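(* Let $\Gamma$ be the fundamental group of a closed surface of negative Euler characteristic and let $\rho:\Gamma\to G=\mathrm{SL}(3,\mathbb R)$ be a $(G,Y)$-Anosov representation which is not hyperconvex. If $\rho$ is strongly irreducible, then the maps $\eta_+:\overline{\mathcal S}_+\to P(V)$ and $\eta_-:\overline{\mathcal S}_-\to P(V)$ are not Lipschitz.
   Context: Flags and frames. $V=\mathbb R^3$ with canonical basis $(e_1,e_2,e_3)$; $V^*$ is its dual, with pairing $\langle\cdot\mid\cdot\rangle$; $P(V),P(V^* )$ are the projective planes. $G=\mathrm{SL}(3,\mathbb R)\cong\mathrm{PGL}(3,\mathbb R)$ acts on $V$, and on $V^*$ by $g^*=(g^{-1})^{T}$. The flag variety is $X=\{([v],[v^*])\in P(V)\times P(V^* ):\langle v\mid v^*\rangle=0\}$. The frame variety $Y$ is the space of triples $([u],[v],[w])$ of non-collinear points of $P(V)$. For distinct $[u],[v]\in P(V)$, $[(uv)^*]\in P(V^* )$ is the class of linear forms vanishing on $\mathrm{span}(u,v)$. Define $\pi_\pm:Y\to X$ by $\pi_+([u],[v],[w])=([u],[(uv)^*])$, $\pi_-([u],[v],[w])=([w],[(wv)^*])$. Let $E^\pm\subset TY$ be the tangent bundle to the fibers of $\pi_\pm$; then $TY=E^+\oplus E^-$, $G$-invariantly. Anosov representations. $\Gamma$ is embedded as a discrete subgroup of $H=\mathrm{SL}(2,\mathbb R)$; $M=\Gamma\backslash H$, with the flow $\Phi^t$ induced by right multiplication by $a^t=\mathrm{diag}(e^t,e^{-t})$. For a representation $\rho:\Gamma\to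 G$, $E_\rho$ is the quotient of $H\times Y$ by $\gamma(h,y)=(\gamma h,\rho(\gamma)y)$, a flat bundle $\pi_\rho:E_\rho\to M$ with fiber $Y$; the flow $(h,y)\mapsto(ha^t,y)$ induces a flow $\Phi^t_\rho$ on $E_\rho$, and $E^\pm$ induce $\Phi_\rho^t$-invariant subbundles $E^\pm_\rho$ of the vertical tangent bundle of $E_\rho$. $\rho$ is $(G,Y)$-Anosov if there is a continuous section $s$ of $\pi_\rho$ whose image $S$ is $\Phi^t_\rho$-invariant and such that, for any continuous norm $\|\cdot\|$ on the vertical tangent bundle, there are $a,b>0$ with $\|D_p\Phi^t_\rho(v^+)\|\le be^{-at}\|v^+\|$ and $\|D_p\Phi^{-t}_\rho(v^-)\|\le be^{-at}\|v^-\|$ for all $p\in S$, $t>0$, and $v^\pm\in E^\pm_\rho$ over $p$. A $(G,Y)$-Anosov representation is hyperconvex if $\rho(\Gamma)$ preserves a strictly convex domain of $P(V)$. $\rho$ is strongly irreducible if no finite index subgroup of $\rho(\Gamma)$ preserves a non-zero proper subspace of $V$. Limit maps. Let $h_+^s=\begin{pmatrix} 1 & s \\ 0 & 1 \end{pmatrix}$, $h_-^s=\begin{pmatrix} 1 & 0 \\ s & 1 \end{pmatrix}$, and let $\mathcal A_\pm$ be the subgroup generated by all $a^t$ and $h^s_\pm$. Put $\overline H=\mathrm{PSL}(2,\mathbb R)$ and $\overline{\mathcal S}_\pm=\overline H/\mathcal A_\pm$, each $H$-equivariantly identified with $\mathbb RP^1$ (with its smooth structure). For a $(G,Y)$-Anosov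 $\rho$, the section $s$ lifts to a continuous map $f:H\to Y$ with $f(\gamma h)=\rho(\gamma)f(h)$ and $f(ha^t)=f(h)$. The map $\pi_\pm\circ f$ is constant on right $\mathcal A_\pm$-orbits and invariant under $h\mapsto -h$, hence induces a continuous $\Gamma$-equivariant map $\bar f_\pm:\overline{\mathcal S}_\pm\to X$; $\eta_\pm$ is the composition of $\bar f_\pm$ with the projection $X\to P(V)$. Lipschitz is meant with respect to Riemannian metrics on $\mathbb RP^1$ and $P(V)$. *)

(* Defs.v *)
From HB Require Import structures.
From mathcomp Require Import all_boot all_order all_algebra.
From mathcomp Require Import all_classical all_reals all_analysis.

Set Implicit Arguments.
Unset Strict Implicit.
Unset Printing Implicit Defensive.
Import Order.TTheory GRing.Theory Num.Theory.
Import numFieldNormedType.Exports.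
Local Open Scope classical_set_scope.
Local Open Scope ring_scope.

(* ---------- Closed surfaces and their fundamental groups ---------- *)

(* Closed surfaces up to homeomorphism: the orientable ones, of genus g, and
   the connected sums of k projective planes.  [Nonorientable 0] is again the
   sphere, which is harmless. *)
Inductive closed_surface : Type :=
  | Orientable (g : nat)
  | Nonorientable (k : nat).

Definition euler_characteristic (S : closed_surface) : int :=
  match S with
  | Orientable g => 2%:Z - (2 * g)%:Z
  | Nonorientable k => 2%:Z - k%:Z
  end.

(* In the orientable case (i, false) is a_i and (i, true) is b_i. *)
Definition generator (S : closed_surface) : Type :=
  match S with
  | Orientable g => ('I_g * bool)%type
  | Nonorientable k => 'I_k
  end.

(* The letter (x, false) is the generator x, and (x, true) its inverse. *)
Definition word (I : Type) : Type := seq (I * bool).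

(* prod_i [a_i, b_i], respectively prod_i c_i^2 *)
Definition relator (S : closed_surface) : word (generator S) :=
  match S return word (generator S) with
  | Orientable g =>
      flatten [seq [:: ((i, false), false); ((i, true), false);
                       ((i, false), true); ((i, true), true)] | i <- enum 'I_g]
  | Nonorientable k =>
      flatten [seq [:: (i, false); (i, false)] | i <- enum 'I_k]
  end.

(* Equality of two words in the group < I | r >. *)
Inductive word_eq (I : Type) (r : word I) : word I -> word I -> Prop :=
  | word_eq_refl w : word_eq r w w
  | word_eq_sym w1 w2 : word_eq r w1 w2 -> word_eq r w2 w1
  | word_eq_trans w1 w2 w3 :
      word_eq r w1 w2 -> word_eq r w2 w3 -> word_eq r w1 w3
  | word_eq_cancel w1 w2 x b :
      word_eq r (w1 ++ [:: (x, b); (x, ~~ b)] ++ w2) (w1 ++ w2)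
  | word_eq_relator w1 w2 : word_eq r (w1 ++ r ++ w2) (w1 ++ w2).

Section LinearGroups.
Variables (R : realType) (n : nat).

Definition SL : set 'M[R]_n := [set g | \det g = 1].

Definition is_subgroup (G D : set 'M[R]_n) : Prop :=
  [/\ D `<=` G, D 1%:M,
      (forall g h, D g -> D h -> D (g *m h)) &
      (forall g, D g -> D (invmx g))].

Definition finite_index (G D : set 'M[R]_n) : Prop :=
  exists2 s : seq 'M[R]_n, (forall h, h \in s -> G h) &
    forall g, G g -> exists2 h, h \in s & D (invmx h *m g).

Definition eval_word (I : Type) (x : I -> 'M[R]_n) (w : word I) : 'M[R]_n :=
  \big[mulmx/1%:M]_(l <- w) (if l.2 then invmx (x l.1) else x l.1).

(* G is isomorphic to pi_1(S): it has generators x for which the standard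
   one-relator presentation of pi_1(S) is a presentation of G. *)
Definition is_fundamental_group (S : closed_surface) (G : set 'M[R]_n) : Prop :=
  exists x : generator S -> 'M[R]_n,
    (forall g, G g <-> exists w, g = eval_word x w) /\
    (forall w, eval_word x w = 1%:M <-> word_eq (relator S) w [::]).

End LinearGroups.
Arguments SL : clear implicits.

Definition discrete_subgroup (R : realType) (Gamma : set 'M[R]_2) : Prop :=
  is_subgroup (SL R 2) Gamma /\ Gamma `<=` isolated Gamma.

Definition representation (R : realType) (Gamma : set 'M[R]_2)
    (rho : 'M[R]_2 -> 'M[R]_3) : Prop :=
  (forall g, Gamma g -> SL R 3 (rho g)) /\
  (forall g h, Gamma g -> Gamma h -> rho (g *m h) = rho g *m rho h).

(* ---------- Projective spaces ---------- *)

(* P(V): the lines of V *)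
Record proj (K : fieldType) (V : vectType K) : Type :=
  Proj { space_of :> {vspace V} ; _ : \dim space_of == 1%N }.
HB.instance Definition _ (K : fieldType) (V : vectType K) :=
  [isSub for @space_of K V].
HB.instance Definition _ (K : fieldType) (V : vectType K) :=
  [Choice of @proj K V by <:].

Section Projective.
Variables (R : realType) (n : nat).
Local Notation V := 'cV[R]_n.+1.

Lemma dim_line_e0 (K : fieldType) (m : nat) (p : nat) :
  \dim <[const_mx 1 : 'M[K]_(m.+1, p.+1)]>%VS == 1%N.
Proof.
rewrite dim_vline; suff -> : (const_mx 1 : 'M[K]_(m.+1, p.+1)) != 0 by [].
by apply/eqP => /matrixP/(_ 0 0)/eqP; rewrite !mxE oner_eq0.
Qed.

(* U as a point of the projective space; a junk value when U is not a line *)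
Definition mkproj (K : fieldType) (m p : nat)
    (U : {vspace 'M[K]_(m.+1, p.+1)}) : proj 'M[K]_(m.+1, p.+1) :=
  insubd (Proj (dim_line_e0 K m p)) U.

Definition line (v : V) : proj V := mkproj <[v]>%VS.

Definition act (g : 'M[R]_n.+1) (l : proj V) : proj V :=
  mkproj (linfun (mulmx g : V -> V) @: l)%VS.

(* The quotient topology for v |-> [v] on the nonzero vectors. *)
Definition proj_open (W : set (proj V)) : Prop :=
  open [set v : V | v != 0 /\ W (line v)].

Lemma proj_openT : proj_open setT.
Proof.
rewrite /proj_open (_ : [set _ | _] = ~` [set (0 : V)]).
  apply: closed_openC; apply: accessible_closed_set1.
  exact: hausdorff_accessible (@norm_hausdorff _ _).
by apply/seteqP; split => v /=; [case=> /eqP | move=> /eqP].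
Qed.

Lemma proj_openI : setI_closed proj_open.
Proof.
move=> A B oA oB; rewrite /proj_open.
rewrite (_ : [set _ | _] = [set v | v != 0 /\ A (line v)] `&`
                           [set v | v != 0 /\ B (line v)]).
  exact: openI.
by apply/seteqP; split => v /=; [case=> ? [] | case=> -[? ?] []].
Qed.

Lemma proj_open_bigU (I : Type) (f : I -> set (proj V)) :
  (forall i, proj_open (f i)) -> proj_open (\bigcup_i f i).
Proof.
move=> of_; rewrite /proj_open.
rewrite (_ : [set _ | _] = \bigcup_i [set v | v != 0 /\ f i (line v)]).
  by apply: bigcup_open => i _; exact: of_.
apply/seteqP; split => v /=.
  by move=> [v0 [i _ fi]]; exists i.
by move=> [i _ [v0 fi]]; split => //; exists i.
Qed.

HB.instance Definition _ :=
  @isOpenTopological.Build (proj V) proj_open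
    proj_openT proj_openI proj_open_bigU.

Definition dot (u v : V) : R := (u^T *m v) 0 0.

(* The angle between two lines: the distance of the round Riemannian metric.
   All Riemannian distances on a compact manifold are Lipschitz equivalent, so
   being Lipschitz does not depend on this choice. *)
Definition dist (l m : proj V) : R :=
  let u := vpick l in let v := vpick m in
  acos (`|dot u v| / (Num.sqrt (dot u u) * Num.sqrt (dot v v))).

End Projective.

Definition lipschitz_map (R : realType) (m n : nat)
    (eta : proj 'cV[R]_m.+1 -> proj 'cV[R]_n.+1) : Prop :=
  exists L : R, forall x y, dist (eta x) (eta y) <= L * dist x y.

(* ---------- Flags and frames; V = 'cV[R]_3 and V^* = 'rV[R]_3 ---------- *)

Section FlagsFrames.
Variable R : realType.
Local Notation V := 'cV[R]_3.
Local Notation Vdual := 'rV[R]_3.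
Local Notation PV := (proj V).
Local Notation PVdual := (proj Vdual).

Definition annihilator (U : {vspace V}) : {vspace Vdual} :=
  (\bigcap_(v <- vbasis U) lker (linfun (mulmxr v : Vdual -> 'M[R]_1)))%VS.

Definition frame_variety : set (PV * PV * PV) :=
  [set y : PV * PV * PV | (y.1.1 + y.1.2 + y.2)%VS = fullv].

(* The flag variety X is the incidence subset of P(V) x P(V^* ), in which pi_plus
   and pi_minus take their values on Y. *)
Definition pi_plus (y : PV * PV * PV) : PV * PVdual :=
  (y.1.1, mkproj (annihilator (y.1.1 + y.1.2))).

Definition pi_minus (y : PV * PV * PV) : PV * PVdual :=
  (y.2, mkproj (annihilator (y.2 + y.1.2))).

Definition act_frame (g : 'M[R]_3) (y : PV * PV * PV) : PV * PV * PV :=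
  (act g y.1.1, act g y.1.2, act g y.2).

(* The tangent bundle TY is described in homogeneous coordinates: [frame] is a
   submersion from GL(3) onto Y whose fibers are the orbits of the right action
   of the diagonal group, and a pair (F, F') with F in GL(3) stands for the
   tangent vector d(frame)_F(F') at frame F.  By differentiating
   F(t) D(t), with D(t) diagonal, (F, F') and (F D, F' D + F D') stand for the
   same tangent vector, and F' stands for 0 iff F' = F D' with D' diagonal. *)
Definition frame (F : 'M[R]_3) : PV * PV * PV :=
  (line (col 0 F), line (col 1 F), line (col ord_max F)).

(* (F, F') is the velocity of a curve in the fiber of p through frame F. *)
Definition tangent_to_fiber (T : Type) (p : PV * PV * PV -> T)
    (F F' : 'M[R]_3) : Prop :=
  exists c : R -> 'M[R]_3,
    [/\ c 0 = F, is_derive (0 : R) (1 : R) c F' &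
        \forall t \near (0 : R),
          c t \in unitmx /\ p (frame (c t)) = p (frame F)].

Definition E_plus := tangent_to_fiber pi_plus.
Definition E_minus := tangent_to_fiber pi_minus.

End FlagsFrames.

(* ---------- Anosov representations ---------- *)

Definition geodesic_flow (R : realType) (t : R) : 'M[R]_2 :=
  diag_mx (\row_(j < 2) (if j == 0 then expR t else expR (- t))).

(* The vertical tangent bundle of E_rho is the quotient of H x TY by Gamma, so
   a continuous norm on it is a Gamma-invariant continuous family of norms;
   N h F F' is the norm of the tangent vector (F, F') at the point (h, frame F).
   Continuity may be tested on H x GL(3) x M(3), since this maps onto H x TY by
   a submersion. *)
Record vertical_norm (R : realType) (Gamma : set 'M[R]_2)
    (rho : 'M[R]_2 -> 'M[R]_3) (N : 'M[R]_2 -> 'M[R]_3 -> 'M[R]_3 -> R) : Prop :=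
  VerticalNorm {
    vnorm_continuous :
      {within [set p : 'M[R]_2 * 'M[R]_3 * 'M[R]_3 |
                 SL R 2 p.1.1 /\ p.1.2 \in unitmx],
        continuous (fun p => N p.1.1 p.1.2 p.2)} ;
    vnorm_well_defined : forall h F F' (d d' : 'rV[R]_3),
      SL R 2 h -> F \in unitmx -> diag_mx d \in unitmx ->
      N h (F *m diag_mx d) (F' *m diag_mx d + F *m diag_mx d') = N h F F' ;
    vnorm_triangle : forall h F F1 F2,
      SL R 2 h -> F \in unitmx -> N h F (F1 + F2) <= N h F F1 + N h F F2 ;
    vnorm_scale : forall h F F' (k : R),
      SL R 2 h -> F \in unitmx -> N h F (k *: F') = `|k| * N h F F' ;
    vnorm_definite : forall h F F',
      SL R 2 h -> F \in unitmx -> N h F F' = 0 ->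
      exists d : 'rV[R]_3, F' = F *m diag_mx d ;
    vnorm_invariant : forall g h F F',
      Gamma g -> SL R 2 h -> F \in unitmx ->
      N (g *m h) (rho g *m F) (rho g *m F') = N h F F' }.

(* Sections of E_rho are the maps h |-> [(h, f h)] with f : H -> Y
   rho-equivariant, and the image of the section is invariant under the flow iff
   f (h a^t) = f h.  The flow of E_rho comes from (h, y) |-> (h a^t, y), so its
   derivative on vertical vectors changes h only. *)
Record anosov_lift (R : realType) (Gamma : set 'M[R]_2)
    (rho : 'M[R]_2 -> 'M[R]_3)
    (f : 'M[R]_2 -> proj 'cV[R]_3 * proj 'cV[R]_3 * proj 'cV[R]_3) : Prop :=
  AnosovLift {
    lift_continuous : {within SL R 2, continuous f} ;
    lift_frame : forall h, SL R 2 h -> frame_variety (f h) ;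
    lift_equivariant : forall g h, Gamma g -> SL R 2 h ->
      f (g *m h) = act_frame (rho g) (f h) ;
    lift_flow : forall h (t : R), SL R 2 h -> f (h *m geodesic_flow t) = f h ;
    lift_contraction : forall N, vertical_norm Gamma rho N ->
      exists a b : R, [/\ 0 < a, 0 < b &
        forall h F F' (t : R),
          SL R 2 h -> F \in unitmx -> frame F = f h -> 0 < t ->
          (E_plus F F' ->
             N (h *m geodesic_flow t) F F' <= b * expR (- (a * t)) * N h F F') /\
          (E_minus F F' ->
             N (h *m geodesic_flow (- t)) F F'
               <= b * expR (- (a * t)) * N h F F')] }.

Definition anosov (R : realType) (Gamma : set 'M[R]_2)
    (rho : 'M[R]_2 -> 'M[R]_3) : Prop :=
  exists f, anosov_lift Gamma rho f.

(* In the affine chart phi = 1 for some linear form phi, the closure of W is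
   compact, W is convex, and the boundary of W contains no segment. *)
Definition strictly_convex_domain (R : realType)
    (W : set (proj 'cV[R]_3)) : Prop :=
  [/\ open W, W !=set0 &
   exists phi : 'rV[R]_3,
   let chart := [set v : 'cV[R]_3 | phi *m v = 1%:M] in
   let point x y (t : R) := line ((1 - t) *: x + t *: y) in
   [/\ (forall l, closure W l -> exists2 v, chart v & l = line v),
       (forall x y t, chart x -> chart y -> W (line x) -> W (line y) ->
          0 <= t <= 1 -> W (point x y t)) &
       (forall x y, chart x -> chart y -> x != y ->
          exists2 t, 0 <= t <= 1 & ~ (closure W `\` W) (point x y t))]].

Definition hyperconvex (R : realType) (Gamma : set 'M[R]_2)
    (rho : 'M[R]_2 -> 'M[R]_3) : Prop :=
  anosov Gamma rho /\
  exists W : set (proj 'cV[R]_3), strictly_convex_domain W /\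
    forall g, Gamma g -> act (rho g) @` W = W.

Definition strongly_irreducible (R : realType) (Gamma : set 'M[R]_2)
    (rho : 'M[R]_2 -> 'M[R]_3) : Prop :=
  forall D : set 'M[R]_3,
    is_subgroup (rho @` Gamma) D -> finite_index (rho @` Gamma) D ->
    forall U : {vspace 'cV[R]_3}, U != 0%VS -> U != fullv ->
    ~ (forall g, D g -> (linfun (mulmx g : 'cV[R]_3 -> 'cV[R]_3) @: U)%VS = U).

(* ---------- Limit maps ---------- *)

(* Modulo +-1, A_+ (resp. A_-) is the stabilizer of [e_1] (resp. [e_2]) in
   RP^1, so that h A_+ |-> h [e_1] and h A_- |-> h [e_2] are the H-equivariant
   identifications of the two coset spaces with RP^1.  [some_rep e x] is some h in
   SL(2) with h [e] = x. *)
Definition some_rep (R : realType) (e : 'cV[R]_2) (x : proj 'cV[R]_2) : 'M[R]_2 :=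
  xget 1%:M [set h | SL R 2 h /\ act h (line e) = x].

Definition eta_plus (R : realType)
    (f : 'M[R]_2 -> proj 'cV[R]_3 * proj 'cV[R]_3 * proj 'cV[R]_3)
    (x : proj 'cV[R]_2) : proj 'cV[R]_3 :=
  (pi_plus (f (some_rep (delta_mx 0 0) x))).1.

Definition eta_minus (R : realType)
    (f : 'M[R]_2 -> proj 'cV[R]_3 * proj 'cV[R]_3 * proj 'cV[R]_3)
    (x : proj 'cV[R]_2) : proj 'cV[R]_3 :=
  (pi_minus (f (some_rep (delta_mx 1 0) x))).1.

(* Main.v *)
(* Suppose eta_+ is Lipschitz.  A vertical norm can be multiplied by any positive
   continuous function on the quotient of H by Gamma, so the Anosov contraction,
   required for all vertical norms, forbids divergent geodesic rays: Gamma is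
   cocompact.  The contraction also shows that eta_+ = eta_- =: eta, and that
   projecting eta from eta(y) gives a continuous function psi_y from RP^1 \ {y}
   to the affine line of all lines through eta(y) but the limit one.  By
   cocompactness, the psi_y form a compact family once normalized by affine maps
   at the source and at the target.  Zooming in at pairs of points which almost
   realize the Lipschitz constant of one of them gives a psi_y which is affine
   on an interval, and zooming in again one which is affine on the whole line.
   By irreducibility it is not constant and y is moved by Gamma, so that eta is
   seen from two of its points through projectively related pencils.  By Steiner's
   theorem eta is a conic, whose interior is a strictly convex domain preserved
   by rho(Gamma), and rho is hyperconvex. *)

From mathcomp Require Import all_boot all_order all_algebra.
From mathcomp Require Import all_classical all_reals all_analysis.
From mathcomp Require Import ring lra zify.
Require Import Defs.

Set Implicit Arguments.
Unset Strict Implicit.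
Unset Printing Implicit Defensive.
Import Order.TTheory GRing.Theory Num.Theory.
Import numFieldNormedType.Exports.
Local Open Scope classical_set_scope.
Local Open Scope ring_scope.

(** * Filters, compactness and matrices *)

(** The contraction is used through diagonal matrices. If g in Gamma brings h a^t back to a compact
    part of SL(2), then [rho g] carries a unit frame over h to one over g h a^t up to a diagonal
    matrix d, and the contraction of E^+ makes |d_0 / d_1| and |d_1 / d_2| exponentially small. If
    two flow lines stay close, one g serves both; the fixed matrix between their frames is then a
    bounded matrix multiplied on its two sides by such diagonal matrices, which forces it to be
    triangular: the two flags agree. Renormalization is an exact identity: replacing h by g h l,
    with l lower triangular, composes psi with an affine map at the source and multiplies it by a
    factor at the target, the translation being absorbed by psi(0) = 0. The obstacle is that this
    factor is not controlled. Hence every condition taken to the limit is homogeneous in psi and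
    closed in the compact set of pairs (h, F), and a limit is a common point of nested closed sets.
    Such a limit may a priori be the zero function; irreducibility excludes this afterwards. *)

Lemma within_continuousP (T S : topologicalType) (A : set T) (g : T -> S) :
  {within A, continuous g} <->
  (forall x (F : set_system T), Filter F -> A x -> F A -> F --> x -> g @ F --> g x).
Proof.
split.
  move=> /subspace_continuousP cg x F FF Ax FA Fx.
  apply: cvg_trans (cg x Ax); apply: cvg_app => B /Fx nB.
  by apply: filterS (filterI FA nB) => y [Ay]; apply.
move=> h; apply/subspace_continuousP => x Ax; apply: h => //.
  exact: withinT.
exact: cvg_within.
Qed.

Lemma continuous_filterP (T S : topologicalType) (g : T -> S) :
  (forall x (F : set_system T), Filter F -> F --> x -> g @ F --> g x) -> continuous g.
Proof. by move=> h x; apply: h. Qed.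

(** Stands in for the extraction of convergent subsequences: when E n consists of the solutions of a
    problem up to an error, or on a range, governed by n, a common point is an exact solution. *)
Lemma nested_compact (T : topologicalType) (A : set T) (E : nat -> set T) :
  compact A -> (forall n, closed (E n)) -> (forall n, E n `<=` A) ->
  (forall m n, (m <= n)%N -> E n `<=` E m) -> (forall n, E n !=set0) ->
  exists x, forall n, E n x.
Proof.
move=> cA clE subE decE neE.
have FF : ProperFilter (filter_from setT E).
  apply: filter_from_proper; last by move=> n _; exact: neE.
  apply: filter_from_filter; first by exists 0%N.
  move=> m n _ _; exists (maxn m n) => // x Ex.
  by split; apply: decE Ex; rewrite ?leq_maxl ?leq_maxr.
have [|x [_ clx]] := cA _ FF; first by exists 0%N => //; exact: subE.
exists x => n; apply: (clE n) => B xB; apply: clx => //.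
by exists n.
Qed.

Lemma within_closed_ge0 (R : realType) (T : topologicalType) (A : set T)
    (g : T -> R) :
  closed A -> {within A, continuous g} -> closed (A `&` [set x | 0 <= g x]).
Proof.
move=> clA /subspace_continuousP cg x clx.
have Ax : A x by apply: clA; apply: closureS clx => y [].
split=> //=.
have PF : ProperFilter (within (A `&` [set x | 0 <= g x]) (nbhs x)).
  exact: within_nbhs_proper.
apply: (@closed_cvg _ R (within (A `&` [set x | 0 <= g x]) (nbhs x)) _ g
   [set y | 0 <= y]).
- exact: closed_ge.
- by apply: (@filterE _ (nbhs x)) => y [].
- apply: cvg_trans (cg _ Ax); apply: cvg_app.
  by move=> B; apply: (@filterS _ (nbhs x)) => y h [Ay _]; exact: h.
Qed.

Lemma compact_le_bound (R : realType) (T : topologicalType) (A : set T)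
    (g : T -> R) :
  compact A -> {within A, continuous g} ->
  exists2 C, 0 < C & forall x, A x -> `|g x| <= C.
Proof.
move=> cA cg; have /compact_bounded[M [_ hM]] := continuous_compact cg cA.
exists (`|M| + 1); first by rewrite ltr_wpDl.
move=> x Ax; apply: (hM (`|M| + 1)); first by rewrite (le_lt_trans (ler_norm M)) ?ltrDl.
by exists x.
Qed.

Lemma compact_ge_bound (R : realType) (T : topologicalType) (A : set T)
    (g : T -> R) :
  compact A -> {within A, continuous g} -> (forall x, A x -> 0 < g x) ->
  exists2 c, 0 < c & forall x, A x -> c <= g x.
Proof.
move=> cA cg g0.
have cV : {within A, continuous (fun x => (g x)^-1)}.
  move: cg => /subspace_continuousP cg; apply/subspace_continuousP => x Ax.
  by apply: cvgV; [rewrite gt_eqF ?g0|exact: cg].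
have [C C0 hC] := compact_le_bound cA cV.
exists C^-1; first by rewrite invr_gt0.
move=> x Ax; rewrite -[g x]invrK lef_pV2 ?posrE ?invr_gt0 ?g0//.
exact: le_trans (ler_norm _) (hC _ Ax).
Qed.

Lemma cvg_mx (R : realType) (T : Type) (F : set_system T) m n
    {FF : Filter F} (f : T -> 'M[R]_(m, n)) (M : 'M[R]_(m, n)) :
  (forall i j, (fun x => f x i j) @ F --> M i j) -> f @ F --> M.
Proof.
move=> h B [P hP sub]; rewrite /nbhs /=.
have : F [set x | forall ij : 'I_m * 'I_n, P ij.1 ij.2 (f x ij.1 ij.2)].
  have := @filter_forall T ('I_m * 'I_n)%type
   (fun ij x => P ij.1 ij.2 (f x ij.1 ij.2)) F FF.
  by apply => -[i j] /=; exact: (h i j _ (hP i j)).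
by apply: filterS => x Px; apply: sub => i j; exact: (Px (i, j)).
Qed.

Lemma cvg_coord (R : realType) (T : Type) (F : set_system T) m n
    {FF : Filter F} (f : T -> 'M[R]_(m, n)) (M : 'M[R]_(m, n)) i j :
  f @ F --> M -> (fun x => f x i j) @ F --> M i j.
Proof.
move=> h; apply: (@cvg_comp _ _ _ f (fun N : 'M[R]_(m,n) => N i j) _ _ _ h).
exact: coord_continuous.
Qed.

Lemma cvg_sum (R : realType) (T : Type) (F : set_system T) (I : Type)
    {FF : Filter F} (r : seq I) (P : pred I) (f : I -> T -> R) (l : I -> R) :
  (forall i, P i -> f i @ F --> l i) ->
  (fun x => \sum_(i <- r | P i) f i x) @ F --> \sum_(i <- r | P i) l i.
Proof.
move=> h; elim: r => [|i r IH].
  under eq_fun do rewrite big_nil.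
  by rewrite big_nil; exact: cvg_cst.
under eq_fun do rewrite big_cons.
by rewrite big_cons; case: ifP => // Pi; apply: cvgD => //; exact: h.
Qed.

Lemma cvg_mulmx (R : realType) (T : Type) (F : set_system T) m n p
    {FF : Filter F} (f : T -> 'M[R]_(m, n)) (g : T -> 'M[R]_(n, p)) (M : 'M[R]_(m, n)) (N : 'M[R]_(n, p)) :
  f @ F --> M -> g @ F --> N -> (fun x => f x *m g x) @ F --> M *m N.
Proof.
move=> hf hg; apply: cvg_mx => i j.
under eq_fun do rewrite mxE.
rewrite mxE; apply: cvg_sum => k _.
by apply: cvgM; exact: cvg_coord.
Qed.

Lemma cvg_trmx (R : realType) (T : Type) (F : set_system T) m n
    {FF : Filter F} (f : T -> 'M[R]_(m, n)) (M : 'M[R]_(m, n)) :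
  f @ F --> M -> (fun x => (f x)^T) @ F --> M^T.
Proof.
move=> hf; apply: cvg_mx => i j.
under eq_fun do rewrite mxE.
by rewrite mxE; exact: cvg_coord.
Qed.

Lemma cvg_prod (R : realType) (T : Type) (F : set_system T) (I : Type)
    {FF : Filter F} (r : seq I) (f : I -> T -> R) (l : I -> R) :
  (forall i, f i @ F --> l i) ->
  (fun x => \prod_(i <- r) f i x) @ F --> \prod_(i <- r) l i.
Proof.
move=> h; elim: r => [|i r IH].
  under eq_fun do rewrite big_nil.
  by rewrite big_nil; exact: cvg_cst.
under eq_fun do rewrite big_cons.
by rewrite big_cons; apply: cvgM.
Qed.

Lemma cvg_det (R : realType) (T : Type) (F : set_system T) n
    {FF : Filter F} (f : T -> 'M[R]_n) (M : 'M[R]_n) :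
  f @ F --> M -> (fun x => \det (f x)) @ F --> \det M.
Proof.
move=> hf; apply: cvg_sum => s _; apply: cvgM; first exact: cvg_cst.
by apply: cvg_prod => i; exact: cvg_coord.
Qed.

Lemma cvg_adj (R : realType) (T : Type) (F : set_system T) n
    {FF : Filter F} (f : T -> 'M[R]_n) (M : 'M[R]_n) :
  f @ F --> M -> (fun x => \adj (f x)) @ F --> \adj M.
Proof.
move=> hf; apply: cvg_mx => i j.
under eq_fun do rewrite mxE.
rewrite mxE; apply: cvgM; first exact: cvg_cst.
apply: cvg_det; apply: cvg_mx => k l.
under eq_fun do rewrite !mxE.
by rewrite !mxE; exact: cvg_coord.
Qed.

Lemma compact_box (R : realType) m n (C : R) :
  compact [set M : 'M[R]_(m, n) | forall i j, `|M i j| <= C].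
Proof.
have cK : compact [set v : 'rV[R]_(m * n) | forall i, `|v ord0 i| <= C].
  have -> : [set v : 'rV[R]_(m * n) | forall i, `|v ord0 i| <= C] =
    [set v : 'rV[R]_(m * n) | forall i, `[-C, C]%classic (v ord0 i)].
    by apply/seteqP; split => v /= h i; move: (h i); rewrite in_itv /= ler_norml.
  by apply: (@rV_compact _ _ (fun=> `[-C, C]%classic)) => _; exact: segment_compact.
have cv : continuous (@vec_mx R m n).
  move=> v; apply: (@cvg_mx _ _ (nbhs v)) => i j.
  under eq_fun do rewrite mxE.
  by rewrite mxE; exact: coord_continuous.
have := @continuous_compact _ _ (@vec_mx R m n) _ (continuous_subspaceT cv) cK.
congr compact; apply/seteqP; split=> [M [v /= hv <-] i j|M hM /=].
  by rewrite mxE.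
exists (mxvec M); last exact: mxvecK.
by move=> k; rewrite ord1; case/mxvec_indexP: k => i j; rewrite mxvecE.
Qed.

Lemma closed_det1 (R : realType) n : closed [set M : 'M[R]_n | \det M = 1].
Proof.
have cd : continuous (fun M : 'M[R]_n => \det M).
  by move=> M; apply: (@cvg_det R _ (nbhs M) n _ id); exact: cvg_id.
have := @preimage_closed _ _ (fun M : 'M[R]_n => \det M) [set 1] (fun M _ => cd M).
apply; exact: accessible_closed_set1 (hausdorff_accessible (@norm_hausdorff _ _)) _.
Qed.

Lemma within_closed_eq (T S : topologicalType) (A : set T) (g1 g2 : T -> S) :
  hausdorff_space S -> closed A -> {within A, continuous g1} ->
  {within A, continuous g2} -> closed (A `&` [set x | g1 x = g2 x]).
Proof.
move=> hS clA /within_continuousP c1 /within_continuousP c2 x clx.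
have Ax : A x by apply: clA; apply: closureS clx => y [].
split=> //=.
pose F := within (A `&` [set x | g1 x = g2 x]) (nbhs x).
have PF : ProperFilter F by exact: within_nbhs_proper.
have FA : F A by apply: (@filterE _ (nbhs x)) => y [].
have Fx : F --> x by exact: cvg_within.
have h1 : g1 @ F --> g1 x by exact: c1.
have h2 : g2 @ F --> g2 x by exact: c2.
have h3 : g1 @ F --> g2 x.
  apply: cvg_trans h2; apply: near_eq_cvg.
  by apply: (@filterE _ (nbhs x)) => y [].
exact: (cvg_unique hS h1 h3).
Qed.

(** * Lines and projectors *)

Section ProjectiveLemmas.
Variables (R : realType) (n : nat).
Local Notation V := 'cV[R]_n.+1.

Lemma dotE (u v : V) : dot u v = \sum_i u i 0 * v i 0.
Proof. by rewrite /dot mxE; apply: eq_bigr => i _; rewrite mxE. Qed.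

Lemma dotZl (c : R) (u v : V) : dot (c *: u) v = c * dot u v.
Proof. by rewrite /dot linearZ /= -scalemxAl mxE. Qed.

Lemma dotZr (c : R) (u v : V) : dot u (c *: v) = c * dot u v.
Proof. by rewrite /dot -scalemxAr mxE. Qed.

Lemma dot_ge0 (v : V) : 0 <= dot v v.
Proof. by rewrite dotE sumr_ge0 // => i _; rewrite -expr2 sqr_ge0. Qed.

Lemma dot_eq0 (v : V) : (dot v v == 0) = (v == 0).
Proof.
apply/eqP/eqP => [|->]; last by rewrite dotE big1 // => i _; rewrite mxE mul0r.
rewrite dotE => /eqP; rewrite psumr_eq0; last by move=> i _; rewrite -expr2 sqr_ge0.
move=> /allP h; apply/colP => i; rewrite mxE.
by have /implyP/(_ isT) := h i (mem_index_enum i); rewrite mulf_eq0 orbb => /eqP.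
Qed.

Lemma dot_gt0 (v : V) : v != 0 -> 0 < dot v v.
Proof. by move=> v0; rewrite lt_neqAle dot_ge0 eq_sym dot_eq0 v0. Qed.

Lemma line_space (v : V) : v != 0 -> space_of (line v) = <[v]>%VS.
Proof.
move=> v0; rewrite /line /mkproj.
have d1 : \dim <[v]>%VS == 1%N by rewrite dim_vline v0.
exact: (@insubdK _ _ (proj V) (Proj (dim_line_e0 R n 0)) _ d1).
Qed.

Lemma space_inj (l m : proj V) : space_of l = space_of m -> l = m.
Proof. by move=> e; apply: val_inj. Qed.

Lemma line_eqP (v w : V) : v != 0 -> w != 0 ->
  line v = line w <-> exists c, w = c *: v.
Proof.
move=> v0 w0; split.
  move=> e; have := congr1 (@space_of _ _) e; rewrite !line_space // => e'.
  by apply/vlineP; rewrite e' memv_line.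
move=> [c cE]; apply: space_inj; rewrite !line_space // cE; apply/esym.
have c0 : c != 0 by apply: contraNneq w0 => c0; rewrite cE c0 scale0r.
apply/eqP; rewrite eqEsubv; apply/andP; split; first by rewrite -memvE; apply/vlineP; exists c.
by rewrite -memvE; apply/vlineP; exists c^-1; rewrite scalerA mulVf // scale1r.
Qed.

Lemma lineZ (c : R) (v : V) : c != 0 -> v != 0 -> line (c *: v) = line v.
Proof.
move=> c0 v0; apply/esym/line_eqP => //; last by exists c.
by rewrite scaler_eq0 negb_or c0.
Qed.

Lemma vpick_proj_neq0 (l : proj V) : vpick l != 0.
Proof.
by rewrite vpick0 -dimv_eq0; case: l => U /= /eqP ->.
Qed.

Lemma line_vpick (l : proj V) : line (vpick l) = l.
Proof.
have v0 := vpick_proj_neq0 l.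
apply: space_inj; rewrite line_space //; apply/eqP.
by rewrite eqEdim -memvE memv_pick /= dim_vline v0; case: l {v0} => U /= /eqP ->.
Qed.

Lemma act_line (g : 'M[R]_n.+1) (v : V) :
  g \in unitmx -> v != 0 -> act g (line v) = line (g *m v).
Proof.
move=> gU v0; rewrite /act line_space // limg_line lfunE /=.
by [].
Qed.

Lemma mulmx_neq0 (g : 'M[R]_n.+1) (v : V) :
  g \in unitmx -> v != 0 -> g *m v != 0.
Proof.
move=> gU; apply: contra_neq => h.
by rewrite -[v](mulKmx gU) h mulmx0.
Qed.

Lemma act1 (l : proj V) : act 1%:M l = l.
Proof.
by rewrite -{1}(line_vpick l) act_line ?unitmx1 ?vpick_proj_neq0 // mul1mx line_vpick.
Qed.

Lemma actM (g h : 'M[R]_n.+1) (l : proj V) :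
  g \in unitmx -> h \in unitmx -> act (g *m h) l = act g (act h l).
Proof.
move=> gU hU; rewrite -(line_vpick l).
rewrite !act_line ?mulmx_neq0 ?vpick_proj_neq0 ?unitmx_mul ?gU //.
by rewrite mulmxA.
Qed.

(** The orthogonal projection onto l. It embeds P(V) in a space of matrices without a choice of sign
    for a unit vector, so that continuity of a map into P(V) can be exploited entry by entry. *)
Definition projector (l : proj V) : 'M[R]_n.+1 :=
  (dot (vpick l) (vpick l))^-1 *: (vpick l *m (vpick l)^T).

Lemma projector_line (v : V) : v != 0 ->
  projector (line v) = (dot v v)^-1 *: (v *m v^T).
Proof.
move=> v0; rewrite /projector.
have w0 := vpick_proj_neq0 (line v).
have /(line_eqP v0 w0)[c cE] : line v = line (vpick (line v)) by rewrite line_vpick.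
rewrite cE dotZl dotZr linearZ /= -scalemxAl -scalemxAr !scalerA.
have c0 : c != 0 by apply: contraNneq w0 => c0; rewrite cE c0 scale0r.
have := dot_gt0 v0 => /lt0r_neq0 d0.
by congr (_ *: _); field; rewrite d0 c0.
Qed.

Lemma projector_unit (v : V) : dot v v = 1 -> projector (line v) = v *m v^T.
Proof.
move=> v1; rewrite projector_line; first by rewrite v1 invr1 scale1r.
by rewrite -dot_eq0 v1 oner_eq0.
Qed.

Lemma projector_inj : injective projector.
Proof.
move=> l m; rewrite -(line_vpick l) -(line_vpick m).
have v0 := vpick_proj_neq0 l; have w0 := vpick_proj_neq0 m.
move: (vpick l) (vpick m) v0 w0 => v w v0 w0.
rewrite !projector_line // => /(congr1 (fun M => M *m w)) /esym.
rewrite -!scalemxAl -!mulmxA [w^T *m w]mx11_scalar -/(dot w w).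
rewrite [v^T *m w]mx11_scalar -/(dot v w) !mul_mx_scalar !scalerA.
rewrite mulVf ?gt_eqF ?dot_gt0 // scale1r => wE.
by apply/line_eqP => //; eexists; exact: wE.
Qed.

Lemma cvg_dot (T : Type) (F : set_system T) {FF : Filter F} (f g : T -> V)
    (u v : V) : f @ F --> u -> g @ F --> v -> (fun x => dot (f x) (g x)) @ F --> dot u v.
Proof.
move=> hf hg; rewrite /dot.
exact: (cvg_coord (cvg_mulmx (cvg_trmx hf) hg)).
Qed.

Lemma projector_continuous : continuous projector.
Proof.
move=> l; rewrite -(line_vpick l).
have v0 := vpick_proj_neq0 l; move: (vpick l) v0 => v v0.
move=> B hB; pose W := B°.
have oW : open W by exact: open_interior.
have Wv : W (projector (line v)) by exact: hB.
apply: (@filterS _ (nbhs (line v)) _ (projector @^-1` W)).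
  by move=> x; exact: interior_subset.
suff : open (projector @^-1` W) by move=> oPW; apply: open_nbhs_nbhs; split.
change (proj_open (projector @^-1` W)); rewrite /proj_open openE => w /= [w0 Ww].
have cP : (fun w : V => (dot w w)^-1 *: (w *m w^T)) @ w -->
    (dot w w)^-1 *: (w *m w^T).
  apply: (@cvg_mx _ _ (nbhs w)) => i j; under eq_fun do rewrite mxE.
  rewrite mxE; apply: cvgM.
    apply: cvgV; first by rewrite gt_eqF ?dot_gt0.
    by apply: (@cvg_dot _ (nbhs w)); exact: cvg_id.
  apply: cvg_coord; apply: (@cvg_mulmx _ _ (nbhs w)); first exact: cvg_id.
  by apply: (@cvg_trmx _ _ (nbhs w)); exact: cvg_id.
have nW : nbhs (projector (line w)) W := open_nbhs_nbhs (conj oW Ww).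
rewrite projector_line // in nW.
have {}nW : nbhs w [set x : V | W ((dot x x)^-1 *: (x *m x^T))] := cP _ nW.
have nw0 : nbhs w [set x : V | x != 0].
  have : proj_open [set: proj V] by exact: proj_openT.
  rewrite /proj_open openE => o0.
  exact: (@filterS _ (nbhs w) _ _ _ (fun x (h : _ /\ _) => proj1 h) (o0 w (conj w0 I))).
apply: (@filterS _ (nbhs w) _ _ _ _ (filterI nW nw0)) => x [Wx x0].
split; first exact: x0.
by change (W (projector (line x))); rewrite projector_line; [exact: Wx|exact: x0].
Qed.

End ProjectiveLemmas.

(** * Elements of SL(2) *)

Section SL2.
Variable R : realType.
Implicit Types g h m : 'M[R]_2.

Lemma SL_unit n (g : 'M[R]_n) : SL R n g -> g \in unitmx.
Proof. by rewrite /SL /= unitmxE => ->; rewrite unitr1. Qed.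

Lemma SL1 n : SL R n 1%:M.
Proof. by rewrite /SL /= det1. Qed.

Lemma SL_mul n (g h : 'M[R]_n) : SL R n g -> SL R n h -> SL R n (g *m h).
Proof. by rewrite /SL /= det_mulmx => -> ->; rewrite mulr1. Qed.

Lemma SL_inv n (g : 'M[R]_n) : SL R n g -> SL R n (invmx g).
Proof. by rewrite /SL /= det_inv => ->; rewrite invr1. Qed.

(** Equal to 2 cosh d(i, g i) on SL(2), for the hyperbolic distance of the upper half-plane: it
    plays the part of a distance to the base point. *)
Definition nrm2 (g : 'M[R]_2) : R := \tr (g *m g^T).

Lemma sum2 (f : 'I_2 -> R) : \sum_i f i = f 0 + f 1.
Proof. by rewrite big_ord_recl big_ord1; congr (_ + f _); apply: val_inj. Qed.

Lemma mulmx2E g h i j : (g *m h) i j = g i 0 * h 0 j + g i 1 * h 1 j.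
Proof. by rewrite mxE sum2. Qed.

Lemma nrm2E g : nrm2 g = g 0 0 ^+ 2 + g 0 1 ^+ 2 + (g 1 0 ^+ 2 + g 1 1 ^+ 2).
Proof. by rewrite /nrm2 /mxtrace sum2 !mxE !sum2 !mxE -!expr2. Qed.

Lemma det2 g : \det g = g 0 0 * g 1 1 - g 0 1 * g 1 0.
Proof.
rewrite (expand_det_row _ 0) sum2 /cofactor !det_mx11 !mxE /= expr0 expr1.
have -> : lift 0 0 = 1 :> 'I_2 by exact: val_inj.
have -> : lift 1 0 = 0 :> 'I_2 by exact: val_inj.
by rewrite mul1r mulN1r mulrN.
Qed.

Lemma mx2P g h : g 0 0 = h 0 0 -> g 0 1 = h 0 1 -> g 1 0 = h 1 0 ->
  g 1 1 = h 1 1 -> g = h.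
Proof.
move=> e1 e2 e3 e4; apply/matrixP => i j.
have o2 (k : 'I_2) : k = 0 \/ k = 1.
  by case: k => -[|[|//]] ?; [left|right]; apply: val_inj.
by case: (o2 i) => ->; case: (o2 j) => ->.
Qed.

Lemma nrm2_ge0 g : 0 <= nrm2 g.
Proof. by rewrite nrm2E !addr_ge0 ?sqr_ge0. Qed.

Lemma nrm2_ge2 g : SL R 2 g -> 2 <= nrm2 g.
Proof.
rewrite /SL /= det2 nrm2E => e.
have h1 := sqr_ge0 (g 0 0 - g 1 1); have h2 := sqr_ge0 (g 0 1 + g 1 0).
nra.
Qed.

Lemma entry_nrm2 g i j : g i j ^+ 2 <= nrm2 g.
Proof.
have o2 (k : 'I_2) : k = 0 \/ k = 1.
  by case: k => -[|[|//]] ?; [left|right]; apply: val_inj.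
have := (sqr_ge0 (g 0 0), sqr_ge0 (g 0 1), sqr_ge0 (g 1 0), sqr_ge0 (g 1 1)).
move=> [[[h1 h2] h3] h4]; rewrite nrm2E.
by case: (o2 i) => ->; case: (o2 j) => ->; lra.
Qed.

Lemma nrm2_mul g m : nrm2 (g *m m) <= nrm2 g * nrm2 m.
Proof.
rewrite !nrm2E !mxE !sum2.
set a := g 0 0; set b := g 0 1; set c := g 1 0; set d := g 1 1.
set x := m 0 0; set y := m 0 1; set z := m 1 0; set t := m 1 1.
have h1 := sqr_ge0 (a * z - b * x); have h2 := sqr_ge0 (a * t - b * y).
have h3 := sqr_ge0 (c * z - d * x); have h4 := sqr_ge0 (c * t - d * y).
rewrite -subr_ge0.
have -> : (a ^+ 2 + b ^+ 2 + (c ^+ 2 + d ^+ 2)) * (x ^+ 2 + y ^+ 2 + (z ^+ 2 + t ^+ 2)) -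
  ((a * x + b * z) ^+ 2 + (a * y + b * t) ^+ 2 + ((c * x + d * z) ^+ 2 + (c * y + d * t) ^+ 2))
  = (a * z - b * x) ^+ 2 + (a * t - b * y) ^+ 2 + (c * z - d * x) ^+ 2 + (c * t - d * y) ^+ 2 by ring.
by rewrite !addr_ge0.
Qed.

Lemma invmx2 g : SL R 2 g -> [/\ invmx g 0 0 = g 1 1, invmx g 0 1 = - g 0 1,
  invmx g 1 0 = - g 1 0 & invmx g 1 1 = g 0 0].
Proof.
move=> dg; have gU := SL_unit dg.
have E : (\matrix_(i, j) (if i == 0 then (if j == 0 then g 1 1 else - g 0 1)
   else (if j == 0 then - g 1 0 else g 0 0))) *m g = 1%:M.
  move: dg; rewrite /SL /= det2 => dg.
  by apply: mx2P; rewrite !mxE !sum2 !mxE /= -?dg; ring.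
have -> : invmx g = \matrix_(i, j) (if i == 0 then (if j == 0 then g 1 1 else - g 0 1)
   else (if j == 0 then - g 1 0 else g 0 0)).
  by rewrite -[LHS]mul1mx -E mulmxK.
by rewrite !mxE.
Qed.

Lemma nrm2_inv g : SL R 2 g -> nrm2 (invmx g) = nrm2 g.
Proof. by move=> /invmx2[e1 e2 e3 e4]; rewrite !nrm2E e1 e2 e3 e4 !sqrrN; ring. Qed.

Lemma nrm2_cancel g h : SL R 2 h -> nrm2 g <= nrm2 (g *m h) * nrm2 h.
Proof.
move=> dh; have := nrm2_mul (g *m h) (invmx h).
by rewrite mulmxK ?SL_unit // nrm2_inv.
Qed.

Lemma cvg_nrm2 (T : Type) (F : set_system T) {FF : Filter F} (f : T -> 'M[R]_2) m :
  f @ F --> m -> (fun x => nrm2 (f x)) @ F --> nrm2 m.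
Proof.
move=> hf; apply: cvg_sum => i _; apply: cvg_coord; apply: cvg_mulmx => //.
exact: cvg_trmx.
Qed.

Lemma nrm2_continuous : continuous (nrm2 : 'M[R]_2 -> R).
Proof. by apply: continuous_filterP => g F FF Fg; apply: cvg_nrm2. Qed.

Lemma ball_compact (B : R) : compact [set g | SL R 2 g /\ nrm2 g <= B].
Proof.
apply: (@subclosed_compact _ _ [set M : 'M[R]_2 | forall i j, `|M i j| <= 1 + B]).
- have c1 : closed (SL R 2) := @closed_det1 R 2.
  have c2 : closed [set g : 'M[R]_2 | nrm2 g <= B].
    have := @preimage_closed _ _ nrm2 [set x | x <= B] (fun M _ => @nrm2_continuous M).
    by apply; exact: closed_le.
  exact: closedI c1 c2.
- exact: compact_box.
- move=> g /= [_ gB] i j.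
  have := le_trans (entry_nrm2 g i j) gB.
  have B0 := le_trans (nrm2_ge0 g) gB.
  move=> h; apply: le_trans (_ : Num.sqrt B <= _).
    by rewrite -sqrtr_sqr ler_sqrt.
  have := sqr_ge0 (Num.sqrt B - 1); have := sqr_sqrtr B0; have := sqrtr_ge0 B.
  nra.
Qed.

(* A bound of tr (g m m^T g^T) / tr (g g^T), continuous in m and 1 at m = 1 *)
Definition distortion m : R :=
  1 + \sum_i \sum_j `|(m *m m^T - 1%:M) i j|.

Lemma nrm2_distortion g m : nrm2 (g *m m) <= nrm2 g * distortion m.
Proof.
have E : nrm2 (g *m m) = nrm2 g + \sum_i \sum_j \sum_k (g k i * g k j) * (m *m m^T - 1%:M) i j.
  rewrite !nrm2E !sum2 !mxE !sum2 !mxE /=.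
  by ring.
rewrite E /distortion mulrDr mulr1 lerD2l mulr_sumr ler_sum // => i _.
rewrite mulr_sumr ler_sum // => j _.
rewrite -mulr_suml; apply: le_trans (ler_norm _) _; rewrite normrM.
apply: ler_wpM2r => //; apply: le_trans (ler_norm_sum _ _ _) _.
have o2 (k : 'I_2) : k = 0 \/ k = 1.
  by case: k => -[|[|//]] ?; [left|right]; apply: val_inj.
have am (x y : R) : `|x * y| <= (x ^+ 2 + y ^+ 2) / 2.
  rewrite ler_norml; have := sqr_ge0 (x - y); have := sqr_ge0 (x + y) => h1 h2.
  by apply/andP; split; nra.
rewrite sum2 nrm2E.
have := (am (g 0 i) (g 0 j), am (g 1 i) (g 1 j)); move=> [h1 h2].
have := (sqr_ge0 (g 0 0), sqr_ge0 (g 0 1), sqr_ge0 (g 1 0), sqr_ge0 (g 1 1)).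
move=> [[[k1 k2] k3] k4].
by case: (o2 i) h1 h2 => ->; case: (o2 j) => -> h1 h2; lra.
Qed.

Lemma distortion1 : distortion 1%:M = 1.
Proof.
rewrite /distortion big1 ?addr0 // => i _; rewrite big1 // => j _.
by rewrite trmx1 mulmx1 subrr mxE normr0.
Qed.

Lemma cvg_distortion (T : Type) (F : set_system T) {FF : Filter F}
    (f : T -> 'M[R]_2) m :
  f @ F --> m -> (fun x => distortion (f x)) @ F --> distortion m.
Proof.
move=> hf; apply: cvgD; first exact: cvg_cst.
apply: cvg_sum => i _; apply: cvg_sum => j _.
apply: cvg_norm; under eq_fun do rewrite mxE; rewrite mxE.
apply: cvgD; last exact: cvg_cst.
by apply: cvg_coord; apply: cvg_mulmx => //; exact: cvg_trmx.
Qed.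

End SL2.

(** * Discrete subgroups *)

Lemma seq_argmin (R : realType) (T : eqType) (f : T -> R) (s : seq T) x0 :
  x0 \in s -> exists2 x, x \in s & forall y, y \in s -> f x <= f y.
Proof.
elim: s x0 => [//|a s IH] x0 _.
case: s IH => [|b s] IH.
  by exists a; rewrite ?mem_head // => y; rewrite inE => /eqP ->.
have [x xs hx] := IH b (mem_head _ _).
case: (leP (f a) (f x)) => ax.
  exists a; first exact: mem_head.
  by move=> y; rewrite inE => /orP[/eqP ->//|/hx]; exact: le_trans.
exists x; first by rewrite inE xs orbT.
by move=> y; rewrite inE => /orP[/eqP ->|/hx//]; exact: ltW.
Qed.

Section Discrete.
Variables (R : realType) (Gamma : set 'M[R]_2).
Hypothesis dG : discrete_subgroup Gamma.

Lemma Gamma_SL g : Gamma g -> SL R 2 g.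
Proof. by case: dG => -[s _ _ _] _ /s. Qed.

Lemma Gamma_unit g : Gamma g -> g \in unitmx.
Proof. by move=> /Gamma_SL /SL_unit. Qed.

Lemma Gamma1 : Gamma 1%:M. Proof. by case: dG => -[]. Qed.

Lemma GammaM g h : Gamma g -> Gamma h -> Gamma (g *m h).
Proof. by case: dG => -[_ _ m _] _; exact: m. Qed.

Lemma GammaV g : Gamma g -> Gamma (invmx g).
Proof. by case: dG => -[_ _ _ m] _; exact: m. Qed.

Lemma Gamma_separated : exists2 e : R, 0 < e & forall g, Gamma g ->
  (forall i j, `|(g - 1%:M) i j| < e) -> g = 1%:M.
Proof.
case: dG => _ /(_ _ Gamma1)[_ [V /nbhs_ballP[e /= e0 eV] VG]].
exists e => // g Gg h.
have : (V `&` Gamma) g.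
  split=> //; apply: eV; split=> // i j.
  by have := h i j; rewrite !mxE -normrN opprB.
by rewrite VG.
Qed.

Lemma Gamma_ball_finite (B : R) : finite_set [set g | Gamma g /\ nrm2 g <= B].
Proof.
have [e e0 he] := Gamma_separated.
pose C := 1 + `|B|; have C0 : 0 < C by rewrite /C ltr_wpDr.
(* C bounds the entries of g and of its inverse. Two elements whose entries lie in the same cells of
   a grid of mesh d satisfy |(g^-1 (h - g)) i j| < 2 C d = e, hence are equal; there are finitely
   many cells. *)
pose d := e / (2 * C); have d0 : 0 < d by rewrite /d divr_gt0 // mulr_gt0.
have bound g i j : nrm2 g <= B -> `|g i j| <= C.
  move=> gB; have h := le_trans (entry_nrm2 g i j) gB.
  rewrite -(ler_pXn2r (ltn0Sn 1)) ?nnegrE ?(ltW C0) //.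
  rewrite real_normK ?num_real // /C (le_trans h) //.
  by have := ler_norm B; have := normr_ge0 B; set b := `|B|; nra.
pose M := Num.truncn (C / d).
have MP : C / d < M.+1%:R by rewrite truncnS_gt.
pose k (x : R) : nat := absz (Num.floor (x / d) + M.+1%:Z).
have k_lt x : `|x| <= C -> (k x < M.+1.*2.+1)%N.
  move=> xC; rewrite /k.
  have /andP[f1 f2] := floor_itv (x / d).
  have xd : `|x / d| < M.+1%:R.
    by rewrite normrM normfV (gtr0_norm d0); apply: le_lt_trans MP; rewrite ler_pM2r ?invr_gt0.
  move: xd; rewrite ltr_norml => /andP[x1 x2].
  have l1 : (- (M.+1%:Z) <= Num.floor (x / d))%R.
    by rewrite -ltzD1 -(ltr_int R) (lt_trans _ f2) // rmorphN.
  have l2 : (Num.floor (x / d) < M.+1%:Z)%R.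
    by rewrite -(ltr_int R) (le_lt_trans f1).
  rewrite -ltz_nat gez0_abs; last by rewrite -lerBlDr sub0r.
  rewrite -addnn -addn1 !PoszD; lia.
pose q (g : 'M[R]_2) : {ffun 'I_2 * 'I_2 -> 'I_(M.+1.*2.+1)} :=
  [ffun ij => inord (k (g ij.1 ij.2))].
suff qi : {in [set g | Gamma g /\ nrm2 g <= B] &, injective q}.
  by rewrite -(eq_finite_set (inj_card_eq qi)); exact: finite_finset.
move=> g h; rewrite !inE => -[Gg gB] [Gh hB] /ffunP qe.
have close i j : `|(h - g) i j| < d.
  have := qe (i, j); rewrite !ffunE /= => /(congr1 val) /=.
  rewrite !inordK ?k_lt ?bound // /k => ke.
  have nn x : `|x| <= C -> (0 <= Num.floor (x / d) + M.+1%:Z)%R.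
    move=> xC; have /andP[f1 f2] := floor_itv (x / d).
    have xd : `|x / d| < M.+1%:R.
      by rewrite normrM normfV (gtr0_norm d0); apply: le_lt_trans MP; rewrite ler_pM2r ?invr_gt0.
    move: xd; rewrite ltr_norml => /andP[x1 x2].
    by rewrite -lerBlDr sub0r -ltzD1 -(ltr_int R) (lt_trans _ f2) // rmorphN.
  have {}ke : Num.floor (g i j / d) = Num.floor (h i j / d).
    apply: (@addIr _ M.+1%:Z).
    by rewrite -(gez0_abs (nn _ (bound g i j gB))) -(gez0_abs (nn _ (bound h i j hB))) ke.
  have /andP[g1 g2] := floor_itv (g i j / d).
  have /andP[h1 h2] := floor_itv (h i j / d).
  rewrite -ke in h1 h2; rewrite intrD in g2 h2.
  have : `|(h i j - g i j) / d| < 1 by rewrite mulrBl ltr_norml; apply/andP; split; lra.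
  by rewrite normrM normfV (gtr0_norm d0) ltr_pdivrMr // mul1r !mxE.
have E : invmx g *m h = 1%:M.
  apply: he; first by apply: GammaM => //; exact: GammaV.
  move=> i j.
  have -> : invmx g *m h - 1%:M = invmx g *m (h - g).
    by rewrite mulmxBr mulVmx // Gamma_unit.
  rewrite mxE sum2.
  have c1 := close 0 j; have c2 := close 1 j.
  have bi k' : `|invmx g i k'| <= C.
    by apply: bound; rewrite nrm2_inv //; exact: Gamma_SL.
  apply: le_lt_trans (ler_normD _ _) _; rewrite !normrM.
  have eE : e = C * d + C * d by rewrite /d; field; rewrite gt_eqF.
  rewrite eE; apply: ltrD; apply: le_lt_trans (ler_wpM2r (normr_ge0 _) (bi _)) _;
    by rewrite ltr_pM2l.
by rewrite -[h](mulKVmx (Gamma_unit Gg)) E mulmx1.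
Qed.

Lemma Gamma_ball_seq (B : R) : exists2 s : seq 'M[R]_2, uniq s &
  forall g, (g \in s) <-> Gamma g /\ nrm2 g <= B.
Proof.
have /finite_seqP[s hs] := Gamma_ball_finite B.
exists (undup s); first exact: undup_uniq.
move=> g; rewrite mem_undup; split=> [gs|h].
  by have : [set` s] g by []; rewrite -hs.
by have : [set g | Gamma g /\ nrm2 g <= B] g by []; rewrite hs.
Qed.

(** By [nrm2_cancel], an element with nrm2 g' > (nrm2 h)^2 moves h farther than 1 does, so only
    finitely many elements compete. *)
Lemma orbit_min h : SL R 2 h ->
  exists2 g, Gamma g & forall g', Gamma g' -> nrm2 (g *m h) <= nrm2 (g' *m h).
Proof.
move=> dh; have [s us hs] := Gamma_ball_seq (nrm2 h * nrm2 h).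
have s1 : 1%:M \in s.
  apply/hs; split; first exact: Gamma1.
  by rewrite -[X in X <= _]mul1r; have := nrm2_cancel 1%:M dh; rewrite mul1mx mul1r.
have [g /hs[Gg _] hg] := seq_argmin (fun g => nrm2 (g *m h)) s1.
exists g => // g' Gg'; case: (leP (nrm2 g') (nrm2 h * nrm2 h)) => c.
  by apply: hg; apply/hs.
apply: le_trans (hg _ s1) _; rewrite mul1mx.
have := nrm2_cancel g' dh => c2.
have := lt_le_trans c c2; have h2 := nrm2_ge2 dh.
by rewrite ltr_pM2r; [exact: ltW|lra].
Qed.

(** Up to 2 cosh, the distance in the quotient from the image of the base point: a proper function
    on the quotient of SL(2) by Gamma. *)
Definition depth (h : 'M[R]_2) : R := inf [set nrm2 (g *m h) | g in Gamma].

Lemma depth_le g h : Gamma g -> depth h <= nrm2 (g *m h).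
Proof.
move=> Gg; apply: ge_inf; last by exists g.
by exists 0 => _ [g' _ <-]; exact: nrm2_ge0.
Qed.

Lemma depth_attained h : SL R 2 h -> exists2 g, Gamma g & depth h = nrm2 (g *m h).
Proof.
move=> dh; have [g Gg hg] := orbit_min dh; exists g => //.
apply/le_anti/andP; split; first exact: depth_le.
apply: lb_le_inf; first by exists (nrm2 (g *m h)); exists g.
by move=> _ [g' Gg' <-]; exact: hg.
Qed.

Lemma depth_invariant g h : Gamma g -> depth (g *m h) = depth h.
Proof.
move=> Gg; rewrite /depth; congr inf; apply/seteqP; split=> x [g' Gg' <-] /=.
  by exists (g' *m g); [exact: GammaM|rewrite mulmxA].
exists (g' *m invmx g); first by apply: GammaM => //; exact: GammaV.
by rewrite mulmxA mulmxKV // Gamma_unit.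
Qed.

Lemma depth_distortion h h' : SL R 2 h -> SL R 2 h' ->
  depth h' <= depth h * distortion (\adj h *m h').
Proof.
move=> dh dh'; have [g Gg ->] := depth_attained dh.
have -> : \adj h = invmx h by rewrite /invmx SL_unit // dh invr1 scale1r.
apply: le_trans (depth_le h' Gg) _.
by have := nrm2_distortion (g *m h) (invmx h *m h'); rewrite mulmxA mulmxK ?SL_unit.
Qed.

(** A squeeze: [depth_distortion] is applied from h to h' and from h' to h. The adjugate, which is
    the inverse on SL(2), is polynomial in the entries. *)
Lemma depth_continuous : {within SL R 2, continuous depth}.
Proof.
apply/within_continuousP => h F FF dh FA Fh.
have aK : \adj h *m h = 1%:M by rewrite mul_adj_mx dh.
have d1 m : 1 <= distortion m.
  by rewrite /distortion lerDl; apply: sumr_ge0 => i _; apply: sumr_ge0.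
apply: (@squeeze_cvgr _ F _ _ (fun h' => depth h / distortion (\adj h' *m h))
   (fun h' => depth h * distortion (\adj h *m h'))).
- apply: filterS FA => h' dh'.
  have p : 0 < distortion (\adj h' *m h) by apply: (@lt_le_trans _ _ 1 _ _ ltr01); exact: d1.
  by rewrite depth_distortion // andbT ler_pdivrMr // depth_distortion.
- rewrite -[X in _ --> X]divr1 -(distortion1 R) -aK.
  apply: cvgM; first exact: cvg_cst.
  apply: cvgV; first by rewrite aK distortion1 oner_eq0.
  by apply: cvg_distortion; apply: cvg_mulmx; [exact: cvg_adj|exact: cvg_cst].
- rewrite -[X in _ --> X]mulr1 -(distortion1 R) -aK.
  apply: cvgM; first exact: cvg_cst.
  by apply: cvg_distortion; apply: cvg_mulmx; [exact: cvg_cst|].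
Qed.

End Discrete.

(** * A vertical norm *)

Section WedgeNorm.
Variable R : realType.
Implicit Types F : 'M[R]_3.

Definition colsq F j : R := \sum_i F i j ^+ 2.

(* |F'_j /\ F_j| / |F_j|^2 summed over the columns: a norm on the tangent space
   of the frame variety at frame F *)
Definition wedge_norm F F' : R :=
  \sum_j (\sum_i \sum_k `|F' i j * F k j - F' k j * F i j|) / colsq F j.

Lemma colsq_gt0 F j : F \in unitmx -> 0 < colsq F j.
Proof.
move=> FU; rewrite lt_neqAle sumr_ge0 ?andbT; last by move=> i _; exact: sqr_ge0.
rewrite eq_sym; apply/negP; rewrite psumr_eq0; last by move=> i _; exact: sqr_ge0.
move=> /allP h.
have c0 : F *m delta_mx j (0 : 'I_1) = 0.
  rewrite -colE; apply/colP => i; rewrite !mxE.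
  by have /implyP/(_ isT) := h i (mem_index_enum i); rewrite sqrf_eq0 => /eqP.
have : delta_mx j (0 : 'I_1) = 0 :> 'cV[R]_3 by rewrite -[LHS](mulKmx FU) c0 mulmx0.
by move=> /matrixP/(_ j 0)/eqP; rewrite !mxE !eqxx oner_eq0.
Qed.

Lemma wedge_norm_ge0 F F' : 0 <= wedge_norm F F'.
Proof.
apply: sumr_ge0 => j _; apply: divr_ge0.
  by apply: sumr_ge0 => i _; apply: sumr_ge0.
by apply: sumr_ge0 => i _; exact: sqr_ge0.
Qed.

Lemma wedge_norm_well_defined F F' (d d' : 'rV[R]_3) : diag_mx d \in unitmx ->
  wedge_norm (F *m diag_mx d) (F' *m diag_mx d + F *m diag_mx d') = wedge_norm F F'.
Proof.
rewrite unitmxE det_diag unitfE => /prodf_neq0 d0.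
apply: eq_bigr => j _; have dj := d0 j isT.
have -> : colsq (F *m diag_mx d) j = d 0 j ^+ 2 * colsq F j.
  rewrite /colsq mulr_sumr; apply: eq_bigr => i _.
  by rewrite mul_mx_diag mxE exprMn mulrC.
rewrite (eq_bigr (fun i => d 0 j ^+ 2 * \sum_k `|F' i j * F k j - F' k j * F i j|)).
  have d2 : d 0 j ^+ 2 != 0 by rewrite sqrf_eq0.
  by rewrite -mulr_sumr -mulf_div divff // mul1r.
move=> i _; rewrite mulr_sumr; apply: eq_bigr => k _.
rewrite !mul_mx_diag !mxE -[d 0 j ^+ 2]ger0_norm ?sqr_ge0 // -normrM.
by congr `|_|; ring.
Qed.

Lemma wedge_norm_triangle F F1 F2 :
  wedge_norm F (F1 + F2) <= wedge_norm F F1 + wedge_norm F F2.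
Proof.
rewrite /wedge_norm -big_split /= ler_sum // => j _; rewrite -mulrDl.
apply: ler_wpM2r; first by rewrite invr_ge0 sumr_ge0 // => i _; exact: sqr_ge0.
rewrite -big_split /= ler_sum // => i _; rewrite -big_split /= ler_sum // => k _.
by apply: le_trans (ler_normD _ _); rewrite !mxE le_eqVlt; apply/orP; left; apply/eqP; congr `|_|; ring.
Qed.

Lemma wedge_norm_scale F F' (k : R) : wedge_norm F (k *: F') = `|k| * wedge_norm F F'.
Proof.
rewrite /wedge_norm mulr_sumr; apply: eq_bigr => j _; rewrite mulrA; congr (_ / _).
rewrite mulr_sumr; apply: eq_bigr => i _; rewrite mulr_sumr; apply: eq_bigr => l _.
by rewrite !mxE -normrM; congr `|_|; ring.
Qed.

Lemma wedge_norm_definite F F' : F \in unitmx -> wedge_norm F F' = 0 ->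
  exists d : 'rV[R]_3, F' = F *m diag_mx d.
Proof.
move=> FU /eqP; rewrite psumr_eq0; last first.
  move=> j _; apply: divr_ge0; last exact/ltW/colsq_gt0.
  by apply: sumr_ge0 => i _; apply: sumr_ge0.
move=> /allP h; exists (\row_j ((\sum_i F' i j * F i j) / colsq F j)).
apply/matrixP => i j; rewrite mul_mx_diag !mxE.
have cj := colsq_gt0 j FU.
have := h j (mem_index_enum j); rewrite /= mulf_eq0 invr_eq0 (gt_eqF cj) orbF.
rewrite psumr_eq0; last by move=> i' _; apply: sumr_ge0.
move=> /allP/(_ i (mem_index_enum i)) /=.
rewrite psumr_eq0 // => /allP hk.
have e k : F' i j * F k j = F' k j * F i j.
  by have /implyP/(_ isT) := hk k (mem_index_enum k); rewrite normr_eq0 subr_eq0 => /eqP.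
rewrite mulrA; apply: (@mulIf _ (colsq F j)); first by rewrite gt_eqF.
rewrite mulfVK ?gt_eqF // /colsq !mulr_sumr; apply: eq_bigr => k _.
transitivity (F' i j * F k j * F k j); first by ring.
by rewrite e; ring.
Qed.

Lemma cvg_wedge_norm (T : Type) (F : set_system T) {FF : Filter F}
    (f f' : T -> 'M[R]_3) (A A' : 'M[R]_3) : A \in unitmx ->
  f @ F --> A -> f' @ F --> A' ->
  (fun x => wedge_norm (f x) (f' x)) @ F --> wedge_norm A A'.
Proof.
move=> AU hf hf'; apply: cvg_sum => j _; apply: cvgM.
  apply: cvg_sum => i _; apply: cvg_sum => k _; apply: cvg_norm.
  by apply: cvgB; apply: cvgM; exact: cvg_coord.
apply: cvgV; first by rewrite gt_eqF ?colsq_gt0.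
apply: cvg_sum => i _.
under eq_fun do rewrite expr2.
by rewrite expr2; apply: cvgM; exact: cvg_coord.
Qed.

End WedgeNorm.

(** * Existence of vertical norms *)

Section VerticalNorm.
Variables (R : realType) (Gamma : set 'M[R]_2) (rho : 'M[R]_2 -> 'M[R]_3).
Hypothesis dG : discrete_subgroup Gamma.
Hypothesis rep : representation Gamma rho.

Lemma rho_unit g : Gamma g -> rho g \in unitmx.
Proof. by case: rep => s _ /s /SL_unit. Qed.

(* Nonzero only if g h is almost as small as possible in the orbit of h: this
   makes the sum below locally finite, and positive. *)
Definition weight g h : R :=
  let x := depth Gamma h + 1 - nrm2 (g *m h) in x + `|x|.

Lemma weight_ge0 g h : 0 <= weight g h.
Proof.
rewrite /weight /=; set x := _ - _.
by have := ler_norm (- x); rewrite normrN; lra.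
Qed.

Lemma weight_eq0 g h : depth Gamma h + 1 <= nrm2 (g *m h) -> weight g h = 0.
Proof. by move=> le; rewrite /weight ler0_norm ?subrr // subr_le0. Qed.

(** The Anosov condition speaks of all vertical norms, so one has to be exhibited. [weight g h]
    depends only on g h and on the invariant depth of h, so replacing (h, F, F') by its image under
    an element of Gamma merely reindexes the sum. *)
Definition gauge h F F' : R :=
  \sum_(g \in Gamma) weight g h * wedge_norm (rho g *m F) (rho g *m F').

Lemma gauge_seq (B : R) : exists2 s : seq 'M[R]_2, (forall g, g \in s -> Gamma g) &
  (forall h F F', SL R 2 h -> nrm2 h <= B -> gauge h F F' =
    \sum_(g <- s) weight g h * wedge_norm (rho g *m F) (rho g *m F')) /\
  (forall h g, SL R 2 h -> nrm2 h <= B -> Gamma g -> nrm2 (g *m h) = depth Gamma h -> g \in s).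
Proof.
(* If nrm2 h <= B, then depth h <= B, and a nonzero weight forces nrm2 (g h) < B + 1, hence nrm2 g
   <= (B + 1) B by [nrm2_cancel]. *)
have [s us hs] := Gamma_ball_seq dG ((B + 1) * B).
have sG g : g \in s -> Gamma g by move=> /hs[].
have out g h : SL R 2 h -> nrm2 h <= B -> Gamma g -> g \notin s -> depth Gamma h + 1 <= nrm2 (g *m h).
  move=> dh hB Gg /negP gs; rewrite leNgt; apply/negP => lt; apply: gs; apply/hs; split=> //.
  apply: le_trans (nrm2_cancel g dh) _.
  have dB : depth Gamma h <= nrm2 h by have := depth_le h (Gamma1 dG); rewrite mul1mx.
  have h0 := nrm2_ge0 h; apply: ler_pM => //; first exact: nrm2_ge0.
  by apply: ltW; apply: lt_le_trans lt _; rewrite lerD2r (le_trans dB).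
exists s => //; split.
  move=> h F F' dh hB; rewrite /gauge (fsbigE s) //.
    by rewrite big_seq_cond [RHS]big_seq; apply: eq_bigl => g; case gs: (g \in s) => //=; apply/mem_set/sG.
  by move=> g Gg gs; rewrite weight_eq0 ?mul0r // out.
move=> h g dh hB Gg e; apply/negP => /negP gs; have := out g h dh hB Gg gs.
by rewrite e gerDl ler10.
Qed.

Lemma cvg_depth (T : Type) (F : set_system T) {FF : Filter F} (f : T -> 'M[R]_2) h :
  SL R 2 h -> F [set x | SL R 2 (f x)] -> f @ F --> h ->
  (fun x => depth Gamma (f x)) @ F --> depth Gamma h.
Proof.
move=> dh FA Fh; have /within_continuousP cd := depth_continuous dG.
exact: (cd h (f @ F)).
Qed.

Lemma cvg_weight (T : Type) (F : set_system T) {FF : Filter F} (f : T -> 'M[R]_2) g h :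
  SL R 2 h -> F [set x | SL R 2 (f x)] -> f @ F --> h ->
  (fun x => weight g (f x)) @ F --> weight g h.
Proof.
move=> dh FA Fh.
have cx : (fun x => depth Gamma (f x) + 1 - nrm2 (g *m f x)) @ F -->
    depth Gamma h + 1 - nrm2 (g *m h).
  apply: cvgB; first by apply: cvgD; [exact: cvg_depth|exact: cvg_cst].
  by apply: cvg_nrm2; apply: cvg_mulmx; [exact: cvg_cst|].
by apply: cvgD => //; exact: cvg_norm.
Qed.

Lemma gauge_vertical_norm : vertical_norm Gamma rho gauge.
Proof.
split.
- apply/within_continuousP => -[[h A] A'] F FF /= [dh AU] FA Fp.
  have F1 : (fun p : 'M[R]_2 * 'M[R]_3 * 'M[R]_3 => p.1.1) @ F --> h.
    by apply: (cvg_comp _ fst (cvg_comp _ fst Fp _)); exact: cvg_fst.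
  have F2 : (fun p : 'M[R]_2 * 'M[R]_3 * 'M[R]_3 => p.1.2) @ F --> A.
    by apply: (cvg_comp _ snd (cvg_comp _ fst Fp _)); [exact: cvg_fst|exact: cvg_snd].
  have F3 : (fun p : 'M[R]_2 * 'M[R]_3 * 'M[R]_3 => p.2) @ F --> A'.
    by apply: (cvg_comp _ snd Fp); exact: cvg_snd.
  have [s sG [sE _]] := gauge_seq (nrm2 h + 1).
  have nB : \forall p \near F, nrm2 p.1.1 <= nrm2 h + 1.
    by apply: (cvgr_le _ (cvg_nrm2 F1)); rewrite ltrDl.
  rewrite sE //; last by rewrite lerDl.
  have : (fun p : 'M[R]_2 * 'M[R]_3 * 'M[R]_3 => \sum_(g <- s) weight g p.1.1 * wedge_norm (rho g *m p.1.2) (rho g *m p.2)) @ F -->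
      \sum_(g <- s) weight g h * wedge_norm (rho g *m A) (rho g *m A').
    rewrite big_seq; under eq_fun do rewrite big_seq.
    apply: cvg_sum => g gs; apply: cvgM.
      by apply: cvg_weight => //; apply: filterS FA => p [].
    apply: cvg_wedge_norm; first by rewrite unitmx_mul AU andbT rho_unit //; exact: sG.
      by apply: cvg_mulmx => //; exact: cvg_cst.
    by apply: cvg_mulmx => //; exact: cvg_cst.
  apply: cvg_trans; apply: near_eq_cvg.
  by apply: filterS (filterI FA nB) => p [[dp _] pB]; rewrite sE.
- move=> h F F' d d' dh FU dU; apply: eq_fsbigr => g _; congr (_ * _).
  by rewrite mulmxDr !mulmxA wedge_norm_well_defined.
- move=> h F F1 F2 dh FU; have [s sG [sE _]] := gauge_seq (nrm2 h).
  rewrite !sE // -big_split /= ler_sum // => g _; rewrite -mulrDr mulmxDr.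
  by rewrite ler_wpM2l ?weight_ge0 ?wedge_norm_triangle.
- move=> h F F' k dh FU; have [s sG [sE _]] := gauge_seq (nrm2 h).
  rewrite !sE // mulr_sumr; apply: eq_bigr => g _.
  by rewrite -scalemxAr wedge_norm_scale; ring.
- move=> h F F' dh FU; have [s sG [sE sM]] := gauge_seq (nrm2 h).
  rewrite sE // => /eqP; rewrite psumr_eq0; last first.
    by move=> g _; rewrite mulr_ge0 ?weight_ge0 ?wedge_norm_ge0.
  have [g Gg gE] := depth_attained dG dh.
  move=> /allP/(_ g (sM h g dh (lexx _) Gg (esym gE))) /=.
  have w2 : weight g h = 2 by rewrite /weight /= -gE (_ : depth Gamma h + 1 - depth Gamma h = 1) ?normr1; ring.
  rewrite w2 mulf_eq0 pnatr_eq0 /= => /eqP.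
  have gU := rho_unit Gg.
  move=> /wedge_norm_definite; rewrite unitmx_mul gU FU => /(_ isT)[d dE].
  by exists d; rewrite -[F'](mulKmx gU) dE -mulmxA mulKmx.
- move=> g h F F' Gg dh FU; rewrite /gauge.
  rewrite (@reindex_fsbig _ _ _ _ _ (fun x => x *m g) Gamma Gamma (fun x => weight x h * wedge_norm (rho x *m F) (rho x *m F'))); last first.
    split.
    + by move=> x Gx; exact: GammaM.
    + by move=> x y _ _ /(congr1 (fun z => z *m invmx g)); rewrite !mulmxK ?(Gamma_unit dG).
    + move=> x Gx; exists (x *m invmx g); first by apply: (GammaM dG) => //; exact: (GammaV dG).
      by rewrite mulmxKV ?(Gamma_unit dG).
  apply: eq_fsbigr => x /set_mem Gx.
  by rewrite /weight (depth_invariant dG) // !mulmxA; case: rep => _ ->.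
Qed.

Lemma scaled_vertical_norm (N : 'M[R]_2 -> 'M[R]_3 -> 'M[R]_3 -> R) (w : R -> R) :
  vertical_norm Gamma rho N -> continuous w -> (forall x, 0 < w x) ->
  vertical_norm Gamma rho (fun h F F' => w (depth Gamma h) * N h F F').
Proof.
move=> vN cw w0; split.
- move: (vnorm_continuous vN) => /within_continuousP cN.
  apply/within_continuousP => p F FF pA FA Fp; apply: cvgM; last exact: cN.
  have F1 : (fun p : 'M[R]_2 * 'M[R]_3 * 'M[R]_3 => p.1.1) @ F --> p.1.1.
    by apply: (cvg_comp _ fst (cvg_comp _ fst Fp _)); exact: cvg_fst.
  apply: (continuous_cvg _ (cw _)); apply: cvg_depth => //; first by case: pA.
  by apply: filterS FA => q [].
- by move=> h F F' d d' dh FU dU; rewrite (vnorm_well_defined vN).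
- by move=> h F F1 F2 dh FU; rewrite -mulrDr ler_pM2l // (vnorm_triangle vN).
- by move=> h F F' k dh FU; rewrite (vnorm_scale vN) // mulrCA.
- move=> h F F' dh FU /eqP; rewrite mulf_eq0 gt_eqF //= => /eqP.
  exact: (vnorm_definite vN).
- move=> g h F F' Gg dh FU; rewrite (depth_invariant dG) //.
  by rewrite (vnorm_invariant vN).
Qed.

End VerticalNorm.

(** * Frames *)

Section Frames.
Variable R : realType.
Implicit Types F : 'M[R]_3.
Local Notation PV := (proj 'cV[R]_3).

Lemma ord3 (i : 'I_3) : [\/ i = 0, i = 1 | i = ord_max].
Proof.
by case: i => -[|[|[|//]]] ?; [apply: Or31|apply: Or32|apply: Or33]; apply: val_inj.
Qed.

Lemma sum3 (S : nmodType) (f : 'I_3 -> S) : \sum_i f i = f 0 + f 1 + f ord_max.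
Proof.
rewrite !big_ord_recl big_ord0 addr0 addrA.
by congr (_ + f _ + f _); apply: val_inj.
Qed.

Definition vertex (y : PV * PV * PV) (j : 'I_3) : PV :=
  if j == 0 then y.1.1 else if j == 1 then y.1.2 else y.2.

Lemma vertex_inj (y z : PV * PV * PV) : (forall j, vertex y j = vertex z j) -> y = z.
Proof.
case: y z => -[a b] c [[a' b'] c'] h.
by have := (h 0, h 1, h ord_max); rewrite /vertex /=; case=> -[-> ->] ->.
Qed.

Lemma vertex_frame F j : vertex (frame F) j = line (col j F).
Proof. by rewrite /vertex /frame /=; case: (ord3 j) => ->. Qed.

Lemma frameP F y : frame F = y <-> forall j, line (col j F) = vertex y j.
Proof.
split=> [<- j|h]; first by rewrite vertex_frame.
by apply: vertex_inj => j; rewrite vertex_frame.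
Qed.

Lemma vertex_act g y j : vertex (act_frame g y) j = act g (vertex y j).
Proof. by rewrite /vertex /act_frame; case: (ord3 j) => ->. Qed.

Lemma col_neq0 F j : F \in unitmx -> col j F != 0.
Proof.
move=> FU; apply/eqP => c0.
have := colsq_gt0 j FU; rewrite /colsq big1 ?ltxx // => i _.
by have /colP/(_ i) := c0; rewrite !mxE => ->; rewrite expr0n.
Qed.

Lemma act_frame_frame g F : g \in unitmx -> F \in unitmx ->
  act_frame g (frame F) = frame (g *m F).
Proof.
move=> gU FU; apply/esym/frameP => j.
by rewrite vertex_act vertex_frame act_line ?col_neq0 // !colE mulmxA.
Qed.

Lemma frame_eq_diag F F' : F \in unitmx -> F' \in unitmx -> frame F = frame F' ->
  exists d : 'rV[R]_3, F' = F *m diag_mx d.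
Proof.
move=> FU FU' e.
have ex j : exists c, col j F' = c *: col j F.
  apply/(line_eqP (col_neq0 j FU) (col_neq0 j FU')).
  by rewrite -!vertex_frame e.
have /choice[d dE] := ex.
exists (\row_j d j); apply/matrixP => i j.
by have /colP/(_ i) := dE j; rewrite mul_mx_diag !mxE mulrC.
Qed.

Lemma diag_unit (d : 'rV[R]_3) F F' : F' \in unitmx -> F' = F *m diag_mx d ->
  forall j, d 0 j != 0.
Proof.
move=> FU' FE j; move: FU'; rewrite FE unitmx_mul => /andP[_].
by rewrite unitmxE det_diag unitfE => /prodf_neq0 /(_ j); apply.
Qed.

(** Unit columns leave only signs undetermined, which makes the frames over a compact set of points
    a compact set. No continuous choice of signs is ever made. *)
Definition unit_frame (y : PV * PV * PV) F : Prop :=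
  (forall j, dot (col j F) (col j F) = 1) /\ frame F = y.

Lemma unit_frame_unit y F : frame_variety y -> unit_frame y F -> F \in unitmx.
Proof.
move=> yY [u1 /frameP fy].
have c0 j : col j F != 0 by rewrite -dot_eq0 u1 oner_eq0.
have sp j : space_of (vertex y j) = <[col j F]>%VS by rewrite -fy line_space.
have ex (x : 'cV[R]_3) : exists c : 'cV[R]_3, F *m c = x.
  have : x \in (vertex y 0%R + vertex y 1%R + vertex y ord_max)%VS.
    by have := yY; rewrite /frame_variety /= /vertex /= => ->; rewrite memvf.
  rewrite !sp => /memv_addP[_ /memv_addP[_ /vlineP[a ->] [_ /vlineP[b ->] ->]] [_ /vlineP[c ->] ->]].
  exists (\col_i (if i == 0 then a else if i == 1 then b else c)).
  by apply/colP => i; rewrite !mxE sum3 !mxE /=; ring.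
have /choice[c cE] := fun j => ex (delta_mx j 0).
have : F *m (\matrix_(i, j) c j i 0) = 1%:M.
  apply/matrixP => i j; have /colP/(_ i) := cE j; rewrite !mxE eqxx andbT => <-.
  by apply: eq_bigr => k _; rewrite mxE.
by move=> /mulmx1_unit[].
Qed.

Lemma unit_frame_exists y : exists F, unit_frame y F.
Proof.
pose e j : 'cV[R]_3 := (Num.sqrt (dot (vpick (vertex y j)) (vpick (vertex y j))))^-1 *: vpick (vertex y j).
have s0 j : 0 < Num.sqrt (dot (vpick (vertex y j)) (vpick (vertex y j))).
  by rewrite sqrtr_gt0 dot_gt0 // vpick_proj_neq0.
have ce j : col j (\matrix_(i, k) e k i 0) = e j by apply/colP => i; rewrite !mxE.
exists (\matrix_(i, j) e j i 0); split.
  move=> j; rewrite ce dotZl dotZr mulrA -invfM -expr2 sqr_sqrtr ?dot_ge0 //.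
  by rewrite mulVf // gt_eqF // dot_gt0 // vpick_proj_neq0.
apply/frameP => j; rewrite ce lineZ ?vpick_proj_neq0 ?line_vpick //.
by rewrite invr_eq0 gt_eqF.
Qed.

(** Rewrites the condition as equations between matrices that vary continuously with F and y; this
    is how the set of framed points is seen to be closed. *)
Lemma unit_frame_projector y F :
  unit_frame y F <-> forall j, col j F *m (col j F)^T = projector (vertex y j).
Proof.
split=> [[u1 /frameP fy] j|h]; first by rewrite -fy projector_unit.
have u1 j : dot (col j F) (col j F) = 1.
  have v0 := vpick_proj_neq0 (vertex y j).
  have := congr1 mxtrace (h j); rewrite /projector linearZ /= !(mxtrace_mulC _ (_^T)).
  by rewrite /mxtrace !big_ord1 -!/(dot _ _) mulVf // gt_eqF // dot_gt0.
split=> //; apply/frameP => j; apply: projector_inj.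
by rewrite projector_unit.
Qed.

Lemma unit_frame_entry y F i j : unit_frame y F -> `|F i j| <= 1.
Proof.
move=> [u1 _]; have := u1 j; rewrite dotE => s1.
rewrite -(@ler_pXn2r _ 2) ?nnegrE // real_normK ?num_real // expr1n -s1.
rewrite (bigD1 i) //= !mxE -expr2 lerDl; apply: sumr_ge0 => k _.
by rewrite -expr2 sqr_ge0.
Qed.

Definition transvection i j (t : R) : 'M[R]_3 := 1%:M + t *: delta_mx i j.

Lemma col_transvection F i j t k :
  col k (F *m transvection i j t) = col k F + (if k == j then t *: col i F else 0).
Proof.
rewrite mulmxDr mulmx1 -scalemxAr raddfD /= linearZ /=; congr (_ + _).
apply/colP => l; case: eqP => [->|/eqP kj]; rewrite !mxE.
  rewrite (bigD1 i) //= mxE !eqxx mulr1 big1 ?addr0 // => m mi.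
  by rewrite mxE (negPf mi) mulr0.
by rewrite big1 ?mulr0 // => m _; rewrite mxE (negPf kj) andbF mulr0.
Qed.

Lemma transvection_unit i j t : i != j -> transvection i j t \in unitmx.
Proof.
move=> ij; have : transvection i j t *m transvection i j (- t) = 1%:M.
  rewrite /transvection mulmxDl mul1mx mulmxDr mulmx1 -scalemxAl -scalemxAr.
  rewrite mul_delta_mx_cond eq_sym (negPf ij) mulr0n !scaler0 addr0.
  by rewrite -addrA -scalerDl addNr scale0r addr0.
by move=> /mulmx1_unit[].
Qed.

Lemma tangent_transvection (T : Type) (p : PV * PV * PV -> T) F i j :
  F \in unitmx -> i != j ->
  (forall t, p (frame (F *m transvection i j t)) = p (frame F)) ->
  tangent_to_fiber p F (F *m delta_mx i j).
Proof.
move=> FU ij h; exists (fun t => F *m transvection i j t); split.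
- by rewrite /transvection scale0r addr0 mulmx1.
- have E : (fun t => F *m transvection i j t) = (fun t => F + t *: (F *m delta_mx i j)).
    by apply/funext => t; rewrite mulmxDr mulmx1 scalemxAr.
  have D : (fun x : R => x^-1 *: ((F + (x *: (1 : R) + 0) *: (F *m delta_mx i j)) - (F + 0 *: (F *m delta_mx i j)))) @ 0^' --> F *m delta_mx i j.
    apply: cvg_near_cst; apply: filterS (nbhs_dnbhs_neq 0) => x x0.
    rewrite addr0 scale0r addr0 addrC addKr scalerA [x *: 1]mulr1 mulVf // scale1r.
    by [].
  rewrite E; apply: DeriveDef; last exact: (cvg_lim (@norm_hausdorff _ _) D).
  by apply/cvg_ex; exists (F *m delta_mx i j).
- by near=> t; rewrite unitmx_mul FU transvection_unit.
Unshelve. all: by end_near. Qed.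

Lemma vline_add_transvection (u v : 'cV[R]_3) (t : R) :
  (<[u]> + <[v + t *: u]> = <[u]> + <[v]>)%VS.
Proof.
have tu : t *: u \in <[u]>%VS by apply/vlineP; exists t.
apply/eqP; rewrite eqEsubv !subv_add !addvSl -!memvE /=; apply/andP; split.
  by rewrite addrC memv_add // memv_line.
have vE : v = - (t *: u) + (v + t *: u) by rewrite addrC addrK.
by rewrite [X in X \in _]vE memv_add ?memvN // memv_line.
Qed.

(** In a fiber of pi_+ the point v may move on the line uv and w may move freely. The directions F
    E_01 and F E_12 are those that compare consecutive diagonal entries, the simple roots; E^-
    contains their transposes. *)
Lemma E_plus_transvection01 F : F \in unitmx -> E_plus F (F *m delta_mx 0 1).
Proof.
move=> FU; apply: tangent_transvection => // t; rewrite /pi_plus /frame /=.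
have TU : F *m transvection 0 1 t \in unitmx by rewrite unitmx_mul FU transvection_unit.
rewrite !line_space ?col_neq0 // !col_transvection /= addr0.
by rewrite vline_add_transvection.
Qed.

Lemma E_plus_transvection12 F : F \in unitmx -> E_plus F (F *m delta_mx 1 ord_max).
Proof.
move=> FU; apply: tangent_transvection => // t; rewrite /pi_plus /frame /=.
by rewrite !col_transvection /= !addr0.
Qed.

Lemma E_minus_transvection21 F : F \in unitmx -> E_minus F (F *m delta_mx ord_max 1).
Proof.
move=> FU; apply: tangent_transvection => // t; rewrite /pi_minus /frame /=.
have TU : F *m transvection ord_max 1 t \in unitmx by rewrite unitmx_mul FU transvection_unit.
rewrite !line_space ?col_neq0 // !col_transvection /= addr0.
by rewrite vline_add_transvection.
Qed.

Lemma E_minus_transvection10 F : F \in unitmx -> E_minus F (F *m delta_mx 1 0).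
Proof.
move=> FU; apply: tangent_transvection => // t; rewrite /pi_minus /frame /=.
by rewrite !col_transvection /= !addr0.
Qed.

End Frames.

(** * Lifts of Anosov sections *)

Section Flow.
Variable R : realType.

Lemma flow_entry (t : R) : [/\ geodesic_flow t 0 0 = expR t, geodesic_flow t 0 1 = 0,
  geodesic_flow t 1 0 = 0 & geodesic_flow t 1 1 = expR (- t)].
Proof. by rewrite /geodesic_flow !mxE. Qed.

Lemma SL_flow (t : R) : SL R 2 (geodesic_flow t).
Proof.
rewrite /SL /= det2; have [-> -> -> ->] := flow_entry t.
by rewrite mul0r subr0 expRxMexpNx_1.
Qed.

Lemma flow0 : geodesic_flow (0 : R) = 1%:M.
Proof.
have [e1 e2 e3 e4] := flow_entry 0.
by apply: mx2P; rewrite (e1, e2, e3, e4) ?oppr0 ?expR0 [RHS]mxE.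
Qed.

Lemma flowK (h : 'M[R]_2) (t : R) : h *m geodesic_flow t *m geodesic_flow (- t) = h.
Proof.
rewrite -mulmxA (_ : geodesic_flow t *m geodesic_flow (- t) = 1%:M) ?mulmx1 //.
have [e1 e2 e3 e4] := flow_entry t; have [n1 n2 n3 n4] := flow_entry (- t).
apply: mx2P; rewrite !mxE !sum2 ?e1 ?e2 ?e3 ?e4 ?n1 ?n2 ?n3 ?n4 /=;
  rewrite ?(mul0r, mulr0, addr0, add0r) ?opprK //; first by rewrite expRxMexpNx_1.
by rewrite mulrC expRxMexpNx_1.
Qed.

End Flow.

(** * Unit frames over SL(2) and their contraction *)

Section Lift.
Variables (R : realType) (Gamma : set 'M[R]_2) (rho : 'M[R]_2 -> 'M[R]_3).
Variable f : 'M[R]_2 -> proj 'cV[R]_3 * proj 'cV[R]_3 * proj 'cV[R]_3.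
Hypothesis dG : discrete_subgroup Gamma.
Hypothesis rep : representation Gamma rho.
Hypothesis lift : anosov_lift Gamma rho f.

Definition framed (h : 'M[R]_2) (F : 'M[R]_3) := SL R 2 h /\ unit_frame (f h) F.

Lemma framed_exists h : SL R 2 h -> exists F, framed h F.
Proof. by move=> dh; have [F hF] := unit_frame_exists (f h); exists F. Qed.

Lemma framed_unit h F : framed h F -> F \in unitmx.
Proof. by move=> [dh]; apply: unit_frame_unit; exact: (lift_frame lift). Qed.

Lemma framed_flow h F t : framed h F -> framed (h *m geodesic_flow t) F.
Proof.
move=> [dh hF]; split; first by apply: SL_mul => //; exact: SL_flow.
by rewrite (lift_flow lift).
Qed.

Lemma framed_equivariant g h F F' : Gamma g -> framed h F -> framed (g *m h) F' ->
  exists2 d : 'rV[R]_3, (forall j, d 0 j != 0) & rho g *m F = F' *m diag_mx d.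
Proof.
move=> Gg fF fF'; have FU := framed_unit fF; have FU' := framed_unit fF'.
have gU := rho_unit rep Gg.
case: fF fF' => dh [_ eF] [_ [_ eF']].
have UgF : rho g *m F \in unitmx by rewrite unitmx_mul gU.
have [d dE] : exists d : 'rV[R]_3, rho g *m F = F' *m diag_mx d.
  apply: frame_eq_diag => //.
  by rewrite eF' (lift_equivariant lift) // -act_frame_frame // eF.
by exists d => //; exact: diag_unit dE.
Qed.

Lemma cvg_projector (T : Type) (F : set_system T) {FF : Filter F} (k : T -> 'M[R]_2) h j :
  SL R 2 h -> F [set x | SL R 2 (k x)] -> k @ F --> h ->
  (fun x => projector (vertex (f (k x)) j)) @ F --> projector (vertex (f h) j).
Proof.
move=> dh Fk kh; apply: (continuous_cvg _ (@projector_continuous _ _ _)).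
have cf : (f \o k) @ F --> f h.
  by have /within_continuousP c := lift_continuous lift; exact: (c h (k @ F)).
have c1 : (fun x => (f (k x)).1) @ F --> (f h).1.
  by apply: (cvg_comp _ fst cf); exact: cvg_fst.
have c2 : (fun x => (f (k x)).2) @ F --> (f h).2.
  by apply: (cvg_comp _ snd cf); exact: cvg_snd.
rewrite /vertex; case: ifP => _; first by apply: (cvg_comp _ fst c1); exact: cvg_fst.
by case: ifP => _ //; apply: (cvg_comp _ snd c1); exact: cvg_snd.
Qed.

Definition framed_ball (B : R) : set ('M[R]_2 * 'M[R]_3) :=
  [set p | framed p.1 p.2 /\ nrm2 p.1 <= B].

Lemma framed_ball_compact B : compact (framed_ball B).
Proof.
pose A := [set g : 'M[R]_2 | SL R 2 g /\ nrm2 g <= B] `*` [set M : 'M[R]_3 | forall i j, `|M i j| <= 1].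
have cA : compact A by apply: compact_setX; [exact: ball_compact|exact: compact_box].
have clA : closed A by apply: (compact_closed _ cA); exact: (@norm_hausdorff R ('M[R]_2 * 'M[R]_3)%type).
have cE j : closed (A `&` [set p | col j p.2 *m (col j p.2)^T = projector (vertex (f p.1) j)]).
  apply: (within_closed_eq _ clA); first exact: (@norm_hausdorff R 'M[R]_3).
    apply/within_continuousP => p F FF pA FA Fp.
    have F2 : snd @ F --> p.2 by apply: (cvg_comp _ snd Fp); exact: cvg_snd.
    have Fc : (fun p : 'M[R]_2 * 'M[R]_3 => col j p.2) @ F --> col j p.2.
      apply: cvg_mx => i k; under eq_fun do rewrite mxE.
      by rewrite mxE; exact: cvg_coord.
    by apply: cvg_mulmx => //; exact: cvg_trmx.
  apply/within_continuousP => p F FF pA FA Fp.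
  have F1 : fst @ F --> p.1 by apply: (cvg_comp _ fst Fp); exact: cvg_fst.
  apply: cvg_projector => //; first by case: pA => -[].
  by apply: filterS FA => q [[]].
suff -> : framed_ball B = A `&` (\bigcap_(j in [set: 'I_3]) (A `&` [set p | col j p.2 *m (col j p.2)^T = projector (vertex (f p.1) j)])).
  apply: (subclosed_compact _ cA); last by move=> p [].
  by apply: closedI => //; apply: closed_bigI => j _.
apply/seteqP; split=> [[h F] /= [[dh hF] hB]|[h F] /= [[[dh hB] _] hE]].
  have Ap : A (h, F) by split=> //= i j; exact: unit_frame_entry hF.
  by split=> // j _; split=> //=; have /unit_frame_projector := hF.
split=> //; split=> //; apply/unit_frame_projector => j.
by have [_] := hE j I.
Qed.

Lemma framed_ball_cvg B (T : normedModType R) (g : 'M[R]_2 -> 'M[R]_3 -> T) :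
  (forall h F (H : set_system ('M[R]_2 * 'M[R]_3)), Filter H -> framed h F ->
    H [set p | framed p.1 p.2] -> fst @ H --> h -> snd @ H --> F ->
    (fun p => g p.1 p.2) @ H --> g h F) ->
  {within framed_ball B, continuous (fun p => g p.1 p.2)}.
Proof.
move=> hg; apply/within_continuousP => -[h F] H FH [fF _] HA HF; apply: hg => //.
- by apply: filterS HA => p [].
- by apply: (cvg_comp _ fst HF); exact: cvg_fst.
- by apply: (cvg_comp _ snd HF); exact: cvg_snd.
Qed.

Lemma framed_ball_inv B : exists2 C, 0 < C & forall h F i j, framed h F -> nrm2 h <= B ->
  `|invmx F i j| <= C.
Proof.
pose g (F : 'M[R]_3) : R := \sum_i \sum_j `|(\det F)^-1 * \adj F i j|.
have [C C0 hC] : exists2 C, 0 < C & forall p, framed_ball B p -> `|g p.2| <= C.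
  apply: compact_le_bound (@framed_ball_compact B) _.
  apply: (@framed_ball_cvg B R (fun _ F => g F)) => h F H FH fF _ _ HF.
  apply: cvg_sum => i _; apply: cvg_sum => j _; apply: cvg_norm; apply: cvgM.
    apply: cvgV; last exact: cvg_det.
    by have := framed_unit fF; rewrite unitmxE unitfE.
  by apply: cvg_coord; exact: cvg_adj.
exists C => // h F i j fF hB; have := hC (h, F) (conj fF hB); apply: le_trans.
apply: le_trans (ler_norm _); rewrite /g /invmx (framed_unit fF) mxE.
rewrite (bigD1 i) //= (bigD1 j) //= -addrA lerDl addr_ge0 //.
  by apply: sumr_ge0 => k _.
by apply: sumr_ge0 => k _; apply: sumr_ge0.
Qed.

(** Conjugation by diag d multiplies E_ij by d_i / d_j, so the decay of the norm of F E_ij is the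
    decay of this ratio: by invariance the norm can be evaluated at the point brought back by g,
    where compactness bounds it from below. *)
Lemma contraction (s : R) (i j : 'I_3) h F B : i != j ->
  (forall N, vertical_norm Gamma rho N -> exists a b : R, [/\ 0 < a, 0 < b &
     forall t, 0 < t -> N (h *m geodesic_flow (s * t)) F (F *m delta_mx i j) <=
       b * expR (- (a * t)) * N h F (F *m delta_mx i j)]) ->
  framed h F ->
  exists a c : R, [/\ 0 < a, 0 < c & forall t g F1 d, 0 < t -> Gamma g ->
    framed (g *m (h *m geodesic_flow (s * t))) F1 ->
    nrm2 (g *m (h *m geodesic_flow (s * t))) <= B ->
    rho g *m F = F1 *m diag_mx d -> `|d 0 i| <= c * expR (- (a * t)) * `|d 0 j|].
Proof.
move=> ij hN fF; pose N := gauge Gamma rho.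
have vN : vertical_norm Gamma rho N := gauge_vertical_norm dG rep.
have [a [b [a0 b0 hab]]] := hN N vN.
have [c c0 hc] : exists2 c, 0 < c & forall p, framed_ball B p -> c <= N p.1 p.2 (p.2 *m delta_mx i j).
  apply: compact_ge_bound (@framed_ball_compact B) _ _.
    apply: (@framed_ball_cvg B R (fun h F => N h F (F *m delta_mx i j))).
    move=> k A H FH fA HA Hk HF.
    have /within_continuousP cN := vnorm_continuous vN.
    have := cN (k, A, A *m delta_mx i j) ((fun p : 'M[R]_2 * 'M[R]_3 => (p.1, p.2, p.2 *m delta_mx i j)) @ H) _; apply.
    - by split; [case: fA|exact: framed_unit fA].
    - by apply: (@filterS _ H _ _ _ _ HA) => p fp; exact: (conj (proj1 fp) (framed_unit fp)).
    - have HE : (fun p : 'M[R]_2 * 'M[R]_3 => p.2 *m delta_mx i j) @ H --> A *m delta_mx i j.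
        by apply: cvg_mulmx => //; exact: cvg_cst.
      exact: (cvg_pair (cvg_pair Hk HF) HE).
  move=> [k A] /= [fA _]; rewrite lt_neqAle; apply/andP; split; last first.
    rewrite /N /gauge; apply: fsumr_ge0 => g _.
    by rewrite mulr_ge0 ?weight_ge0 ?wedge_norm_ge0.
  rewrite eq_sym; apply/eqP => N0; have AU := framed_unit fA.
  have [d dE] := vnorm_definite vN fA.1 AU N0.
  have : delta_mx i j = diag_mx d :> 'M[R]_3 by rewrite -[LHS](mulKmx AU) dE mulKmx.
  by move=> /matrixP/(_ i j)/eqP; rewrite !mxE !eqxx (negPf ij) mulr0n oner_eq0.
pose M := b * N h F (F *m delta_mx i j) + 1.
have Nge k A A' : 0 <= N k A A'.
  rewrite /N /gauge; apply: fsumr_ge0 => g _.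
  by rewrite mulr_ge0 ?weight_ge0 ?wedge_norm_ge0.
have M0 : 0 < M by rewrite /M ltr_wpDl // mulr_ge0 // ltW.
exists a, (M / c); split=> // [|t g F1 d t0 Gg fF1 hB dE]; first exact: divr_gt0.
have FU := framed_unit fF; have FU1 := framed_unit fF1; have gU := rho_unit rep Gg.
have d0 : forall k, d 0 k != 0 by apply: diag_unit dE; rewrite unitmx_mul gU.
have dh : SL R 2 (h *m geodesic_flow (s * t)).
  by apply: SL_mul; [case: fF|exact: SL_flow].
have := hab t t0; rewrite -(vnorm_invariant vN _ Gg dh FU) (mulmxA (rho g)) dE.
(* diag d E_ij = (d_i / d_j) E_ij diag d. The zero summand only gives the vector the shape required
   by [vnorm_well_defined]. *)
have -> : F1 *m diag_mx d *m delta_mx i j =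
  ((d 0 i / d 0 j) *: (F1 *m delta_mx i j)) *m diag_mx d + F1 *m diag_mx d *m diag_mx 0.
  rewrite (_ : diag_mx 0 = 0) ?mulmx0 ?addr0; last by apply/matrixP => k l; rewrite !mxE mul0rn.
  rewrite -scalemxAl -!mulmxA scalemxAr; congr (_ *m _).
  apply/matrixP => k l; rewrite mul_diag_mx mul_mx_diag !mxE.
  case: eqP => [->|_] /=; last by rewrite mulr0 mul0r mulr0.
  case: eqP => [->|_] /=; last by rewrite mulr0 mul0r mulr0.
  by rewrite mulr1 mul1r mulfVK.
have dU : diag_mx d \in unitmx.
  by rewrite unitmxE det_diag unitfE; apply/prodf_neq0 => k _.
have -> : F1 *m diag_mx d *m diag_mx 0 = F1 *m diag_mx (0 : 'rV[R]_3).
  by rewrite (_ : diag_mx 0 = 0) ?mulmx0 //; apply/matrixP => k l; rewrite !mxE mul0rn.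
rewrite (vnorm_well_defined vN) //; last by case: fF1.
rewrite (vnorm_scale vN) //; last by case: fF1.
have := hc (_, F1) (conj fF1 hB); rewrite /= => cN.
move=> le1; have dj : 0 < `|d 0 j| by rewrite normr_gt0.
have le2 : `|d 0 i / d 0 j| * c <= M * expR (- (a * t)).
  apply: le_trans (ler_wpM2l _ cN) _ => //; apply: le_trans le1 _.
  by rewrite mulrAC ler_pM2r ?expR_gt0 // /M lerDl.
rewrite normrM normfV in le2.
have e0 := expR_gt0 (- (a * t)).
rewrite -ler_pdivrMr // -(ler_pM2r c0) (le_trans le2) //.
by rewrite le_eqVlt; apply/orP; left; apply/eqP; field; rewrite gt_eqF.
Qed.

End Lift.

(** * Cocompactness *)

Section Cocompact.
Variables (R : realType) (Gamma : set 'M[R]_2) (rho : 'M[R]_2 -> 'M[R]_3).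
Variable f : 'M[R]_2 -> proj 'cV[R]_3 * proj 'cV[R]_3 * proj 'cV[R]_3.
Hypothesis dG : discrete_subgroup Gamma.
Hypothesis rep : representation Gamma rho.
Hypothesis lift : anosov_lift Gamma rho f.

Definition image_sqnorm (g : 'M[R]_2) (c : 'cV[R]_2) : R :=
  (g 0 0 * c 0 0 + g 0 1 * c 1 0) ^+ 2 + (g 1 0 * c 0 0 + g 1 1 * c 1 0) ^+ 2.

Lemma circle_compact : compact [set c : 'cV[R]_2 | c 0 0 ^+ 2 + c 1 0 ^+ 2 = 1].
Proof.
apply: (@subclosed_compact _ _ [set M : 'cV[R]_2 | forall i j, `|M i j| <= 1]).
- have cc : continuous (fun c : 'cV[R]_2 => c 0 0 ^+ 2 + c 1 0 ^+ 2).
    apply: continuous_filterP => c F FF Fc.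
    by apply: cvgD; apply: cvgM; exact: cvg_coord.
  have := @preimage_closed _ _ (fun c : 'cV[R]_2 => c 0 0 ^+ 2 + c 1 0 ^+ 2) [set 1] (fun M _ => cc M).
  by apply; exact: accessible_closed_set1 (hausdorff_accessible (@norm_hausdorff _ _)) _.
- exact: compact_box.
- move=> c /= c1 i j; rewrite ord1 -(@ler_pXn2r _ 2) ?nnegrE // real_normK ?num_real // expr1n -c1.
  have o2 (k : 'I_2) : k = 0 \/ k = 1.
    by case: k => -[|[|//]] ?; [left|right]; apply: val_inj.
  by case: (o2 i) => ->; rewrite ?lerDl ?lerDr sqr_ge0.
Qed.

Lemma cvg_image_sqnorm (T : Type) (F : set_system T) {FF : Filter F} (k : T -> 'cV[R]_2) g c :
  k @ F --> c -> (fun x => image_sqnorm g (k x)) @ F --> image_sqnorm g c.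
Proof.
move=> kc.
have h i : (fun x => g i 0 * k x 0 0 + g i 1 * k x 1 0) @ F --> g i 0 * c 0 0 + g i 1 * c 1 0.
  by apply: cvgD; (apply: cvgM; [exact: cvg_cst|exact: cvg_coord]).
by apply: cvgD; apply: cvgM; exact: h.
Qed.

Lemma sqrt_succ_sqr (r : R) : Num.sqrt (r ^+ 2 + 1) <= `|r| + 1.
Proof.
have p : 0 <= `|r| + 1 by rewrite addr_ge0.
rewrite -[X in _ <= X]ger0_norm // -sqrtr_sqr ler_wsqrtr //.
by rewrite sqrrD real_normK ?num_real // expr1n mulr1 lerD2r lerDl mulrn_wge0.
Qed.

(* A point at infinity of the Dirichlet domain centered at i *)
Lemma unbounded_dirichlet_domain :
  (forall B, exists2 h, SL R 2 h & forall g, Gamma g -> B < nrm2 (g *m h)) ->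
  exists2 c : 'cV[R]_2, c 0 0 ^+ 2 + c 1 0 ^+ 2 = 1 &
    forall g, Gamma g -> 1 <= image_sqnorm g c.
Proof.
move=> unb.
pose A := [set c : 'cV[R]_2 | c 0 0 ^+ 2 + c 1 0 ^+ 2 = 1].
have clA : closed A by apply: (compact_closed _ circle_compact); exact: (@norm_hausdorff R 'cV[R]_2).
pose E (n : nat) := [set c : 'cV[R]_2 | A c /\ forall g, Gamma g -> nrm2 g <= n.+1%:R ->
   1 - n.+1%:R^-1 <= image_sqnorm g c].
have [c hc] : exists c, forall n, E n c.
  apply: (nested_compact circle_compact).
  - move=> n; have -> : E n = A `&` \bigcap_(g in [set g | Gamma g /\ nrm2 g <= n.+1%:R])
       (A `&` [set c | 0 <= image_sqnorm g c - (1 - n.+1%:R^-1)]).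
      apply/seteqP; split=> [c [Ac hc]|c [Ac hc]].
        by split=> // g [Gg gn]; split=> //=; rewrite subr_ge0; exact: hc.
      by split=> // g Gg gn; have [_ /=] := hc g (conj Gg gn); rewrite subr_ge0.
    apply: closedI => //; apply: closed_bigI => g _.
    apply: within_closed_ge0 => //; apply/within_continuousP => c F FF _ _ Fc.
    by apply: cvgB; [exact: cvg_image_sqnorm|exact: cvg_cst].
  - by move=> n c [].
  - move=> m n mn c [Ac hc]; split=> // g Gg gm.
    apply: le_trans (hc g Gg _).
      by rewrite lerD2l lerN2 lef_pV2 ?posrE // ler_nat.
    by apply: le_trans gm _; rewrite ler_nat.
  - move=> n; have [h0 dh0 hh0] := unb (n.+1%:R ^+ 2).
    have [g0 Gg0 min0] := orbit_min dG dh0.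
    pose h := g0 *m h0.
    have dh : SL R 2 h by apply: SL_mul => //; exact: (Gamma_SL dG).
    have hmin g : Gamma g -> nrm2 h <= nrm2 (g *m h).
      by move=> Gg; rewrite mulmxA; apply: min0; exact: (GammaM dG).
    have hbig : n.+1%:R ^+ 2 < nrm2 h by exact: hh0.
    (* h h^T has entries p, r, r, q and determinant 1. When its trace is large it is close to the
       rank one matrix with entries p, s, s, q, where s^2 = p q, which is (p + q) c c^T for a unit
       vector c. The two differ by |s - r| <= 1 off the diagonal, so (p + q) |g c|^2 equals nrm2 (g
       h) up to an error nrm2 g. *)
    pose p := h 0 0 ^+ 2 + h 0 1 ^+ 2; pose q := h 1 0 ^+ 2 + h 1 1 ^+ 2.
    pose r := h 0 0 * h 1 0 + h 0 1 * h 1 1.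
    have pq : p * q = r ^+ 2 + 1.
      move: dh; rewrite /SL /= det2 => dh.
      by rewrite -[1](expr1n _ 2) -dh /p /q /r; ring.
    have p0 : 0 <= p by rewrite addr_ge0 ?sqr_ge0.
    have q0 : 0 <= q by rewrite addr_ge0 ?sqr_ge0.
    have tE : nrm2 h = p + q by rewrite nrm2E.
    have t0 : 0 < p + q by rewrite -tE; apply: le_lt_trans hbig; exact: sqr_ge0.
    pose sg : R := if 0 <= r then 1 else -1.
    have sg2 : sg ^+ 2 = 1 by rewrite /sg; case: ifP; rewrite ?sqrrN expr1n.
    have rs : r = sg * `|r|.
      rewrite /sg; case: ifP => [r0|/negbT]; first by rewrite mul1r ger0_norm.
      by rewrite -ltNge => r0; rewrite ltr0_norm // mulN1r opprK.
    pose s := sg * Num.sqrt (p * q).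
    have sr : `|s - r| <= 1.
      rewrite /s [in X in _ - X]rs -mulrBr normrM.
      have -> : `|sg| = 1 by rewrite /sg; case: ifP; rewrite ?normrN normr1.
      rewrite mul1r pq ger0_norm; first by rewrite lerBlDl sqrt_succ_sqr.
      rewrite subr_ge0 -sqrtr_sqr ler_wsqrtr // lerDl //.
    pose c : 'cV[R]_2 := \col_i (if i == 0 then Num.sqrt (p / (p + q)) else sg * Num.sqrt (q / (p + q))).
    have c00 : c 0 0 = Num.sqrt (p / (p + q)) by rewrite mxE.
    have c10 : c 1 0 = sg * Num.sqrt (q / (p + q)) by rewrite mxE.
    have cc0 : c 0 0 ^+ 2 = p / (p + q) by rewrite c00 sqr_sqrtr // divr_ge0 // ltW.
    have cc1 : c 1 0 ^+ 2 = q / (p + q).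
      by rewrite c10 exprMn sg2 mul1r sqr_sqrtr // divr_ge0 // ltW.
    have c01 : c 0 0 * c 1 0 = s / (p + q).
      rewrite c00 c10 /s mulrCA -mulrA; congr (_ * _).
      rewrite -sqrtrM ?divr_ge0 ?(ltW t0) // mulrACA -invfM -expr2 sqrtrM ?mulr_ge0 //.
      by rewrite sqrtrV ?sqr_ge0 // sqrtr_sqr ger0_norm // ltW.
    exists c; split.
      by rewrite /A /= cc0 cc1 -mulrDl divff // gt_eqF.
    move=> g Gg gn; have := hmin g Gg.
    have -> : image_sqnorm g c = (nrm2 (g *m h) + 2 * (g 0 0 * g 0 1 + g 1 0 * g 1 1) * (s - r)) / (p + q).
      transitivity ((g 0 0 ^+ 2 + g 1 0 ^+ 2) * c 0 0 ^+ 2 + 2 * (g 0 0 * g 0 1 + g 1 0 * g 1 1) * (c 0 0 * c 1 0)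
         + (g 0 1 ^+ 2 + g 1 1 ^+ 2) * c 1 0 ^+ 2); first by rewrite /image_sqnorm; ring.
      rewrite cc0 cc1 c01 nrm2E !mxE !sum2 /p /q /r.
      by field; rewrite gt_eqF.
    rewrite tE => le1; rewrite ler_pdivlMr //.
    have le2 : - nrm2 g <= 2 * (g 0 0 * g 0 1 + g 1 0 * g 1 1) * (s - r).
      have : `|2 * (g 0 0 * g 0 1 + g 1 0 * g 1 1) * (s - r)| <= nrm2 g.
        rewrite normrM -[X in _ <= X]mulr1 ler_pM // nrm2E ler_norml.
        have := (sqr_ge0 (g 0 0 - g 0 1), sqr_ge0 (g 0 0 + g 0 1), sqr_ge0 (g 1 0 - g 1 1), sqr_ge0 (g 1 0 + g 1 1)).
        by move=> [[[k1 k2] k3] k4]; apply/andP; split; nra.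
      by rewrite ler_norml => /andP[].
    have le3 : n.+1%:R <= n.+1%:R^-1 * (p + q).
      by rewrite mulrC ler_pdivlMr // -expr2 -tE ltW.
    rewrite mulrBl mul1r; apply: le_trans (_ : nrm2 (g *m h) - nrm2 g <= _).
      by rewrite lerB // (le_trans gn).
    by rewrite lerD2l.
exists c; first by have [] := hc 0%N.
move=> g Gg; rewrite leNgt; apply/negP => lt1.
pose e := 1 - image_sqnorm g c; have e0 : 0 < e by rewrite subr_gt0.
pose m := maxn (Num.truncn (nrm2 g)) (Num.truncn e^-1).
have [_ /(_ g Gg)] := hc m.
have h1 : nrm2 g <= m.+1%:R.
  apply: ltW; apply: lt_le_trans (truncnS_gt _) _; rewrite ler_nat ltnS; exact: leq_maxl.
have h2 : e^-1 < m.+1%:R.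
  apply: lt_le_trans (truncnS_gt _) _; rewrite ler_nat ltnS; exact: leq_maxr.
move=> /(_ h1); rewrite leNgt => /negP; apply.
have : m.+1%:R^-1 < e by rewrite -[e]invrK ltf_pV2 ?posrE ?invr_gt0.
by rewrite /e !ltrBrDr addrC.
Qed.

Lemma cvg_flow (T : Type) (F : set_system T) {FF : Filter F} (k : T -> R) t :
  k @ F --> t -> (fun x => geodesic_flow (k x)) @ F --> geodesic_flow t.
Proof.
move=> kt; apply: cvg_mx => i j.
have e (s : R) : geodesic_flow s i j = (if i == 0 then expR s else expR (- s)) *+ (i == j).
  by rewrite /geodesic_flow !mxE.
under eq_fun do rewrite e.
rewrite e; case: (i == j); last by rewrite mulr0n; under eq_fun do rewrite mulr0n; exact: cvg_cst.
rewrite mulr1n; under eq_fun do rewrite mulr1n.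
case: (i == 0); apply: (continuous_cvg _ (@continuous_expR R _)) => //.
exact: cvgN.
Qed.

(* Otherwise a geodesic ray escapes to infinity in the quotient, and a vertical
   norm can be made to grow along it as fast as one likes. *)
Lemma cocompact : exists B, forall h, SL R 2 h ->
  exists2 g, Gamma g & nrm2 (g *m h) <= B.
Proof.
apply: contrapT => hB.
have [c c1 hc] : exists2 c : 'cV[R]_2, c 0 0 ^+ 2 + c 1 0 ^+ 2 = 1 &
    forall g, Gamma g -> 1 <= image_sqnorm g c.
  apply: unbounded_dirichlet_domain => B; apply: contrapT => nh; apply: hB; exists B => h dh.
  apply: contrapT => ng; apply: nh; exists h => // g Gg.
  by rewrite ltNge; apply/negP => le; apply: ng; exists g.
(* The rotation with first column c: k a^s runs along the geodesic ray that ends at c. By the choice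
   of c, the distance from this ray to the orbit of the base point is attained at the base point
   itself, so the depth grows like exp (2 s). *)
pose k : 'M[R]_2 := \matrix_(i, j) (if j == 0 then c i 0 else if i == 0 then - c 1 0 else c 0 0).
have [k00 k01 k10 k11] : [/\ k 0 0 = c 0 0, k 0 1 = - c 1 0, k 1 0 = c 1 0 & k 1 1 = c 0 0].
  by rewrite !mxE.
have dk : SL R 2 k by rewrite /SL /= det2 k00 k01 k10 k11 -c1; ring.
have nka g s : nrm2 (g *m (k *m geodesic_flow s)) =
   expR (- s) ^+ 2 * nrm2 g + (expR s ^+ 2 - expR (- s) ^+ 2) * image_sqnorm g c.
  have [e1 e2 e3 e4] := flow_entry s.
  rewrite !nrm2E !mulmx2E e1 e2 e3 e4 k00 k01 k10 k11 /image_sqnorm.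
  rewrite -[in RHS](mul1r (g 0 0 ^+ 2 + g 0 1 ^+ 2 + (g 1 0 ^+ 2 + g 1 1 ^+ 2))) -c1.
  by ring.
have depthE s : 0 <= s -> depth Gamma (k *m geodesic_flow s) = expR s ^+ 2 + expR (- s) ^+ 2.
  move=> s0; apply/le_anti/andP; split.
    apply: le_trans (depth_le (k *m geodesic_flow s) (Gamma1 dG)) _.
    have cs1 : image_sqnorm 1%:M c = 1 by rewrite /image_sqnorm !mxE /= !(mul1r, mul0r, addr0, add0r).
    have n1 : nrm2 (1%:M : 'M[R]_2) = 2 by rewrite nrm2E !mxE /=; ring.
    by rewrite nka cs1 n1 le_eqVlt; apply/orP; left; apply/eqP; ring.
  have [g Gg ->] := depth_attained dG (SL_mul dk (SL_flow s)).
  rewrite nka.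
  have g2 := nrm2_ge2 (Gamma_SL dG Gg); have gc := hc g Gg.
  have e1 : expR (- s) <= expR s by rewrite ler_expR; lra.
  have e0 := expR_gt0 (- s).
  have e2 : expR (- s) ^+ 2 <= expR s ^+ 2 by rewrite !expr2 ler_pM // ltW.
  have := ler_wpM2l (sqr_ge0 (expR (- s))) g2.
  have : 0 <= (expR s ^+ 2 - expR (- s) ^+ 2) * (image_sqnorm g c - 1) by rewrite mulr_ge0 ?subr_ge0.
  by lra.
have [F fF] := framed_exists f dk; have FU := framed_unit lift fF.
pose N := gauge Gamma rho.
have vN : vertical_norm Gamma rho N := gauge_vertical_norm dG rep.
pose phi s := N (k *m geodesic_flow s) F (F *m delta_mx 0 1).
have phi0 s : 0 < phi s.
  rewrite lt_neqAle; apply/andP; split; last first.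
    rewrite /phi /N /gauge; apply: fsumr_ge0 => g _.
    by rewrite mulr_ge0 ?weight_ge0 ?wedge_norm_ge0.
  rewrite eq_sym; apply/eqP => N0.
  have [d dE] := vnorm_definite vN (SL_mul dk (SL_flow s)) FU N0.
  have : delta_mx 0 1 = diag_mx d :> 'M[R]_3 by rewrite -[LHS](mulKmx FU) dE mulKmx.
  by move=> /matrixP/(_ 0 1)/eqP; rewrite !mxE !eqxx /= mulr0n oner_eq0.
have cphi : continuous phi.
  apply: continuous_filterP => s H FH Hs.
  have /within_continuousP cN := vnorm_continuous vN.
  have := cN (k *m geodesic_flow s, F, F *m delta_mx 0 1)
     ((fun x => (k *m geodesic_flow x, F, F *m delta_mx 0 1)) @ H) _; apply.
  - by split=> //=; apply: SL_mul => //; exact: SL_flow.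
  - apply: (@filterE _ H) => x; split=> //=; apply: SL_mul => //; exact: SL_flow.
  - have H1 : (fun x => k *m geodesic_flow x) @ H --> k *m geodesic_flow s.
      by apply: cvg_mulmx; [exact: cvg_cst|exact: cvg_flow].
    exact: (cvg_pair (cvg_pair H1 (cvg_cst _)) (cvg_cst _)).
(* Along the ray the depth is y + 1 / y with y = exp (2 s), the larger root, so that s = ln y / 2 is
   a function of the depth. [sq] fixes r >= 2 and reflects the rest, which keeps the discriminant
   nonnegative and makes w continuous and positive on all of R. *)
pose sq (r : R) := (2 + `|r - 2|).
pose y (r : R) := (sq r + Num.sqrt (sq r ^+ 2 - 4)) / 2.
have y0 r : 0 < y r.
  rewrite /y divr_gt0 // ltr_wpDr ?sqrtr_ge0 // /sq ltr_wpDr //.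
pose w r := (phi (ln (y r) / 2))^-1.
have cy : continuous y.
  apply: continuous_filterP => r H FH Hr.
  have Hq : sq @ H --> sq r.
    by apply: cvgD; [exact: cvg_cst|apply: cvg_norm; apply: cvgB => //; exact: cvg_cst].
  apply: cvgM; last exact: cvg_cst.
  apply: cvgD => //; apply: (continuous_cvg _ (@sqrt_continuous R _)).
  by apply: cvgB; [apply: cvgM|exact: cvg_cst].
have cw : continuous w.
  apply: continuous_filterP => r H FH Hr.
  apply: cvgV; first by rewrite gt_eqF.
  apply: (continuous_cvg _ (cphi _)); apply: cvgM; last exact: cvg_cst.
  apply: (continuous_cvg _ (continuous_ln (y0 r))).
  exact: (continuous_cvg _ (cy _)).
have w0 r : 0 < w r by rewrite invr_gt0.
have wE s : 0 <= s -> w (depth Gamma (k *m geodesic_flow s)) * phi s = 1.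
  move=> s0; rewrite depthE // /w.
  suff -> : ln (y (expR s ^+ 2 + expR (- s) ^+ 2)) / 2 = s by rewrite mulVf // gt_eqF.
  have es : expR s * expR (- s) = 1 by exact: expRxMexpNx_1.
  have eq : sq (expR s ^+ 2 + expR (- s) ^+ 2) = expR s ^+ 2 + expR (- s) ^+ 2.
    rewrite /sq ger0_norm; first by rewrite addrC subrK.
    rewrite subr_ge0; have := sqr_ge0 (expR s - expR (- s)).
    by rewrite sqrrB es; move: (expR s ^+ 2) (expR (- s) ^+ 2) => u v; lra.
  have -> : y (expR s ^+ 2 + expR (- s) ^+ 2) = expR s ^+ 2.
    rewrite /y eq.
    have -> : (expR s ^+ 2 + expR (- s) ^+ 2) ^+ 2 - 4 = (expR s ^+ 2 - expR (- s) ^+ 2) ^+ 2.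
      transitivity ((expR s ^+ 2 + expR (- s) ^+ 2) ^+ 2 - 4 * (expR s * expR (- s)) ^+ 2).
        by rewrite es expr1n mulr1.
      by move: (expR s) (expR (- s)) => u v; ring.
    rewrite sqrtr_sqr ger0_norm; first by field.
    rewrite subr_ge0 !expr2 ler_pM ?expR_ge0 // ler_expR; lra.
  by rewrite lnXn ?expR_gt0 // expRK -(mulr_natr s) mulfK ?pnatr_eq0.
have [a [b [a0 b0 hab]]] := lift_contraction lift (scaled_vertical_norm dG vN cw w0).
(* The scaled norm is 1 all along the ray, so contraction at time b / a reads 1 <= b exp (-b),
   against (1 + b) exp (-b) <= 1. *)
have t0 : 0 < b / a by rewrite divr_gt0.
have [h1 _] := hab k F (F *m delta_mx 0 1) (b / a) dk FU fF.2.2 t0.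
have main : w (depth Gamma (k *m geodesic_flow (b / a))) * phi (b / a) <=
  b * expR (- (a * (b / a))) * (w (depth Gamma k) * N k F (F *m delta_mx 0 1)).
  exact: h1 (E_plus_transvection01 FU).
have k0 : w (depth Gamma k) * N k F (F *m delta_mx 0 1) = 1.
  by have := wE 0 (lexx 0); rewrite /phi flow0 mulmx1.
have le : 1 <= b * expR (- b).
  have aux (x z c' : R) : x <= c' * z -> x = 1 -> z = 1 -> 1 <= c'.
    by move=> le xE zE; rewrite -xE (le_trans le) // zE mulr1.
  have := aux _ _ _ main (wE _ (ltW t0)) k0.
  by rewrite (_ : a * (b / a) = b) // mulrC divfK // gt_eqF.
have := ler_wpM2r (ltW (expR_gt0 (- b))) (expR_ge1Dx b).
rewrite expRxMexpNx_1 mulrDl mul1r leNgt => /negP; apply.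
by rewrite -[X in X < _]add0r ltr_leD // expR_gt0.
Qed.

End Cocompact.

(** * Comparison of flags *)

Section Triangular.
Variable R : realType.
Implicit Types A : 'M[R]_3.

Definition dominated (e : R) (d : 'rV[R]_3) : Prop :=
  (forall j, d 0 j != 0) /\ `|d 0 0| <= e * `|d 0 1| /\ `|d 0 1| <= e * `|d 0 ord_max|.

(* The singular values of the matrices diag d and diag d' are comparable, and
   those of diag d are more and more separated as e tends to 0. *)
Lemma dominated_triangular A A' (C : R) : A' *m A = 1%:M ->
  (forall e, 0 < e -> exists d d', [/\ dominated e d, dominated e d',
     forall i j, `|d 0 i * A i j| <= C * `|d' 0 j| &
     forall i j, `|d' 0 i * A' i j| <= C * `|d 0 j|]) ->
  forall i j : 'I_3, (j < i)%N -> A i j = 0.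
Proof.
move=> AA hd.
(* K exceeds |C| / |M i j| for every nonzero entry of A and of A', so A i j != 0 implies |d_i| <= K
   |d'_j|, and symmetrically. Below, e is chosen with e K^2 = 1/2, which makes x <= K e y and y <= K
   x incompatible for y > 0. *)
pose K := 1 + `|C| * (\sum_i \sum_j `|A i j|^-1 + \sum_i \sum_j `|A' i j|^-1).
have s0 (M : 'M[R]_3) : 0 <= \sum_i \sum_j `|M i j|^-1.
  by apply: sumr_ge0 => i _; apply: sumr_ge0 => j _; rewrite invr_ge0.
have s1 (M : 'M[R]_3) i j : `|M i j|^-1 <= \sum_i \sum_j `|M i j|^-1.
  rewrite (bigD1 i) //= (bigD1 j) //= -addrA lerDl addr_ge0 //.
    by apply: sumr_ge0 => k _; rewrite invr_ge0.
  by apply: sumr_ge0 => k _; apply: sumr_ge0 => l _; rewrite invr_ge0.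
have K1 : 1 <= K by rewrite /K lerDl mulr_ge0 // addr_ge0.
have K0 : 0 < K by apply: lt_le_trans K1.
have KA (M : 'M[R]_3) (x y : R) i j : (`|M i j|^-1 <= \sum_i \sum_j `|A i j|^-1 + \sum_i \sum_j `|A' i j|^-1) ->
    `|x * M i j| <= C * `|y| -> M i j != 0 -> `|x| <= K * `|y|.
  move=> hM; rewrite normrM => le M0; rewrite -ler_pdivlMr ?normr_gt0 // in le.
  apply: le_trans le _; rewrite mulrAC; apply: ler_wpM2r => //.
  rewrite /K; apply: ler_wpDl => //.
  apply: le_trans (_ : `|C| * `|M i j|^-1 <= _).
    by rewrite ler_wpM2r ?invr_ge0 // ler_norm.
  by rewrite ler_wpM2l.
pose e := (2 * (K * K))^-1.
have KK : 1 <= K * K by rewrite -[1]mul1r ler_pM.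
have e0 : 0 < e by rewrite invr_gt0 mulr_gt0 // mulr_gt0.
have eKK : e * (K * K) = 2^-1 by rewrite /e invfM mulfVK // gt_eqF // mulr_gt0.
have e1 : e <= 1 by have := ler_wpM2l (ltW e0) KK; rewrite eKK mulr1; lra.
have [d [d' [[d0 [d01 d12]] [d'0 [d'01 d'12]] hA hA']]] := hd e e0.
have {}hA i j : A i j != 0 -> `|d 0 i| <= K * `|d' 0 j|.
  by apply: KA (hA i j); apply: ler_wpDr.
have {}hA' i j : A' i j != 0 -> `|d' 0 i| <= K * `|d 0 j|.
  by apply: KA (hA' i j); apply: ler_wpDl.
have x0 j : 0 < `|d 0 j| by rewrite normr_gt0.
have y0 j : 0 < `|d' 0 j| by rewrite normr_gt0.
have mono (x y : R) : 0 < y -> x <= e * y -> x <= y.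
  by move=> y_gt0 /le_trans; apply; rewrite -[X in _ <= X]mul1r ler_wpM2r // ltW.
have x01 := mono _ _ (x0 1) d01; have x12 := mono _ _ (x0 ord_max) d12.
have y01 := mono _ _ (y0 1) d'01; have y12 := mono _ _ (y0 ord_max) d'12.
have absurd (x y : R) : 0 < y -> x <= K * (e * y) -> y <= K * x -> False.
  move=> y_gt0 h1 h2.
  have := le_trans h2 (ler_wpM2l (ltW K0) h1).
  have -> : K * (K * (e * y)) = e * (K * K) * y by ring.
  by rewrite eKK; move: y_gt0; clear; lra.
have [k Ak] : exists k, A' ord_max k != 0.
  apply: contrapT => nk.
  have := congr1 (fun M : 'M[R]_3 => M ord_max ord_max) AA.
  rewrite !mxE eqxx big1; first by move=> /eqP; rewrite eq_sym oner_eq0.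
  move=> k _; suff -> : A' ord_max k = 0 by rewrite mul0r.
  by apply/eqP/negPn/negP => h; apply: nk; exists k.
have A2 j : `|d' 0 j| <= e * `|d' 0 ord_max| -> A ord_max j = 0.
  move=> hj; apply/eqP/negPn/negP => /hA h1.
  apply: (absurd `|d 0 ord_max| `|d' 0 ord_max|) => //.
    by apply: le_trans h1 _; rewrite ler_wpM2l // ltW.
  apply: le_trans (hA' _ _ Ak) _; rewrite ler_wpM2l ?(ltW K0) //.
  by case: (ord3 k) => -> //; exact: le_trans x12.
have A21 : A ord_max 1 = 0 by exact: A2.
have A20 : A ord_max 0 = 0.
  by apply: A2; apply: le_trans d'01 _; rewrite ler_wpM2l // ltW.
(* A 1 0 != 0 gives |d_1| <= K e |d'_1|, which forces A' 1 0 = A' 1 1 = 0; since A 2 1 = 0 as well,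
   the entry (1, 1) of A' A would vanish. *)
have A10 : A 1 0 = 0.
  apply/eqP/negPn/negP => /hA h1.
  have z j : `|d 0 j| <= `|d 0 1| -> A' 1 j = 0.
    move=> hj; apply/eqP/negPn/negP => /hA' h2.
    apply: (absurd `|d 0 1| `|d' 0 1|) => //.
      by apply: le_trans h1 _; rewrite ler_wpM2l // ltW.
    by apply: le_trans h2 _; rewrite ler_wpM2l // ltW.
  have := congr1 (fun M : 'M[R]_3 => M 1 1) AA.
  rewrite !mxE sum3 (z 0) // (z 1) // A21 !mul0r mulr0 !addr0 eqxx.
  by move=> /eqP; rewrite eq_sym oner_eq0.
by move=> i j; case: (ord3 i) => ->; case: (ord3 j) => ->.
Qed.

Definition antidiag : 'M[R]_3 := \matrix_(i, j) (i == rev_ord j)%:R.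

Lemma mul_antidiag A i j : (A *m antidiag) i j = A i (rev_ord j).
Proof.
rewrite mxE (bigD1 (rev_ord j)) //= mxE eqxx mulr1 big1 ?addr0 // => k kj.
by rewrite mxE (negPf kj) mulr0.
Qed.

Lemma antidiag_mul A i j : (antidiag *m A) i j = A (rev_ord i) j.
Proof.
rewrite mxE (bigD1 (rev_ord i)) //= mxE rev_ordK eqxx mul1r big1 ?addr0 // => k kj.
by rewrite mxE -(inj_eq rev_ord_inj) rev_ordK eq_sym (negPf kj) mul0r.
Qed.

Lemma antidiagK : antidiag *m antidiag = 1%:M.
Proof. by apply/matrixP => i j; rewrite antidiag_mul !mxE (inj_eq rev_ord_inj). Qed.

Lemma antidiag_unit : antidiag \in unitmx.
Proof. by case/mulmx1_unit: antidiagK. Qed.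

Lemma invmx_antidiag A : A \in unitmx ->
  invmx (A *m antidiag) = antidiag *m invmx A.
Proof.
move=> AU; have h : A *m antidiag *m (antidiag *m invmx A) = 1%:M.
  by rewrite -mulmxA (mulmxA antidiag) antidiagK mul1mx mulmxV.
have U : A *m antidiag \in unitmx by rewrite unitmx_mul AU antidiag_unit.
by rewrite -[RHS](mulKmx U) h mulmx1.
Qed.

(** Backward flow contracts E^-, which is E^+ for the frame read in reverse order. With the columns
    reversed when o is false, both directions of time obey the same statements. *)
Definition oriented (o : bool) (F : 'M[R]_3) := if o then F else F *m antidiag.

Lemma oriented_unit o F : F \in unitmx -> oriented o F \in unitmx.
Proof. by case: o => // FU; rewrite unitmx_mul FU antidiag_unit. Qed.

Definition oriented_row (o : bool) (d : 'rV[R]_3) : 'rV[R]_3 :=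
  if o then d else \row_j d 0 (rev_ord j).

Lemma oriented_diag o F (d : 'rV[R]_3) :
  oriented o (F *m diag_mx d) = oriented o F *m diag_mx (oriented_row o d).
Proof.
case: o => //=; rewrite -!mulmxA; congr (_ *m _).
apply/matrixP => i j; rewrite mul_antidiag antidiag_mul !mxE.
by rewrite rev_ordK -[X in _ = _ *+ (X : bool)](inj_eq rev_ord_inj) rev_ordK.
Qed.

End Triangular.

(** * Flags over flow lines that stay close *)

Section Flags.
Variables (R : realType) (Gamma : set 'M[R]_2) (rho : 'M[R]_2 -> 'M[R]_3).
Variable f : 'M[R]_2 -> proj 'cV[R]_3 * proj 'cV[R]_3 * proj 'cV[R]_3.
Hypothesis dG : discrete_subgroup Gamma.
Hypothesis rep : representation Gamma rho.
Hypothesis lift : anosov_lift Gamma rho f.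

Definition direction (o : bool) : R := if o then 1 else -1.

Lemma exp_decay (a c e : R) : 0 < a -> 0 < c -> 0 < e ->
  exists2 T, 0 < T & forall t, T <= t -> c * expR (- (a * t)) <= e.
Proof.
(* From this time on, exp (a t) >= 1 + a t >= c / e. *)
move=> a0 c0 e0; exists (c / (e * a)); first by rewrite divr_gt0 // mulr_gt0.
move=> t Tt; rewrite expRN ler_pdivrMr ?expR_gt0 //.
apply: le_trans (_ : e * (1 + a * t) <= _).
  rewrite ler_pdivrMr ?mulr_gt0 // in Tt.
  by apply: le_trans Tt _; rewrite mulrDr mulr1 [t * _]mulrC -mulrA ler_wpDl // ltW.
by rewrite ler_wpM2l ?(ltW e0) // expR_ge1Dx.
Qed.

(** The directions E_01 and E_12 for forward flow, E_10 and E_21 for backward flow, bound the two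
    ratios of consecutive entries of d; after the reversal of the columns they are the same two
    ratios. *)
Lemma eventually_dominated o h F B e : framed f h F -> 0 < e ->
  exists2 T, 0 < T & forall t, T <= t -> forall g F1 d, Gamma g ->
    framed f (g *m (h *m geodesic_flow (direction o * t))) F1 ->
    nrm2 (g *m (h *m geodesic_flow (direction o * t))) <= B ->
    rho g *m oriented o F = oriented o F1 *m diag_mx d -> dominated e d.
Proof.
move=> fF e0; have FU := framed_unit lift fF; have [dh [_ eF]] := fF.
pose E (i j : 'I_3) := forall N, vertical_norm Gamma rho N -> exists a b : R, [/\ 0 < a, 0 < b &
     forall t, 0 < t -> N (h *m geodesic_flow (direction o * t)) F (F *m delta_mx i j) <=
       b * expR (- (a * t)) * N h F (F *m delta_mx i j)].
have EP i j : o = true -> E_plus F (F *m delta_mx i j) -> E i j.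
  move=> oE Eij N vN; have [a [b [a0 b0 hab]]] := lift_contraction lift vN.
  exists a, b; split=> // t t0; rewrite /direction oE mul1r.
  by have [h1 _] := hab h F (F *m delta_mx i j) t dh FU eF t0; exact: h1.
have EM i j : o = false -> E_minus F (F *m delta_mx i j) -> E i j.
  move=> oE Eij N vN; have [a [b [a0 b0 hab]]] := lift_contraction lift vN.
  exists a, b; split=> // t t0; rewrite /direction oE mulN1r.
  by have [_ h1] := hab h F (F *m delta_mx i j) t dh FU eF t0; exact: h1.
have step i j : i != j -> E i j -> exists2 T, 0 < T & forall t, T <= t -> forall g F1 d, Gamma g ->
    framed f (g *m (h *m geodesic_flow (direction o * t))) F1 ->
    nrm2 (g *m (h *m geodesic_flow (direction o * t))) <= B ->
    rho g *m F = F1 *m diag_mx d -> `|d 0 i| <= e * `|d 0 j|.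
  move=> ij Eij; have [a [c [a0 c0 hc]]] := @contraction _ _ _ _ dG rep lift (direction o) i j h F B ij Eij fF.
  have [T T0 hT] := exp_decay a0 c0 e0; exists T => // t Tt g F1 d Gg fF1 gB dE.
  apply: le_trans (hc t g F1 d (lt_le_trans T0 Tt) Gg fF1 gB dE) _.
  by rewrite ler_wpM2r // hT.
have nz g F1 d : Gamma g -> rho g *m oriented o F = oriented o F1 *m diag_mx d -> forall j, d 0 j != 0.
  move=> Gg; apply: diag_unit; rewrite unitmx_mul (rho_unit rep Gg) oriented_unit //.
case oE : o.
  have [T1 T10 h1] := step 0 1 isT (EP 0 1 oE (E_plus_transvection01 FU)).
  have [T2 T20 h2] := step 1 ord_max isT (EP 1 ord_max oE (E_plus_transvection12 FU)).
  exists (Num.max T1 T2); first by rewrite lt_max T10.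
  move=> t; rewrite ge_max => /andP[t1 t2] g F1 d Gg fF1 gB dE.
  rewrite oE in nz h1 h2; split; first exact: nz dE.
  by split; [exact: h1 t t1 g F1 d Gg fF1 gB dE|exact: h2 t t2 g F1 d Gg fF1 gB dE].
have [T1 T10 h1] := step 1 0 isT (EM 1 0 oE (E_minus_transvection10 FU)).
have [T2 T20 h2] := step ord_max 1 isT (EM ord_max 1 oE (E_minus_transvection21 FU)).
exists (Num.max T1 T2); first by rewrite lt_max T10.
move=> t; rewrite ge_max => /andP[t1 t2] g F1 d Gg fF1 gB dE.
rewrite oE in nz h1 h2; split; first exact: nz dE.
pose d' := \row_j d 0 (rev_ord j).
have dE' : rho g *m F = F1 *m diag_mx d'.
  have := congr1 (fun M => M *m antidiag R) dE.
  rewrite /oriented /= -!mulmxA antidiagK mulmx1 => ->; congr (_ *m _).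
  apply/matrixP => i j; rewrite antidiag_mul mul_antidiag !mxE.
  by rewrite (inj_eq rev_ord_inj).
have d'E i j : rev_ord i = j -> d' 0 i = d 0 j by move=> <-; rewrite mxE.
have := h1 t t1 g F1 d' Gg fF1 gB dE'; have := h2 t t2 g F1 d' Gg fF1 gB dE'.
rewrite (d'E ord_max 0) ?(d'E 1 1) ?(d'E 0 ord_max); try exact: val_inj.
by [].
Qed.

(** By cocompactness some g brings the flowed point of h back to a bounded region, and that of h'
    with it. There the matrix between the frames and its inverse are bounded; between F and F' it is
    the same matrix up to diagonal factors, dominated more and more as t grows. The conclusion says
    that the flags spanned by the first columns agree. *)
Lemma flag_triangular o o' h h' F F' B : framed f h F -> framed f h' F' ->
  (forall t, 0 < t -> nrm2 (geodesic_flow (- (direction o * t)) *m invmx h *m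
     (h' *m geodesic_flow (direction o' * t))) <= B) ->
  forall i j : 'I_3, (j < i)%N -> (invmx (oriented o F) *m oriented o' F') i j = 0.
Proof.
move=> fF fF' hB.
have FU := framed_unit lift fF; have FU' := framed_unit lift fF'.
have oU := oriented_unit o FU; have oU' := oriented_unit o' FU'.
have [B0 hB0] := cocompact dG rep lift.
pose B1 := `|B0| * `|B|.
have [C C0 hC] := framed_ball_inv lift B0.
have [C' C'0 hC'] := framed_ball_inv lift B1.
pose A := invmx (oriented o F) *m oriented o' F'.
pose A' := invmx (oriented o' F') *m oriented o F.
have AA : A' *m A = 1%:M by rewrite /A' /A mulmxA mulmxK // mulVmx.
apply: (@dominated_triangular _ A A' (C *+ 3 + C' *+ 3) AA) => e e0.
have [T T0 hT] := @eventually_dominated o h F B0 e fF e0.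
have [T' T'0 hT'] := @eventually_dominated o' h' F' B1 e fF' e0.
pose t := Num.max T T'.
have Tt : T <= t by rewrite le_max lexx.
have T't : T' <= t by rewrite le_max lexx orbT.
have t0 : 0 < t by exact: lt_le_trans Tt.
have [dh _] := fF; have [dh' _] := fF'.
have da : SL R 2 (h *m geodesic_flow (direction o * t)) by apply: SL_mul => //; exact: SL_flow.
have da' : SL R 2 (h' *m geodesic_flow (direction o' * t)) by apply: SL_mul => //; exact: SL_flow.
have [g Gg gB] := hB0 _ da.
have gB1 : nrm2 (g *m (h' *m geodesic_flow (direction o' * t))) <= B1.
  have -> : g *m (h' *m geodesic_flow (direction o' * t)) =
     g *m (h *m geodesic_flow (direction o * t)) *m
     (geodesic_flow (- (direction o * t)) *m invmx h *m (h' *m geodesic_flow (direction o' * t))).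
    rewrite !mulmxA; congr (_ *m _ *m _).
    by rewrite flowK mulmxK // SL_unit.
  apply: le_trans (nrm2_mul _ _) _; apply: ler_pM; rewrite ?nrm2_ge0 //.
    exact: le_trans gB (ler_norm _).
  exact: le_trans (hB t t0) (ler_norm _).
have dga := SL_mul (Gamma_SL dG Gg) da; have dga' := SL_mul (Gamma_SL dG Gg) da'.
have [F1 fF1] := framed_exists f dga; have [F1' fF1'] := framed_exists f dga'.
have fFa := framed_flow lift (direction o * t) fF.
have fFa' := framed_flow lift (direction o' * t) fF'.
have [d0 _ dE0] := framed_equivariant rep lift Gg fFa fF1.
have [d0' _ dE0'] := framed_equivariant rep lift Gg fFa' fF1'.
pose d := oriented_row o d0; pose d' := oriented_row o' d0'.
have ori o1 (M : 'M[R]_3) : oriented o1 (rho g *m M) = rho g *m oriented o1 M.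
  by case: o1 => //=; rewrite mulmxA.
have dE : rho g *m oriented o F = oriented o F1 *m diag_mx d by rewrite -ori dE0 oriented_diag.
have dE' : rho g *m oriented o' F' = oriented o' F1' *m diag_mx d' by rewrite -ori dE0' oriented_diag.
have oU1 := oriented_unit o (framed_unit lift fF1).
have oU1' := oriented_unit o' (framed_unit lift fF1').
have entry o1 (M : 'M[R]_3) k i j : framed f k M -> `|oriented o1 M i j| <= 1.
  move=> [_ uM]; case: o1 => /=; rewrite ?mul_antidiag; exact: unit_frame_entry uM.
have entryV o1 (M : 'M[R]_3) k D : framed f k M ->
    (forall i j, `|invmx M i j| <= D) -> forall i j, `|invmx (oriented o1 M) i j| <= D.
  move=> fM hD i j; case: o1 => //=.
  by rewrite invmx_antidiag ?(framed_unit lift fM) // antidiag_mul.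
have prodE (M N : 'M[R]_3) D i j : (forall i j, `|M i j| <= D) -> (forall i j, `|N i j| <= 1) ->
    `|(M *m N) i j| <= D *+ 3.
  move=> hM hN; rewrite mxE; apply: le_trans (ler_norm_sum _ _ _) _.
  have -> : D *+ 3 = \sum_(k < 3) D by rewrite sumr_const card_ord.
  by apply: ler_sum => k _; rewrite normrM -[D]mulr1; apply: ler_pM.
have key (M M1 N N1 : 'M[R]_3) x y D : M \in unitmx -> M1 \in unitmx ->
   rho g *m M = M1 *m diag_mx x -> rho g *m N = N1 *m diag_mx y ->
   (forall i j, `|(invmx M1 *m N1) i j| <= D) ->
   forall i j, `|x 0 i * (invmx M *m N) i j| <= D * `|y 0 j|.
  move=> MU MU1 xE yE hD i j.
  have -> : x 0 i * (invmx M *m N) i j = (diag_mx x *m (invmx M *m N)) i j.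
    by rewrite mul_diag_mx mxE.
  have -> : diag_mx x *m (invmx M *m N) = invmx M1 *m N1 *m diag_mx y.
    rewrite -mulmxA -yE -[diag_mx x](mulKmx MU1) -xE -!mulmxA.
    by rewrite (mulmxA M) mulmxV // mul1mx.
  by rewrite mul_mx_diag mxE normrM ler_wpM2r.
exists d, d'; split.
- exact: hT Tt g F1 d Gg fF1 gB dE.
- exact: hT' T't g F1' d' Gg fF1' gB1 dE'.
- apply: (key _ (oriented o F1) _ (oriented o' F1')) => // i j.
  apply: le_trans (_ : C *+ 3 <= _); last by rewrite lerDl mulrn_wge0 // ltW.
  apply: prodE; last by move=> k l; exact: entry fF1'.
  by apply: (entryV _ _ _ _ fF1) => k l; exact: hC fF1 gB.
- apply: (key _ (oriented o' F1') _ (oriented o F1)) => // i j.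
  apply: le_trans (_ : C' *+ 3 <= _); last by rewrite lerDr mulrn_wge0 // ltW.
  apply: prodE; last by move=> k l; exact: entry fF1.
  by apply: (entryV _ _ _ _ fF1') => k l; exact: hC' fF1' gB1.
Qed.

End Flags.

(** * The limit curve in a pencil of lines *)

Lemma cvg_invmx (R : realType) (T : Type) (F : set_system T) n
    {FF : Filter F} (f : T -> 'M[R]_n) (M : 'M[R]_n) :
  F [set x | f x \in unitmx] -> M \in unitmx ->
  f @ F --> M -> (fun x => invmx (f x)) @ F --> invmx M.
Proof.
move=> uf uM hf.
have h : (fun x => (\det (f x))^-1 *: \adj (f x)) @ F --> invmx M.
  rewrite /invmx uM; apply: cvg_mx => i j.
  under eq_fun do rewrite mxE.
  rewrite mxE; apply: cvgM; last by apply: cvg_coord; exact: cvg_adj.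
  by apply: cvgV; [rewrite -unitfE -unitmxE|exact: cvg_det].
apply: cvg_trans h; apply: near_eq_cvg.
by apply: filterS uf => x ux; rewrite /invmx (ux : f x \in unitmx).
Qed.

Section LimitCurve.
Variables (R : realType) (Gamma : set 'M[R]_2) (rho : 'M[R]_2 -> 'M[R]_3).
Variable f : 'M[R]_2 -> proj 'cV[R]_3 * proj 'cV[R]_3 * proj 'cV[R]_3.
Hypothesis dG : discrete_subgroup Gamma.
Hypothesis rep : representation Gamma rho.
Hypothesis lift : anosov_lift Gamma rho f.

Definition mx2 (a b c d : R) : 'M[R]_2 :=
  \matrix_(i, j) (if i == 0 then (if j == 0 then a else b) else (if j == 0 then c else d)).

Lemma mx2_entry a b c d : [/\ mx2 a b c d 0 0 = a, mx2 a b c d 0 1 = b,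
  mx2 a b c d 1 0 = c & mx2 a b c d 1 1 = d].
Proof. by rewrite !mxE. Qed.

Lemma flow_mul (s s' : R) (p : 'M[R]_2) i j :
  (geodesic_flow s *m p *m geodesic_flow s') i j =
  (if i == 0 then expR s else expR (- s)) * p i j * (if j == 0 then expR s' else expR (- s')).
Proof. by rewrite mul_mx_diag mxE mul_diag_mx !mxE. Qed.

Lemma exp_le1 (t : R) : 0 < t -> expR (- t) <= 1.
Proof. by move=> t0; rewrite expR_le1 oppr_le0 ltW. Qed.

Lemma rev_ord3_lt (i j : 'I_3) : (i < j)%N -> (rev_ord j < rev_ord i)%N.
Proof. by case: (ord3 i) => ->; case: (ord3 j) => ->. Qed.

(** For p upper triangular and t > 0, the norm of a^-t p a^t is at most that of p, since the upper
    right entry shrinks. This is the constancy of the flag pi_+ on right orbits of A_+; [lower_flag]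
    is its counterpart for backward time. *)
Lemma upper_flag h p F F' : framed f h F -> framed f (h *m p) F' -> p 1 0 = 0 ->
  forall i j : 'I_3, (j < i)%N -> (invmx F *m F') i j = 0.
Proof.
move=> fF fF' p0; have [dh _] := fF.
apply: (@flag_triangular _ _ _ _ dG rep lift true true h (h *m p) F F' (nrm2 p) fF fF').
move=> t t0; rewrite /direction !mul1r -mulmxA !mulmxA mulmxKV ?SL_unit //.
rewrite !nrm2E !flow_mul /= p0 !opprK.
have e1 : expR (- t) * expR t = 1 by rewrite mulrC expRxMexpNx_1.
have e2 : expR t * expR (- t) = 1 by exact: expRxMexpNx_1.
rewrite !mulr0 mul0r mulrAC e1 mul1r [X in _ + (_ + X ^+ 2)]mulrAC e2 mul1r.
rewrite lerD2r lerD2l mulrAC exprMn ler_piMl ?sqr_ge0 //.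
rewrite expr_le1 ?mulr_ge0 ?expR_ge0 //.
by rewrite -[X in _ <= X]mulr1 ler_pM ?expR_ge0 // exp_le1.
Qed.

Lemma lower_flag h p F F' : framed f h F -> framed f (h *m p) F' -> p 0 1 = 0 ->
  forall i j : 'I_3, (i < j)%N -> (invmx F *m F') i j = 0.
Proof.
move=> fF fF' p0 i j ij; have [dh _] := fF.
have hB : forall t : R, 0 < t ->
    nrm2 (geodesic_flow (- (direction R false * t)) *m invmx h *m
     (h *m p *m geodesic_flow (direction R false * t))) <= nrm2 p.
  move=> t t0; rewrite /direction !mulN1r !mulmxA mulmxKV ?SL_unit //.
  rewrite !nrm2E !flow_mul /= p0 !opprK.
  have e1 : expR (- t) * expR t = 1 by rewrite mulrC expRxMexpNx_1.
  have e2 : expR t * expR (- t) = 1 by exact: expRxMexpNx_1.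
  rewrite !mulr0 mul0r mulrAC e2 mul1r [X in _ + (_ + X ^+ 2)]mulrAC e1 mul1r.
  rewrite lerD2l lerD2r mulrAC exprMn ler_piMl ?sqr_ge0 //.
  rewrite expr_le1 ?mulr_ge0 ?expR_ge0 //.
  by rewrite -[X in _ <= X]mulr1 ler_pM ?expR_ge0 // exp_le1.
have FU := framed_unit lift fF.
have := @flag_triangular _ _ _ _ dG rep lift false false h (h *m p) F F' (nrm2 p) fF fF' hB
   (rev_ord i) (rev_ord j).
rewrite /oriented invmx_antidiag // mulmxA mul_antidiag -mulmxA antidiag_mul !rev_ordK; apply.
exact: rev_ord3_lt.
Qed.

Definition quarter_turn : 'M[R]_2 := mx2 0 (-1) 1 0.

Lemma SL_quarter_turn : SL R 2 quarter_turn.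
Proof. by rewrite /SL /= det2; have [-> -> -> ->] := mx2_entry 0 (-1) 1 0; rewrite mul0r mulN1r add0r opprK. Qed.

(* Exchanging e_1 and e_2 reverses the frame, that is, eta_+ = eta_- on RP^1. *)
Lemma framed_quarter_turn h F : framed f h F -> framed f (h *m quarter_turn) (F *m antidiag R).
Proof.
move=> fF; have [dh [u1 _]] := fF; have FU := framed_unit lift fF.
have dhJ : SL R 2 (h *m quarter_turn) := SL_mul dh SL_quarter_turn.
have [F' fF'] := framed_exists f dhJ; have FU' := framed_unit lift fF'.
(* With J the quarter turn, a^-x J a^-x = J: the flow line of h and the reversed flow line of h J
   stay at constant distance in both directions of time. Hence the matrix between F' and the
   reversed F is triangular in both senses, that is, diagonal. *)
have hB o : forall t : R, 0 < t ->
    nrm2 (geodesic_flow (- (direction R o * t)) *m invmx h *m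
     (h *m quarter_turn *m geodesic_flow (direction R (~~ o) * t))) <= 2.
  move=> t t0; rewrite !mulmxA mulmxKV ?SL_unit //.
  rewrite !nrm2E !flow_mul /=; have [-> -> -> ->] := mx2_entry 0 (-1) 1 0.
  have -> : direction R (~~ o) * t = - (direction R o * t).
    by case: o; rewrite /direction /= ?mulN1r ?mul1r ?opprK.
  set x := direction R o * t.
  rewrite opprK !mulr0 !mul0r mulr1 mulrN1 mulNr sqrrN expRxMexpNx_1 mulrC.
  by rewrite mulrC [_ * expR x]mulrC expRxMexpNx_1 expr0n !expr1n /= !(add0r, addr0).
have A1 := @flag_triangular _ _ _ _ dG rep lift false true _ _ _ _ 2 fF fF' (hB false).
have A2 := @flag_triangular _ _ _ _ dG rep lift true false _ _ _ _ 2 fF fF' (hB true).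
pose A := invmx F *m F' *m antidiag R.
have Alow (i j : 'I_3) : (j < i)%N -> A i j = 0.
  by move=> ij; rewrite /A -mulmxA; exact: A2.
have Aup (i j : 'I_3) : (i < j)%N -> A i j = 0.
  move=> ij; have := A1 (rev_ord i) (rev_ord j).
  rewrite /oriented invmx_antidiag // -mulmxA antidiag_mul rev_ordK /A mul_antidiag; apply.
  exact: rev_ord3_lt.
have AE : A = diag_mx (\row_j A j j).
  apply/matrixP => i j; rewrite [RHS]mxE [X in X *+ _]mxE; case: (ltngtP i j) => [ij|ij|/val_inj ->].
  - by rewrite Aup // (_ : i == j = false) ?mulr0n // -val_eqE ltn_eqF.
  - by rewrite Alow // (_ : i == j = false) ?mulr0n // -val_eqE gtn_eqF.
  - by rewrite eqxx mulr1n.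
have FE : F' = F *m antidiag R *m diag_mx (oriented_row false (\row_j A j j)).
  transitivity (F *m A *m antidiag R).
    by rewrite /A -!mulmxA antidiagK mulmx1 mulKVmx.
  rewrite -[F *m antidiag R]/(oriented false F) -oriented_diag -AE.
  by [].
have FaU : F *m antidiag R \in unitmx by rewrite unitmx_mul FU antidiag_unit.
split=> //; split.
  move=> j; have -> : col j (F *m antidiag R) = col (rev_ord j) F; last exact: u1.
  by apply/colP => i; rewrite [LHS]mxE mul_antidiag !mxE.
have [_ [_ <-]] := fF'; apply/frameP => j; rewrite vertex_frame FE.
set G := F *m antidiag R; set d := oriented_row _ _.
have -> : col j (G *m diag_mx d) = d 0 j *: col j G.
  by apply/colP => i; rewrite mul_mx_diag !mxE mulrC.
by rewrite lineZ ?col_neq0 //; apply: diag_unit FE _.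
Qed.

Lemma same_direction h p F F' : framed f h F -> framed f (h *m p) F' -> p 1 0 = 0 ->
  exists2 c, c != 0 & col 0 F' = c *: col 0 F.
Proof.
move=> fF fF' p0; have FU := framed_unit lift fF; have FU' := framed_unit lift fF'.
have A := upper_flag fF fF' p0.
have E : col 0 F' = (invmx F *m F') 0 0 *: col 0 F.
  have {1}-> : F' = F *m (invmx F *m F') by rewrite mulKVmx.
  move: A; set B := invmx F *m F' => A; apply/colP => i.
  by rewrite !mxE sum3 (A 1 0) // (A ord_max 0) // !mulr0 !addr0 mulrC !mxE.
exists ((invmx F *m F') 0 0) => //.
apply/eqP => c0; have := col_neq0 0 FU'; rewrite E c0 scale0r.
by rewrite eqxx.
Qed.

Definition horocycle (s : R) : 'M[R]_2 := mx2 1 0 s 1.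

Lemma SL_horocycle s : SL R 2 (horocycle s).
Proof. by rewrite /SL /= det2; have [-> -> -> ->] := mx2_entry 1 0 s 1; rewrite mulr1 mul0r subr0. Qed.

Lemma SL_row0 p : SL R 2 p -> p 0 1 = 0 -> p 0 0 != 0.
Proof.
by rewrite /SL /= det2 => + p0; rewrite p0 mul0r subr0 => p1; apply/eqP => p00; move: p1; rewrite p00 mul0r => /eqP; rewrite eq_sym oner_eq0.
Qed.

Definition coord (F : 'M[R]_3) (x : 'cV[R]_3) i := (invmx F *m x) i 0.

Lemma coordE (F F' : 'M[R]_3) i j : coord F (col j F') i = (invmx F *m F') i j.
Proof. by rewrite /coord colE mulmxA -colE mxE. Qed.

Lemma coordZ (F : 'M[R]_3) c x i : coord F (c *: x) i = c * coord F x i.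
Proof. by rewrite /coord -scalemxAr mxE. Qed.

(** By [lower_flag] the matrix is lower triangular, and it is invertible, so its diagonal does not
    vanish. Geometrically, eta (h p [e_1]) lies off the limit line at eta (h [e_2]); this keeps the
    coordinate psi finite. *)
Lemma framed_row0 h p F F' : framed f h F -> framed f (h *m p) F' -> p 0 1 = 0 ->
  coord F (col 0 F') 0 != 0 /\ (invmx F *m F') 1 1 != 0.
Proof.
move=> fF fF' p0; have FU := framed_unit lift fF; have FU' := framed_unit lift fF'.
have A := lower_flag fF fF' p0; rewrite coordE.
have AU : invmx F *m F' \in unitmx by rewrite unitmx_mul unitmx_inv FU.
move: (invmx F *m F') AU A => B BU A.
have := BU; rewrite unitmxE unitfE det_trig; last first.
  by apply/is_trig_mxP => i j; exact: A.
by move=> /prodf_neq0 h0; rewrite !h0.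
Qed.

(** The matrix x x^T, where x holds the coordinates in the basis F of a unit vector on the limit
    line. Quotients of its entries give x_1 / x_0, are insensitive to the sign of the vector and
    depend continuously on h, F and s. *)
Definition pencil h (F : 'M[R]_3) (s : R) : 'M[R]_3 :=
  invmx F *m projector (f (h *m horocycle s)).1.1 *m (invmx F)^T.

(* The affine coordinate of [eta_+ (h [1 : s])] in the pencil of lines through
   [eta_- (h [0 : 1])], computed from the orthogonal projector. *)
Definition psi h F s : R := pencil h F s 1 0 / pencil h F s 0 0.

Lemma pencilE h F F1 s i j : framed f (h *m horocycle s) F1 ->
  pencil h F s i j = coord F (col 0 F1) i * coord F (col 0 F1) j.
Proof.
move=> [_ [u1 /frameP/(_ 0) e]]; rewrite /pencil.
have -> : (f (h *m horocycle s)).1.1 = line (col 0 F1) by rewrite e.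
rewrite projector_unit //.
have -> : invmx F *m (col 0 F1 *m (col 0 F1)^T) *m (invmx F)^T =
  (invmx F *m col 0 F1) *m (invmx F *m col 0 F1)^T by rewrite trmx_mul !mulmxA.
by rewrite mxE big_ord1 [_^T _ _]mxE.
Qed.

Lemma pencil_neq0 h F s : framed f h F -> pencil h F s 0 0 != 0.
Proof.
move=> fF; have [dh _] := fF.
have [F1 fF1] := framed_exists f (SL_mul dh (SL_horocycle s)).
have [n0 _] := framed_row0 fF fF1 (let: And4 _ e _ _ := mx2_entry 1 0 s 1 in e).
by rewrite (pencilE _ _ _ fF1) mulf_neq0.
Qed.

Lemma psiE h F F' s p : framed f h F -> SL R 2 p -> p 1 0 = 0 ->
  framed f (h *m horocycle s *m p) F' ->
  coord F (col 0 F') 0 != 0 /\ psi h F s = coord F (col 0 F') 1 / coord F (col 0 F') 0.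
Proof.
move=> fF dp p0 fF'; have [dh _] := fF.
have dhs : SL R 2 (h *m horocycle s) := SL_mul dh (SL_horocycle s).
have [F1 fF1] := framed_exists f dhs.
have [c c0 cE] := same_direction fF1 fF' p0.
have := pencil_neq0 s fF; rewrite (pencilE _ _ _ fF1) mulf_eq0 orbb => n0.
rewrite cE !coordZ; split; first by rewrite mulf_neq0.
rewrite -mulf_div divff // mul1r /psi.
by rewrite !(pencilE _ _ _ fF1) -mulf_div divff // mulr1.
Qed.

(** At the source, l times the horocycle matrix of s is the horocycle matrix of an affine function
    of s times an upper triangular matrix, which does not move the point of the curve. At the
    target, with F1 a frame over h l, [rho g] is diagonal between F1 and F', and the matrix between
    F and F1 is lower triangular, so x_1 / x_0 undergoes an affine map; as both sides vanish at s =
    0, only the factor c remains. *)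
Lemma renormalization h F g l F' : framed f h F -> Gamma g -> SL R 2 l -> l 0 1 = 0 ->
  framed f (g *m (h *m l)) F' ->
  exists c, forall s, psi (g *m (h *m l)) F' s =
    c * (psi h F (l 1 0 / l 0 0 + s / l 0 0 ^+ 2) - psi h F (l 1 0 / l 0 0)).
Proof.
move=> fF Gg dl l01 fF'; have [dh _] := fF.
have l00 := SL_row0 dl l01.
have l11 : l 1 1 = (l 0 0)^-1.
  move: dl; rewrite /SL /= det2 l01 mul0r subr0 => dl.
  by apply: (mulfI l00); rewrite dl mulfV.
have dhl := SL_mul dh dl.
have [F1 fF1] := framed_exists f dhl.
have FU := framed_unit lift fF; have FU1 := framed_unit lift fF1; have FU' := framed_unit lift fF'.
have [d d0 dE] := framed_equivariant rep lift Gg fF1 fF'.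
have Alow := lower_flag fF fF1 l01.
have [A00 A11] := framed_row0 fF fF1 l01.
rewrite coordE in A00.
pose A := invmx F *m F1.
exists (d 0 1 / d 0 0 * (A 0 0 / A 1 1)) => s.
have horo t : exists p, [/\ SL R 2 p, p 1 0 = 0 & l *m horocycle t = horocycle (l 1 0 / l 0 0 + t / l 0 0 ^+ 2) *m p].
  exists (mx2 (l 0 0) 0 0 (l 0 0)^-1); split.
  - by rewrite /SL /= det2; have [-> -> -> ->] := mx2_entry (l 0 0) 0 0 (l 0 0)^-1; rewrite mulfV // mul0r subr0.
  - by have [] := mx2_entry (l 0 0) 0 0 (l 0 0)^-1.
  - have [a1 a2 a3 a4] := mx2_entry (l 0 0) 0 0 (l 0 0)^-1.
    have [b1 b2 b3 b4] := mx2_entry 1 0 t 1.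
    have [c1 c2 c3 c4] := mx2_entry 1 0 (l 1 0 / l 0 0 + t / l 0 0 ^+ 2) 1.
    apply: mx2P; rewrite !mulmx2E /horocycle ?(a1, a2, a3, a4) ?(b1, b2, b3, b4) ?(c1, c2, c3, c4) ?l01 ?l11;
      by rewrite ?(mulr0, mul0r, mulr1, mul1r, addr0, add0r) //; field.
have [p [dp p10 pE]] := horo s.
have dhs : SL R 2 (h *m horocycle (l 1 0 / l 0 0 + s / l 0 0 ^+ 2) *m p).
  by apply: SL_mul => //; apply: SL_mul => //; exact: SL_horocycle.
have [F2 fF2] := framed_exists f dhs.
have [X00 ->] := psiE fF dp p10 fF2.
have [p0 [dp0 p010 p0E]] := horo 0.
have fF1' : framed f (h *m horocycle (l 1 0 / l 0 0) *m p0) F1.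
  rewrite mul0r addr0 in p0E; rewrite -mulmxA -p0E.
  have -> : horocycle 0 = 1%:M by apply: mx2P; rewrite !mxE.
  by rewrite mulmx1.
have [_ ->] := psiE fF dp0 p010 fF1'.
have E2 : g *m (h *m l) *m horocycle s *m 1%:M = g *m (h *m horocycle (l 1 0 / l 0 0 + s / l 0 0 ^+ 2) *m p).
  by rewrite mulmx1 -!mulmxA pE.
have d3 : SL R 2 (g *m (h *m horocycle (l 1 0 / l 0 0 + s / l 0 0 ^+ 2) *m p)).
  by apply: SL_mul => //; exact: (Gamma_SL dG).
have [F3 fF3] := framed_exists f d3.
have [e e0 eE] := framed_equivariant rep lift Gg fF2 fF3.
have fF3' : framed f (g *m (h *m l) *m horocycle s *m 1%:M) F3 by rewrite E2.
have one10 : (1%:M : 'M[R]_2) 1 0 = 0 by rewrite mxE.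
have [Y00 ->] := psiE fF' (SL1 R 2) one10 fF3'.
pose X i := coord F (col 0 F2) i; pose Z i := coord F1 (col 0 F2) i; pose Y i := coord F' (col 0 F3) i.
have YE i : Y i = d 0 i / e 0 0 * Z i.
  have c3 : rho g *m col 0 F2 = e 0 0 *: col 0 F3.
    rewrite colE mulmxA eE -colE; apply/colP => k.
    by rewrite mul_mx_diag !mxE mulrC.
  have {1}-> : Y i = (e 0 0)^-1 * coord F' (rho g *m col 0 F2) i by rewrite c3 coordZ mulKf.
  rewrite [d 0 i / _]mulrC -mulrA; congr (_ * _).
  rewrite /Z /coord mulmxA.
  have -> : invmx F' *m rho g = diag_mx d *m invmx F1.
    by rewrite -[diag_mx d](mulKmx FU') -dE -!mulmxA mulmxV // mulmx1.
  by rewrite -mulmxA mul_diag_mx mxE.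
have XE i : X i = \sum_k A i k * Z k.
  have -> : X i = (A *m (invmx F1 *m col 0 F2)) i 0.
    by rewrite /A -mulmxA mulKVmx.
  by rewrite mxE.
have X0E : X 0 = A 0 0 * Z 0.
  by rewrite XE sum3 /A (Alow 0 1) // (Alow 0 ord_max) // !mul0r !addr0.
have X1E : X 1 = A 1 0 * Z 0 + A 1 1 * Z 1.
  by rewrite XE sum3 /A (Alow 1 ord_max) // mul0r addr0.
rewrite -/(X 0) -/(X 1) -/(Y 0) -/(Y 1) !coordE -/A !YE X1E X0E.
have Z0 : Z 0 != 0 by move: X00; rewrite -/(X 0) X0E mulf_eq0 negb_or => /andP[].
by field; rewrite Z0 (e0 0) (d0 0) A00 A11.
Qed.

Lemma psi0 h F : framed f h F -> psi h F 0 = 0.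
Proof.
move=> fF; have fF' : framed f (h *m horocycle 0 *m 1%:M) F.
  have -> : horocycle 0 = 1%:M by apply: mx2P; rewrite !mxE.
  by rewrite !mulmx1.
have one10 : (1%:M : 'M[R]_2) 1 0 = 0 by rewrite mxE.
have [_ ->] := psiE fF (SL1 R 2) one10 fF'.
by rewrite coordE mulVmx ?(framed_unit lift fF) // mxE /= mul0r.
Qed.

Lemma cvg_pencil (T : Type) (H : set_system T) {FH : Filter H}
    (k : T -> 'M[R]_2) (A : T -> 'M[R]_3) (s : T -> R) h F s0 i j :
  framed f h F -> H [set x | framed f (k x) (A x)] -> k @ H --> h -> A @ H --> F ->
  s @ H --> s0 -> (fun x => pencil (k x) (A x) (s x) i j) @ H --> pencil h F s0 i j.
Proof.
move=> fF HA kh AF ss; have [dh _] := fF.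
have FU := framed_unit lift fF.
have AV : (fun x => invmx (A x)) @ H --> invmx F.
  apply: cvg_invmx => //.
  by apply: filterS HA => x; exact: (framed_unit lift).
apply: cvg_coord; apply: cvg_mulmx; last exact: cvg_trmx.
apply: cvg_mulmx => //.
have /= h0 := @cvg_projector _ _ _ _ lift T H _ (fun x => k x *m horocycle (s x)) (h *m horocycle s0) 0.
apply: h0.
- by apply: SL_mul => //; exact: SL_horocycle.
- by apply: filterS HA => x [dk _]; apply: SL_mul => //; exact: SL_horocycle.
- apply: cvg_mulmx => //; apply: cvg_mx => k' l; rewrite /horocycle /mx2.
  under eq_fun do rewrite mxE.
  by rewrite mxE; case: ifP => _; case: ifP => _ //; exact: cvg_cst.
Qed.

Lemma psi_continuous B s : {within framed_ball f B, continuous (fun p => psi p.1 p.2 s)}.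
Proof.
apply: (@framed_ball_cvg R f B R (fun h F => psi h F s)) => h F H FH fF HA Hh HF.
apply: cvgM; first by apply: cvg_pencil => //; exact: cvg_cst.
by apply: cvgV; [exact: pencil_neq0|apply: cvg_pencil => //; exact: cvg_cst].
Qed.

End LimitCurve.

(** * Renormalization of Lipschitz functions *)

Section Renormalization.
Variables (R : realType) (T : topologicalType) (K : set T) (psi : T -> R -> R).
Hypothesis cK : compact K.
Hypothesis clK : closed K.
Hypothesis cpsi : forall s, {within K, continuous (psi^~ s)}.
Hypothesis psi0 : forall p, K p -> psi p 0 = 0.

(** All zooms of phi belong to the family, up to a factor. The factor c is unconstrained;
    compactness of K makes up for the lack of a bound on it. *)
Definition renormalizable (phi : R -> R) : Prop := forall s0 r, 0 < r ->
  exists2 q, K q & exists c, forall s, psi q s = c * (phi (s0 + r * s) - phi s0).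

Lemma renormalizable_linear (phi : R -> R) : renormalizable phi ->
  (forall x, 0 <= x <= 1 -> phi x = x * phi 1) ->
  exists2 p, K p & forall x, psi p x = x * psi p 1.
Proof.
move=> rn lin.
pose E (n : nat) := [set p | K p /\ forall x, `|x| <= n%:R -> psi p x = x * psi p 1].
have [p hp] : exists p, forall n, E n p.
  apply: (nested_compact cK).
  - move=> n; have -> : E n = K `&` \bigcap_(x in [set x : R | `|x| <= n%:R])
       (K `&` [set p | 0 <= - `|psi p x - x * psi p 1|]).
      apply/seteqP; split=> [p [Kp h]|p [Kp h]].
        by split=> // x /= xn; split=> //=; rewrite h // subrr normr0 oppr0.
      split=> // x xn; have [_ /=] := h x xn.
      by rewrite oppr_ge0 normr_le0 subr_eq0 => /eqP.
    apply: closedI => //; apply: closed_bigI => x _; apply: within_closed_ge0 => //.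
    apply/within_continuousP => p F FF Kp FK Fp.
    have c1 y : (fun p => psi p y) @ F --> psi p y.
      by have /within_continuousP c := @cpsi y; exact: c.
    by apply: cvgN; apply: cvg_norm; apply: cvgB => //; apply: cvgM => //; exact: cvg_cst.
  - by move=> n p [].
  - move=> m n mn p [Kp h]; split=> // x xm; apply: h.
    by apply: le_trans xm _; rewrite ler_nat.
  (* Zooming at the midpoint with this ratio maps [-(n+1), n+1] into [0, 1]. The bound n + 1 instead
     of n ensures that x = 1 is covered even when n = 0. *)
  - move=> n; pose r : R := (2 * n.+1%:R)^-1.
    have r0 : 0 < r by rewrite invr_gt0 mulr_gt0.
    have rn1 : r * n.+1%:R = 2^-1 by rewrite /r invfM mulfVK // pnatr_eq0.
    have [q Kq [c cE]] := rn 2^-1 r r0; exists q; split=> //.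
    have lin' x : `|x| <= n.+1%:R -> psi q x = c * (r * x * phi 1).
      move=> xn; rewrite cE (lin (2^-1 + r * x)) ?(lin 2^-1).
      - by ring.
      - by apply/andP; split; lra.
      - have : `|r * x| <= 2^-1 by rewrite normrM (gtr0_norm r0) -rn1 ler_wpM2l // ltW.
        by rewrite ler_norml => /andP[h1 h2]; apply/andP; split; lra.
    move=> x xn; rewrite lin'; last by apply: le_trans xn _; rewrite ler_nat.
    rewrite lin'; first by ring.
    by rewrite normr1 ler1n.
exists p; first by have [] := hp 0%N.
move=> x; have [_] := hp (Num.truncn `|x|).+1; apply.
exact/ltW/truncnS_gt.
Qed.

(* Zooming in between two points which almost realize the Lipschitz constant
   gives in the limit a function whose Lipschitz constant is attained between 0
   and 1, that is, an affine one. *)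
Lemma lipschitz_linear (phi : R -> R) (C : R) :
  (forall p, K p -> renormalizable (psi p)) -> renormalizable phi ->
  (forall x y, 0 <= x <= 1 -> 0 <= y <= 1 -> `|phi x - phi y| <= C * `|x - y|) ->
  exists2 p, K p & forall x, psi p x = x * psi p 1.
Proof.
move=> rnK rn lip.
(* Since psi p 0 = 0, |psi p 1| is the slope between 0 and 1; the condition says that it is almost
   the largest on [0, 1]. Both sides are homogeneous in [psi p], so the unknown factor of a zoom is
   harmless. *)
pose E (n : nat) := [set p | K p /\ forall x y, 0 <= x <= 1 -> 0 <= y <= 1 ->
   (1 - n.+1%:R^-1) * `|psi p x - psi p y| <= `|psi p 1| * `|x - y|].
have [p hp] : exists p, forall n, E n p.
  apply: (nested_compact cK).
  - move=> n; have -> : E n = K `&` \bigcap_(z in [set z : R * R | 0 <= z.1 <= 1 /\ 0 <= z.2 <= 1])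
       (K `&` [set p | 0 <= `|psi p 1| * `|z.1 - z.2| - (1 - n.+1%:R^-1) * `|psi p z.1 - psi p z.2|]).
      apply/seteqP; split=> [p [Kp h]|p [Kp h]].
        by split=> // -[x y] /= [xi yi]; split=> //=; rewrite subr_ge0 h.
      split=> // x y xi yi; have [_ /=] := h (x, y) (conj xi yi).
      by rewrite subr_ge0.
    apply: closedI => //; apply: closed_bigI => z _; apply: within_closed_ge0 => //.
    apply/within_continuousP => p F FF Kp FK Fp.
    have c1 y : (fun p => psi p y) @ F --> psi p y.
      by have /within_continuousP c := @cpsi y; exact: c.
    apply: cvgB; apply: cvgM; try exact: cvg_cst; apply: cvg_norm => //.
    exact: cvgB.
  - by move=> n p [].
  - move=> m n mn p [Kp h]; split=> // x y xi yi; apply: le_trans (h x y xi yi).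
    by rewrite ler_wpM2r // lerD2l lerN2 lef_pV2 ?posrE // ler_nat.
  - move=> n.
    pose S := [set z | exists x y, [/\ 0 <= x, x < y, y <= 1 & z = `|phi y - phi x| / (y - x)]].
    have S1 : S `|phi 1 - phi 0| by exists 0, 1; split=> //; rewrite ?ltr01 // subr0 divr1.
    have ubS : ubound S C.
      move=> _ [x [y [x0 xy y1 ->]]]; rewrite ler_pdivrMr ?subr_gt0 //.
      rewrite -[X in _ <= _ * X]gtr0_norm ?subr_gt0 //; apply: lip; apply/andP; split=> //; lra.
    have hS : has_sup S by split; [exists `|phi 1 - phi 0| | exists C].
    pose L := sup S.
    have LS x y : 0 <= x -> y <= 1 -> x < y -> `|phi y - phi x| <= L * (y - x).
      move=> x0 y1 xy; rewrite -ler_pdivrMr ?subr_gt0 //.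
      by apply: ub_le_sup; [exists C|exists x, y].
    have L0 : 0 <= L by apply: le_trans (ub_le_sup _ S1); [|exists C].
    have lip' x y : 0 <= x <= 1 -> 0 <= y <= 1 -> `|phi x - phi y| <= L * `|x - y|.
      move=> /andP[x0 x1] /andP[y0 y1]; case: (ltgtP x y) => [xy|yx|->].
      - rewrite distrC [`|x - y|]distrC [`|y - x|]gtr0_norm ?subr_gt0 //; exact: LS.
      - rewrite [`|x - y|]gtr0_norm ?subr_gt0 //; exact: LS.
      - by rewrite !subrr normr0 mulr0.
    have n0 : 0 < n.+1%:R^-1 :> R by rewrite invr_gt0.
    have [x [y [x0 xy y1 slope]]] : exists x y, [/\ 0 <= x, x < y, y <= 1 &
        (1 - n.+1%:R^-1) * L * (y - x) <= `|phi y - phi x|].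
      case: (ltgtP L 0) => [|Lp|Lz]; first by rewrite ltNge L0.
        have [z [x [y [x0 xy y1 ->]]] hz] := sup_adherent (mulr_gt0 n0 Lp) hS.
        exists x, y; split=> //; rewrite -ler_pdivlMr ?subr_gt0 // mulrBl mul1r.
        exact: ltW.
      by exists 0, 1; split=> //; rewrite ?ltr01 // Lz mulr0 mul0r.
    have yx0 : 0 < y - x by rewrite subr_gt0.
    (* This zoom sends 0 to x and 1 to y, so the steep chord becomes the one over [0, 1]. *)
    have [q Kq [c cE]] := rn x (y - x) yx0; exists q; split=> // u v ui vi.
    have -> : psi q 1 = c * (phi y - phi x) by rewrite cE mulr1 [x + _]addrC subrK.
    have -> : psi q u - psi q v = c * (phi (x + (y - x) * u) - phi (x + (y - x) * v)).
      by rewrite !cE; ring.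
    have inI w : 0 <= w <= 1 -> 0 <= x + (y - x) * w <= 1.
      move=> /andP[w0 w1]; have h1 := mulr_ge0 (ltW yx0) w0.
      have h2 := ler_wpM2l (ltW yx0) w1; rewrite mulr1 in h2.
      by apply/andP; split; lra.
    have := lip' _ _ (inI u ui) (inI v vi).
    have -> : x + (y - x) * u - (x + (y - x) * v) = (y - x) * (u - v) by ring.
    rewrite !normrM (gtr0_norm yx0) => h.
    rewrite mulrCA -mulrA ler_wpM2l //.
    have n1 : 0 <= 1 - n.+1%:R^-1 :> R by rewrite subr_ge0 invf_le1 // ler1n.
    apply: le_trans (ler_wpM2l n1 h) _.
    by rewrite !mulrA ler_wpM2r.
have Kp : K p by have [] := hp 0%N.
have lip1 x y : 0 <= x <= 1 -> 0 <= y <= 1 -> `|psi p x - psi p y| <= `|psi p 1| * `|x - y|.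
  move=> xi yi; rewrite leNgt; apply/negP => lt1.
  set a := `|psi p x - psi p y| in lt1; set b := `|psi p 1| * `|x - y| in lt1.
  have a0 : 0 < a by apply: le_lt_trans lt1; rewrite mulr_ge0.
  (* Chosen so that a / (n + 1) < a - b, that is, (1 - 1 / (n + 1)) a > b. *)
  pose n := Num.truncn (a / (a - b)).
  have ab : 0 < a - b by rewrite subr_gt0.
  have [_ /(_ x y xi yi)] := hp n; rewrite -/a -/b leNgt => /negP; apply.
  have : a / (a - b) < n.+1%:R by exact: truncnS_gt.
  rewrite ltr_pdivrMr // mulrC -ltr_pdivrMr // => h.
  by rewrite mulrBl mul1r ltrBrDl -ltrBrDr mulrC.
apply: (renormalizable_linear (rnK p Kp)).
(* The increments over [0, x] and [x, 1] are at most x |psi p 1| and (1 - x) |psi p 1| and add up to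
   psi p 1: both bounds are attained, with the same sign. *)
move=> x /andP[x0 x1].
have h0 := lip1 x 0 (introT andP (conj x0 x1)) (introT andP (conj (lexx 0) ler01)).
have h1 := lip1 1 x (introT andP (conj ler01 (lexx 1))) (introT andP (conj x0 x1)).
rewrite psi0 // !subr0 (ger0_norm x0) in h0.
rewrite (@ger0_norm _ (1 - x)) ?subr_ge0 // in h1.
move: h0 h1; rewrite !ler_norml; move: (psi p x) (psi p 1) => u v.
have [v0|v0] := leP 0 v.
  rewrite (ger0_norm v0) => /andP[h1 h2] /andP[h3 h4]; apply/le_anti/andP; split; lra.
rewrite (ltr0_norm v0) => /andP[h1 h2] /andP[h3 h4]; apply/le_anti/andP; split; lra.
Qed.

End Renormalization.

(** * The interior of a conic *)

Section ConicDomain.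
Variables (R : realType) (G : 'M[R]_3).
Hypothesis GU : G \in unitmx.
Local Notation V := 'cV[R]_3.

Definition gcoord (x : V) i : R := (invmx G *m x) i 0.

(** In the coordinates given by the columns of G, its zeros are the points [1 : s : s^2] and
    [0 : 0 : 1]. *)
Definition conic_form (x : V) : R := gcoord x 1 ^+ 2 - gcoord x 0 * gcoord x ord_max.

(** On the kernel x_0 + x_2 = 0 of this linear form, the quadratic form is x_1^2 + x_0^2, hence
    positive definite: the line at infinity of the chart misses the closed domain. *)
Definition conic_chart : 'rV[R]_3 :=
  2^-1 *: (row 0 (invmx G) + row ord_max (invmx G)).

Definition conic_domain : set (proj V) := [set l | conic_form (vpick l) < 0].

Lemma gcoordZ c x i : gcoord (c *: x) i = c * gcoord x i.
Proof. by rewrite /gcoord -scalemxAr mxE. Qed.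

Lemma gcoordD x y i : gcoord (x + y) i = gcoord x i + gcoord y i.
Proof. by rewrite /gcoord mulmxDr mxE. Qed.

Lemma gcoord0 x : (forall i, gcoord x i = 0) -> x = 0.
Proof.
move=> h; rewrite -[x](mulKVmx GU); suff -> : invmx G *m x = 0 by rewrite mulmx0.
by apply/colP => i; rewrite [RHS]mxE; exact: h.
Qed.

Lemma conic_formZ c x : conic_form (c *: x) = c ^+ 2 * conic_form x.
Proof. by rewrite /conic_form !gcoordZ; ring. Qed.

Lemma conic_chartE x : (conic_chart *m x) 0 0 = (gcoord x 0 + gcoord x ord_max) / 2.
Proof.
rewrite /conic_chart -scalemxAl mulmxDl -!row_mul !mxE /gcoord !mxE.
by rewrite mulrC.
Qed.

Lemma conic_chart_scalar x (c : R) : (conic_chart *m x == c%:M) = (gcoord x 0 + gcoord x ord_max == 2 * c).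
Proof.
rewrite [conic_chart *m x]mx11_scalar conic_chartE; apply/eqP/eqP => [/matrixP/(_ 0 0)|h].
  by rewrite !mxE !eqxx !mulr1n => <-; field.
by congr (_%:M); rewrite h; field.
Qed.

Lemma conic_form_line v : v != 0 -> conic_domain (line v) = (conic_form v < 0) :> Prop.
Proof.
move=> v0; have w0 := vpick_proj_neq0 (line v).
have /(line_eqP v0 w0)[c cE] : line v = line (vpick (line v)) by rewrite line_vpick.
rewrite /conic_domain /= cE conic_formZ.
have c0 : c != 0 by apply: contraNneq w0 => c0; rewrite cE c0 scale0r.
by rewrite pmulr_rlt0 // exprn_even_gt0.
Qed.

Lemma conic_form_gt0 x : x != 0 -> gcoord x 0 + gcoord x ord_max = 0 -> 0 < conic_form x.
Proof.
move=> x0 h; have e : gcoord x ord_max = - gcoord x 0.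
  by apply/eqP; rewrite -addr_eq0 addrC h.
rewrite /conic_form e mulrN opprK lt_neqAle addr_ge0 ?sqr_ge0 -?expr2 ?sqr_ge0 // andbT.
rewrite eq_sym; apply: contraNneq x0 => /eqP.
rewrite paddr_eq0 ?sqr_ge0 // !sqrf_eq0 => /andP[/eqP e1 /eqP e0].
apply/eqP/gcoord0 => i; case: (ord3 i) => -> //.
by rewrite e e0 oppr0.
Qed.

(** For x and y in the chart, x - y lies in the kernel of the linear form, where the quadratic form
    is positive, so the last term is the strict convexity. *)
Lemma conic_form_convex x y (t : R) : conic_form ((1 - t) *: x + t *: y) =
  (1 - t) * conic_form x + t * conic_form y - t * (1 - t) * conic_form (x - y).
Proof.
have -> : x - y = x + (-1) *: y by rewrite scaleN1r.
by rewrite /conic_form !gcoordD !gcoordZ; ring.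
Qed.

Lemma conic_form_continuous : continuous conic_form.
Proof.
apply: continuous_filterP => x F FF Fx.
have c i : (fun x => gcoord x i) @ F --> gcoord x i.
  by apply: cvg_coord; apply: cvg_mulmx; [exact: cvg_cst|].
by apply: cvgB; apply: cvgM; exact: c.
Qed.

Lemma conic_domain_open : open conic_domain.
Proof.
change (proj_open conic_domain); rewrite /proj_open.
have -> : [set v : V | v != 0 /\ conic_domain (line v)] = conic_form @^-1` [set x | x < 0].
  apply/seteqP; split=> [v [v0]|v /= qv]; first by rewrite conic_form_line.
  have v0 : v != 0.
    apply/eqP => v0; move: qv; rewrite v0 /conic_form /gcoord mulmx0 !mxE.
    by rewrite expr0n mul0r subr0 ltxx.
  by split=> //; rewrite conic_form_line.
by apply: open_comp; [move=> v _; exact: conic_form_continuous|exact: open_lt].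
Qed.

Lemma conic_domain_closure l : closure conic_domain l -> conic_form (vpick l) <= 0.
Proof.
move=> cl; rewrite leNgt; apply/negP => gt0.
pose W : set (proj V) := [set m | 0 < conic_form (vpick m)].
have WE v : v != 0 -> W (line v) = (0 < conic_form v) :> Prop.
  move=> v0; have w0 := vpick_proj_neq0 (line v).
  have /(line_eqP v0 w0)[c cE] : line v = line (vpick (line v)) by rewrite line_vpick.
  rewrite /W /= cE conic_formZ.
  have c0 : c != 0 by apply: contraNneq w0 => c0; rewrite cE c0 scale0r.
  by rewrite pmulr_rgt0 // exprn_even_gt0.
have oW : open W.
  change (proj_open W); rewrite /proj_open.
  have -> : [set v : V | v != 0 /\ W (line v)] = conic_form @^-1` [set x | 0 < x].
    apply/seteqP; split=> [v [v0]|v /= qv]; first by rewrite WE.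
    have v0 : v != 0.
      apply/eqP => v0; move: qv; rewrite v0 /conic_form /gcoord mulmx0 !mxE.
      by rewrite expr0n mul0r subr0 ltxx.
    by split=> //; rewrite WE.
  by apply: open_comp; [move=> v _; exact: conic_form_continuous|exact: open_gt].
have nW : nbhs l W by apply: open_nbhs_nbhs; split.
have [m [qm Wm]] := cl W nW.
by have := lt_trans (qm : conic_form (vpick m) < 0) Wm; rewrite ltxx.
Qed.

Lemma conic_domain_strictly_convex : strictly_convex_domain conic_domain.
Proof.
split; first exact: conic_domain_open.
  pose x : V := G *m \col_i (if i == 1 then 0 else 1).
  have xE i : gcoord x i = if i == 1 then 0 else 1.
    by rewrite /gcoord /x mulKmx // mxE.
  have qx : conic_form x < 0.
    by rewrite /conic_form !xE /= expr0n mulr1 add0r oppr_lt0 ltr01.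
  exists (line x); rewrite conic_form_line //.
  apply/eqP => x0; have := xE 0; rewrite x0 /gcoord mulmx0 mxE /= => /eqP.
  by rewrite eq_sym oner_eq0.
have nz v : conic_chart *m v = 1%:M -> v != 0.
  move=> cv; apply/eqP => v0; move: cv; rewrite v0 mulmx0 => /matrixP/(_ 0 0)/eqP.
  by rewrite !mxE eqxx eq_sym oner_eq0.
have chartE v : conic_chart *m v = 1%:M <-> gcoord v 0 + gcoord v ord_max = 2.
  by rewrite (rwP eqP) conic_chart_scalar mulr1 -(rwP eqP).
have diff x y : gcoord x 0 + gcoord x ord_max = 2 -> gcoord y 0 + gcoord y ord_max = 2 ->
    gcoord (x - y) 0 + gcoord (x - y) ord_max = 0.
  move=> hx hy; rewrite -scaleN1r !gcoordD !gcoordZ.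
  transitivity ((gcoord x 0 + gcoord x ord_max) - (gcoord y 0 + gcoord y ord_max)); first by ring.
  by rewrite hx hy subrr.
have segment x y (t : R) : conic_chart *m x = 1%:M -> conic_chart *m y = 1%:M ->
    conic_chart *m ((1 - t) *: x + t *: y) = 1%:M.
  by move=> cx cy; rewrite mulmxDr -!scalemxAr cx cy -scalerDl subrK scale1r.
exists conic_chart => chart point; split.
- move=> l /conic_domain_closure ql.
  have w0 := vpick_proj_neq0 l; set w := vpick l in ql w0 *.
  pose c := (gcoord w 0 + gcoord w ord_max) / 2.
  have c0 : c != 0.
    rewrite mulf_neq0 ?invr_eq0 ?pnatr_eq0 //; apply/eqP => h.
    by have := conic_form_gt0 w0 h; rewrite ltNge ql.
  exists (c^-1 *: w); last by rewrite lineZ ?invr_eq0 // line_vpick.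
  apply/chartE; rewrite !gcoordZ -mulrDr.
  have -> : gcoord w 0 + gcoord w ord_max = 2 * c by rewrite /c; field.
  by rewrite mulrC mulfK.
- move=> x y t cx cy Wx Wy /andP[t0 t1].
  have := segment x y t cx cy => cs.
  rewrite conic_form_line in Wx; last exact: nz.
  rewrite conic_form_line in Wy; last exact: nz.
  rewrite /point conic_form_line; last exact: nz.
  rewrite conic_form_convex.
  have qd : 0 <= conic_form (x - y).
    have [->|d0] := eqVneq (x - y) 0.
      by rewrite /conic_form /gcoord mulmx0 !mxE expr0n mul0r subr0.
    by apply/ltW/conic_form_gt0 => //; apply: diff; apply/chartE.
  have h1 : 0 <= t * (1 - t) * conic_form (x - y) by rewrite !mulr_ge0 // subr_ge0.
  have h2 : (1 - t) * conic_form x + t * conic_form y < 0.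
    have [t00|tp] := eqVneq t 0; first by rewrite t00 subr0 mul1r mul0r addr0.
    have tpos : 0 < t by rewrite lt_neqAle eq_sym tp.
    by rewrite ltr_wnDl // ?pmulr_rlt0 // mulr_ge0_le0 ?subr_ge0 // ltW.
  by rewrite subr_lt0; apply: lt_le_trans h1.
- move=> x y cx cy xy.
  have x0 := nz x cx; have y0 := nz y cy.
  have px : point x y 0 = line x by rewrite /point subr0 scale1r scale0r addr0.
  have py : point x y 1 = line y by rewrite /point subrr scale0r scale1r add0r.
  have [bx|nbx] := pselect ((closure conic_domain `\` conic_domain) (line x)); last first.
    by exists 0; rewrite ?lexx ?ler01 // px.
  have [by_|nby] := pselect ((closure conic_domain `\` conic_domain) (line y)); last first.
    by exists 1; rewrite ?lexx ?ler01 // py.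
  have q0 v : v != 0 -> (closure conic_domain `\` conic_domain) (line v) -> conic_form v <= 0.
    move=> v0 [/conic_domain_closure le _]; rewrite leNgt; apply/negP => gt0.
    have w0 := vpick_proj_neq0 (line v).
    have /(line_eqP v0 w0)[c cE] : line v = line (vpick (line v)) by rewrite line_vpick.
    have c0 : c != 0 by apply: contraNneq w0 => c0; rewrite cE c0 scale0r.
    move: le; rewrite cE conic_formZ leNgt => /negP; apply.
    by rewrite mulr_gt0 // exprn_even_gt0.
  (* At the midpoint the form is at most - conic_form (x - y) / 4 < 0, so the midpoint lies in the
     open domain and not on its boundary. *)
  exists 2^-1; first by apply/andP; split; lra.
  move=> [_]; apply; rewrite /point conic_form_line; last exact/nz/segment.
  rewrite conic_form_convex.
  have d0 : x - y != 0 by rewrite subr_eq0.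
  have qd : 0 < conic_form (x - y).
    by apply: conic_form_gt0 => //; apply: diff; apply/chartE.
  have := q0 x x0 bx; have := q0 y y0 by_; move: qd; clear.
  by move: (conic_form x) (conic_form y) (conic_form (x - y)) => a b c; lra.
Qed.

End ConicDomain.

(** * Rigidity *)

Section Rigidity.
Variables (R : realType) (Gamma : set 'M[R]_2) (rho : 'M[R]_2 -> 'M[R]_3).
Variable f : 'M[R]_2 -> proj 'cV[R]_3 * proj 'cV[R]_3 * proj 'cV[R]_3.
Hypothesis dG : discrete_subgroup Gamma.
Hypothesis rep : representation Gamma rho.
Hypothesis lift : anosov_lift Gamma rho f.
Hypothesis irr : strongly_irreducible Gamma rho.

Lemma rho1 : rho 1%:M = 1%:M.
Proof.
have G1 := Gamma1 dG; have U := rho_unit rep G1.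
have : rho 1%:M *m rho 1%:M = rho 1%:M by case: rep => _ <- //; rewrite mulmx1.
by move=> /(congr1 (mulmx (invmx (rho 1%:M)))); rewrite mulKmx // mulVmx.
Qed.

Lemma rhoV g : Gamma g -> rho (invmx g) = invmx (rho g).
Proof.
move=> Gg; have GV := GammaV dG Gg; have U := rho_unit rep Gg.
have : rho g *m rho (invmx g) = 1%:M.
  by case: rep => _ <- //; rewrite mulmxV ?rho1 // (Gamma_unit dG).
by move=> /(congr1 (mulmx (invmx (rho g)))); rewrite mulKmx // mulmx1.
Qed.

Lemma no_invariant_subspace (U : {vspace 'cV[R]_3}) : U != 0%VS -> U != fullv ->
  (forall g x, Gamma g -> x \in U -> rho g *m x \in U) -> False.
Proof.
move=> U0 UT inv.
apply: (irr (D := rho @` Gamma) _ _ U0 UT).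
- split=> //.
  + by exists 1%:M; [exact: Gamma1 dG|exact: rho1].
  + move=> _ _ [g Gg <-] [h Gh <-]; exists (g *m h); first exact: (GammaM dG).
    by case: rep => _ ->.
  + by move=> _ [g Gg <-]; exists (invmx g); [exact: (GammaV dG)|exact: rhoV].
- exists [:: 1%:M].
    by move=> h; rewrite inE => /eqP ->; exists 1%:M; [exact: Gamma1 dG|exact: rho1].
  move=> g Gg; exists 1%:M; first by rewrite inE.
  by rewrite invmx1 mul1mx.
- move=> _ [g Gg <-]; apply/vspaceP => x; apply/idP/idP.
    by move=> /memv_imgP[y yU ->]; rewrite lfunE /=; exact: inv.
  move=> xU; apply/memv_imgP; exists (rho (invmx g) *m x).
    by apply: inv => //; exact: (GammaV dG).
  by rewrite lfunE /= rhoV // mulKVmx // (rho_unit rep Gg).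
Qed.

(** The Bruhat decomposition of h^-1 h': the direction h' [e_1] is h [1 : s] for some s, or h
    [0 : 1]. *)
Lemma direction_cases h h' : SL R 2 h -> SL R 2 h' ->
  (exists s p, [/\ SL R 2 p, p 1 0 = 0 & h' = h *m horocycle s *m p]) \/
  (exists p, [/\ SL R 2 p, p 1 0 = 0 & h' = h *m quarter_turn R *m p]).
Proof.
move=> dh dh'; pose p := invmx h *m h'.
have dp : SL R 2 p by apply: SL_mul => //; exact: SL_inv.
have h'E : h' = h *m p by rewrite mulKVmx // SL_unit.
have [p00|p00] := eqVneq (p 0 0) 0.
  right; exists (mx2 0 1 (-1) 0 *m p); have [a1 a2 a3 a4] := mx2_entry (0 : R) 1 (-1) 0.
  have dJ : SL R 2 (mx2 (0 : R) 1 (-1) 0) by rewrite /SL /= det2 a1 a2 a3 a4; ring.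
  split; first exact: SL_mul.
    by rewrite mulmx2E a3 a4 p00 mulr0 mul0r addr0.
  rewrite h'E -!mulmxA; congr (_ *m _); rewrite mulmxA.
  have -> : quarter_turn R *m mx2 0 1 (-1) 0 = 1%:M; last by rewrite mul1mx.
  have [b1 b2 b3 b4] := mx2_entry (0 : R) (-1) 1 0.
  by apply: mx2P; rewrite !mulmx2E /quarter_turn ?(b1, b2, b3, b4) ?(a1, a2, a3, a4) !mxE /=; ring.
left; pose s := p 1 0 / p 0 0; exists s, (horocycle (- s) *m p).
have [a1 a2 a3 a4] := mx2_entry (1 : R) 0 (- s) 1.
have [b1 b2 b3 b4] := mx2_entry (1 : R) 0 s 1.
split; first by apply: SL_mul => //; exact: SL_horocycle.
  by rewrite mulmx2E /horocycle a3 a4 /s mul1r mulNr divfK // addNr.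
rewrite h'E -!mulmxA; congr (_ *m _); rewrite mulmxA.
have -> : horocycle s *m horocycle (- s) = 1%:M; last by rewrite mul1mx.
by apply: mx2P; rewrite !mulmx2E /horocycle ?(b1, b2, b3, b4) ?(a1, a2, a3, a4) !mxE /=; ring.
Qed.

Lemma coord_antidiag F x i : F \in unitmx ->
  coord (F *m antidiag R) x i = coord F x (rev_ord i).
Proof.
move=> FU; rewrite /coord invmx_antidiag // !mxE; apply: eq_bigr => k _.
by rewrite antidiag_mul.
Qed.

(** Otherwise every point of the limit curve lies in the plane U spanned by columns 0 and 2 of F.
    These columns are themselves on the curve, which rho(Gamma) preserves, so U would be
    invariant. *)
Lemma psi_nonzero h F : framed f h F -> (forall s, psi f h F s = 0) -> False.
Proof.
move=> fF z; have [dh _] := fF; have FU := framed_unit lift fF.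
have fFJ := framed_quarter_turn dG rep lift fF.
have c1 h' F' : framed f h' F' -> coord F (col 0 F') 1 = 0.
  move=> fF'; have [dh' _] := fF'.
  have [[s [p [dp p10 e]]]|[p [dp p10 e]]] := direction_cases dh dh'; rewrite e in fF'.
    have [n0 e1] := psiE dG rep lift fF dp p10 fF'.
    by move: e1; rewrite z => /esym/eqP; rewrite mulf_eq0 invr_eq0 (negPf n0) orbF => /eqP.
  have [c c0 ->] := same_direction dG rep lift fFJ fF' p10.
  rewrite coordZ.
  have -> : col 0 (F *m antidiag R) = col ord_max F.
    by apply/colP => i; rewrite [LHS]mxE mul_antidiag [RHS]mxE; congr (F _ _); exact: val_inj.
  by rewrite coordE mulVmx // mxE mulr0.
pose U := (<[col 0%R F]> + <[col ord_max F]>)%VS.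
have UE x : (x \in U) = (coord F x 1 == 0).
  apply/idP/eqP.
    move=> /memv_addP[_ /vlineP[a ->] [_ /vlineP[b ->] ->]].
    have coordD y w i : coord F (y + w) i = coord F y i + coord F w i.
      by rewrite /coord mulmxDr mxE.
    by rewrite coordD !coordZ !coordE mulVmx // !mxE /= !mulr0 addr0.
  move=> x1; have -> : x = coord F x 0 *: col 0 F + coord F x ord_max *: col ord_max F.
    rewrite -[LHS](mulKVmx FU); apply/colP => i.
    rewrite !mxE sum3 -/(coord F x 0) -/(coord F x 1) -/(coord F x ord_max) x1 mulr0 addr0.
    by rewrite ![_ * F _ _]mulrC.
  by apply: memv_add; apply/vlineP; eexists.
apply: (@no_invariant_subspace U).
- apply/eqP => U0; have : col 0 F \in U by rewrite UE coordE mulVmx // mxE.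
  by rewrite U0 memv0 (negPf (col_neq0 0 FU)).
- apply/eqP => UT; have : col 1 F \in U by rewrite UT memvf.
  by rewrite UE coordE mulVmx // mxE eqxx oner_eq0.
- move=> g x Gg /memv_addP[_ /vlineP[a ->] [_ /vlineP[b ->] ->]].
  have img h' F' : framed f h' F' -> rho g *m col 0 F' \in U.
    move=> fF'; have [dh' _] := fF'.
    have dgh : SL R 2 (g *m h') by apply: SL_mul => //; exact: (Gamma_SL dG).
    have [F1 fF1] := framed_exists f dgh.
    have [d d0 dE] := framed_equivariant rep lift Gg fF' fF1.
    have -> : rho g *m col 0 F' = d 0 0 *: col 0 F1.
      rewrite colE mulmxA dE -colE; apply/colP => k.
      by rewrite mul_mx_diag !mxE mulrC.
    by rewrite memvZ // UE (c1 _ _ fF1).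
  rewrite mulmxDr -!scalemxAr memvD ?memvZ //; first exact: img fF.
  have -> : col ord_max F = col 0 (F *m antidiag R).
    by apply/colP => i; rewrite [LHS]mxE [RHS]mxE mul_antidiag; congr (F _ _); exact: val_inj.
  exact: img fFJ.
Qed.

Definition linear_psi h F := forall s, psi f h F s = s * psi f h F 1.

Lemma linear_psi_slope h F : framed f h F -> linear_psi h F -> psi f h F 1 != 0.
Proof.
move=> fF lin; apply/eqP => s0; apply: (psi_nonzero fF) => s.
by rewrite lin s0 mulr0.
Qed.

(** A lower triangular l keeps the center h [e_2] of the pencil, and g moves it along its orbit.
    Renormalization is affine at the source, so it preserves linearity. *)
Lemma linear_psi_transport h F g l F' : framed f h F -> linear_psi h F -> Gamma g ->
  SL R 2 l -> l 0 1 = 0 -> framed f (g *m (h *m l)) F' -> linear_psi (g *m (h *m l)) F'.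
Proof.
move=> fF lin Gg dl l01 fF'.
have [c cE] := renormalization dG rep lift fF Gg dl l01 fF'.
move=> s; rewrite !cE (lin (l 1 0 / l 0 0)) (lin (_ + s / _)) (lin (_ + 1 / _)).
by ring.
Qed.

(** The entry vanishes exactly when g fixes h [e_2]. If all of Gamma fixed this point, its image
    under eta would be an invariant line. *)
Lemma moved_point h F : framed f h F ->
  exists2 g, Gamma g & (invmx h *m g *m h) 0 1 != 0.
Proof.
move=> fF; have [dh _] := fF; have FU := framed_unit lift fF.
apply: contrapT => no.
have fix_ g : Gamma g -> (invmx h *m g *m h) 0 1 = 0.
  by move=> Gg; apply/eqP/negPn/negP => ne; apply: no; exists g.
have fFJ := framed_quarter_turn dG rep lift fF.
set w := col 0 (F *m antidiag R).
have w0 : w != 0 by apply: col_neq0; rewrite unitmx_mul FU antidiag_unit.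
apply: (@no_invariant_subspace <[w]>%VS).
- by rewrite -dimv_eq0 dim_vline w0.
- apply/eqP => e; have := congr1 (fun U : {vspace 'cV[R]_3} => \dim U) e.
  by rewrite dim_vline w0 dimvf /dim /=.
- move=> g x Gg /vlineP[a ->].
  pose J := quarter_turn R; pose J' := mx2 (0 : R) 1 (-1) 0.
  have [a1 a2 a3 a4] := mx2_entry (0 : R) 1 (-1) 0.
  have [b1 b2 b3 b4] := mx2_entry (0 : R) (-1) 1 0.
  have JJ : J *m J' = 1%:M.
    by apply: mx2P; rewrite !mulmx2E /J /J' /quarter_turn ?(b1, b2, b3, b4) ?(a1, a2, a3, a4) !mxE /=; ring.
  pose q := invmx h *m g *m h.
  have e : g *m (h *m J) = h *m J *m (J' *m q *m J).
    by rewrite /q !mulmxA -(mulmxA h J) JJ mulmx1 mulmxV ?SL_unit // mul1mx.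
  have p10 : (J' *m q *m J) 1 0 = 0.
    rewrite (mulmx2E (J' *m q) J) !(mulmx2E J' q) (fix_ g Gg : q 0 1 = 0).
    by rewrite /J /J' /quarter_turn a3 a4 b1 b3; ring.
  have dghJ : SL R 2 (g *m (h *m J)).
    by apply: SL_mul; [exact: (Gamma_SL dG)|case: fFJ].
  have [F1 fF1] := framed_exists f dghJ.
  have [d d0 dE] := framed_equivariant rep lift Gg fFJ fF1.
  rewrite e in fF1.
  have [c c0 cE] := same_direction dG rep lift fFJ fF1 p10.
  rewrite -scalemxAr; apply: memvZ.
  have -> : rho g *m w = d 0 0 *: col 0 F1.
    rewrite /w colE mulmxA dE -colE; apply/colP => k.
    by rewrite mul_mx_diag !mxE mulrC.
  by rewrite cE !memvZ // memv_line.
Qed.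

Lemma two_linear_pencils h0 F0 : framed f h0 F0 -> linear_psi h0 F0 ->
  exists h F, [/\ framed f h F, linear_psi h F &
    linear_psi (h *m quarter_turn R) (F *m antidiag R)].
Proof.
move=> fF0 lin; have [dh0 _] := fF0.
have [g Gg q01] := moved_point fF0.
pose q := invmx h0 *m g *m h0; rewrite -/q in q01.
have dg := Gamma_SL dG Gg.
have dq : SL R 2 q by apply: SL_mul => //; apply: SL_mul => //; exact: SL_inv.
(* q sends [e_2] to [1 : s], so h = h0 *m horocycle s satisfies h [e_2] = h0 [e_2] and h [e_1] = g
   h0 [e_2]: the pencils at both points are obtained from the one at h0 [e_2]. *)
pose s := q 1 1 / q 0 1.
have dh : SL R 2 (h0 *m horocycle s) by apply: SL_mul => //; exact: SL_horocycle.
have [F fF] := framed_exists f dh.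
exists (h0 *m horocycle s), F.
have [b1 b2 b3 b4] := mx2_entry (0 : R) (-1) 1 0.
have [c1 c2 c3 c4] := mx2_entry (1 : R) 0 s 1.
split=> //.
  have := @linear_psi_transport h0 F0 1%:M (horocycle s) F fF0 lin (Gamma1 dG) (SL_horocycle s) c2.
  by rewrite mul1mx; apply.
have fFJ := framed_quarter_turn dG rep lift fF.
pose l := invmx q *m horocycle s *m quarter_turn R.
have dl : SL R 2 l.
  apply: SL_mul; last exact: SL_quarter_turn.
  by apply: SL_mul; [exact: SL_inv|exact: SL_horocycle].
have l01 : l 0 1 = 0.
  rewrite /l !mulmx2E /quarter_turn /horocycle b2 b4 c1 c3 mulr0 addr0.
  have [-> -> _ _] := invmx2 dq.
  by rewrite /s; field.
have e : g *m (h0 *m l) = h0 *m horocycle s *m quarter_turn R.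
  have gE : g *m h0 = h0 *m q by rewrite /q !mulmxA mulmxV ?SL_unit // mul1mx.
  have qE : q *m l = horocycle s *m quarter_turn R.
    by rewrite /l !mulmxA mulmxV ?SL_unit // mul1mx.
  by rewrite mulmxA gE -mulmxA qE mulmxA.
by rewrite -e; apply: (linear_psi_transport fF0) => //; rewrite e.
Qed.

(* Steiner's construction: the limit curve is the locus of the intersections of
   corresponding lines in two projectively related pencils. *)
Lemma steiner_conic h F : framed f h F -> linear_psi h F ->
  linear_psi (h *m quarter_turn R) (F *m antidiag R) ->
  exists G : 'M[R]_3, G \in unitmx /\
    (forall h' F', framed f h' F' -> conic_form G (col 0 F') = 0) /\
    (forall s, exists h' F' c, framed f h' F' /\
       col 0 F' = c *: (G *m \col_(i < 3) (s ^+ i)) /\ c != 0) /\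
    (exists h' F' c, framed f h' F' /\ col 0 F' = c *: col ord_max G /\ c != 0).
Proof.
move=> fF lin linJ; have [dh _] := fF; have FU := framed_unit lift fF.
have fFJ := framed_quarter_turn dG rep lift fF; have [dhJ _] := fFJ.
pose k1 := psi f h F 1; pose k2 := psi f (h *m quarter_turn R) (F *m antidiag R) 1.
have k1n : k1 != 0 := linear_psi_slope fF lin.
have k2n : k2 != 0 := linear_psi_slope fFJ linJ.
(* Seen from h [e_2], the curve satisfies x_1 / x_0 = k1 s. Seen from h [e_1], where the same point
   has parameter -1 / s, it satisfies x_1 / x_2 = - k2 / s. Hence x_2 = k3 s^2 x_0, and scaling the
   columns of F by 1, k1, k3 turns the curve into [1 : s : s^2]. *)
pose k3 := - (k1 / k2).
have k3n : k3 != 0 by rewrite oppr_eq0 mulf_neq0 // invr_eq0.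
pose dd : 'rV[R]_3 := \row_i (if i == 0 then 1 else if i == 1 then k1 else k3).
have dd0 i : dd 0 i != 0 by rewrite mxE; case: (ord3 i) => -> //=; exact: oner_neq0.
have dU : diag_mx dd \in unitmx.
  by rewrite unitmxE det_diag unitfE; apply/prodf_neq0 => i _.
pose G := F *m diag_mx dd.
have GU : G \in unitmx by rewrite unitmx_mul FU.
have gE x i : gcoord G x i = coord F x i / dd 0 i.
  have e : invmx G *m x = \col_i (coord F x i / dd 0 i).
    apply: (can_inj (mulKmx GU)); rewrite mulKVmx // /G -mulmxA.
    have -> : diag_mx dd *m (\col_i (coord F x i / dd 0 i)) = invmx F *m x.
      apply/colP => j; rewrite mul_diag_mx mxE [X in _ * X]mxE mulrC.
      by rewrite divfK // dd0.
    by rewrite mulKVmx.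
  by rewrite /gcoord e mxE.
have curve s p F' : SL R 2 p -> p 1 0 = 0 -> framed f (h *m horocycle s *m p) F' ->
   exists2 c, c != 0 & forall i : 'I_3, gcoord G (col 0 F') i = c * s ^+ i.
  move=> dp p10 fF'.
  have [X0 X1] := psiE dG rep lift fF dp p10 fF'.
  exists (coord F (col 0 F') 0) => // i.
  set X := coord F (col 0 F') in X0 X1 *.
  have X1E : X 1 = k1 * s * X 0 by rewrite [k1 * s]mulrC /k1 -lin X1 divfK.
  have X2E : X ord_max = k3 * s ^+ 2 * X 0.
    have [s0|s0] := eqVneq s 0.
      rewrite s0 expr0n mulr0 mul0r.
      have fF0 : framed f (h *m p) F'.
        suff -> : h = h *m horocycle s by [].
        rewrite s0 (_ : horocycle 0 = 1%:M) ?mulmx1 //.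
        by apply: mx2P; rewrite !mxE.
      have [c c0 cE] := same_direction dG rep lift fF fF0 p10.
      by rewrite /X cE coordZ coordE mulVmx // mxE mulr0.
    (* The upper triangular correction in the change of parameter from s to -1 / s; the point s = 0,
       which is the center of the second pencil, has been treated apart. *)
    pose p' := invmx (horocycle (- s^-1)) *m invmx (quarter_turn R) *m horocycle s *m p.
    have dJ := SL_quarter_turn R.
    have dH := SL_horocycle (- s^-1).
    have e : h *m horocycle s *m p = h *m quarter_turn R *m horocycle (- s^-1) *m p'.
      rewrite /p' !mulmxA mulmxK; last exact: SL_unit.
      by rewrite mulmxK //; exact: SL_unit.
    have dp' : SL R 2 p'.
      rewrite /p'; apply: SL_mul => //; apply: SL_mul; last exact: SL_horocycle.
      by apply: SL_mul; apply: SL_inv.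
    have p'10 : p' 1 0 = 0.
      have [b1 b2 b3 b4] := mx2_entry (0 : R) (-1) 1 0.
      have [c1 c2 c3 c4] := mx2_entry (1 : R) 0 s 1.
      have [d1 d2 d3 d4] := mx2_entry (1 : R) 0 (- s^-1) 1.
      have [i1 i2 i3 i4] := invmx2 dJ; have [j1 j2 j3 j4] := invmx2 dH.
      rewrite /p' !mulmx2E i1 i2 i3 i4 j3 j4 /quarter_turn /horocycle b1 b2 b3 b4 c1 c2 c3 c4 d1 d3 p10.
      by field.
    rewrite e in fF'.
    have [Z0 Z1] := psiE dG rep lift fFJ dp' p'10 fF'.
    rewrite !coord_antidiag // in Z0 Z1.
    have r0 : rev_ord (0 : 'I_3) = ord_max by exact: val_inj.
    have r1 : rev_ord (1 : 'I_3) = 1 by exact: val_inj.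
    rewrite r0 -/(X ord_max) in Z0; rewrite r0 r1 -/(X ord_max) -/(X 1) linJ -/k2 in Z1.
    have Z1' : X 1 = - s^-1 * k2 * X ord_max by rewrite Z1 divfK.
    rewrite X1E in Z1'.
    have : X ord_max = - (s / k2) * (k1 * s * X 0) by rewrite Z1'; field; rewrite s0 k2n.
    by move=> ->; rewrite /k3; field.
  rewrite gE -/(X i); case: (ord3 i) => ->; rewrite mxE /=.
  - by rewrite divr1 mulr1.
  - by rewrite X1E; field.
  - by rewrite X2E; field.
have curveJ (p : 'M[R]_2) (F' : 'M[R]_3) : p 1 0 = 0 -> framed f (h *m quarter_turn R *m p) F' ->
   exists2 c, c != 0 & col 0 F' = c *: col ord_max G.
  move=> p10 fF'; have [c c0 cE] := same_direction dG rep lift fFJ fF' p10.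
  exists (c / k3); first by rewrite mulf_neq0 // invr_eq0.
  rewrite cE; apply/colP => i.
  rewrite [LHS]mxE [col 0 _ _ _]mxE mul_antidiag [RHS]mxE [col ord_max G _ _]mxE.
  rewrite /G mul_mx_diag mxE [dd _ _]mxE /=.
  have -> : rev_ord 0 = ord_max :> 'I_3 by exact: val_inj.
  by field.
exists G; split=> //; split; [|split].
- move=> h' F' fF'; have [dh' _] := fF'.
  have [[s [p [dp p10 e]]]|[p [dp p10 e]]] := direction_cases dh dh'; rewrite e in fF'.
    have [c c0 cE] := curve s p F' dp p10 fF'.
    by rewrite /conic_form !cE /= expr0 expr1; ring.
  have [c c0 ->] := curveJ p F' p10 fF'.
  have gc i : gcoord G (col ord_max G) i = (i == ord_max)%:R.
    by rewrite -[LHS]/(coord G _ i) coordE mulVmx // mxE.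
  by rewrite conic_formZ /conic_form !gc /=; ring.
- move=> s; have dhs : SL R 2 (h *m horocycle s *m 1%:M).
    by rewrite mulmx1; apply: SL_mul => //; exact: SL_horocycle.
  have [F' fF'] := framed_exists f dhs.
  have [|c c0 cE] := curve s 1%:M F' (SL1 R 2) _ fF'; first by rewrite mxE.
  exists (h *m horocycle s *m 1%:M), F', c; split=> //; split=> //.
  rewrite scalemxAr -[LHS](mulKVmx GU); congr (_ *m _).
  by apply/colP => i; rewrite [LHS]cE !mxE.
- have dhJ1 : SL R 2 (h *m quarter_turn R *m 1%:M) by rewrite mulmx1.
  have [F' fF'] := framed_exists f dhJ1.
  have [|c c0 cE] := curveJ 1%:M F' _ fF'; first by rewrite mxE.
  by exists (h *m quarter_turn R *m 1%:M), F', c.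
Qed.

End Rigidity.

(** * Invariance of the conic under the representation *)

Lemma expr3_eq1 (R : realFieldType) (z : R) : z ^+ 3 = 1 -> z = 1.
Proof.
move=> e3; have : (z - 1) * ((z + 2^-1) ^+ 2 + 3 / 4) = 0.
  by transitivity (z ^+ 3 - 1); [field|rewrite e3 subrr].
move=> /eqP; rewrite mulf_eq0 subr_eq0 => /orP[/eqP //|].
by rewrite gt_eqF // ltr_wpDl ?sqr_ge0 // divr_gt0.
Qed.

Section Hyperconvexity.
Variables (R : realType) (Gamma : set 'M[R]_2) (rho : 'M[R]_2 -> 'M[R]_3).
Variable f : 'M[R]_2 -> proj 'cV[R]_3 * proj 'cV[R]_3 * proj 'cV[R]_3.
Hypothesis dG : discrete_subgroup Gamma.
Hypothesis rep : representation Gamma rho.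
Hypothesis lift : anosov_lift Gamma rho f.
Hypothesis irr : strongly_irreducible Gamma rho.

(** The symmetric matrix of x_1^2 - x_0 x_2. *)
Definition veronese_form : 'M[R]_3 := \matrix_(i, j)
  (if i == rev_ord j then (if i == 1 then 1 else - 2^-1) else 0).

Lemma conic_formE (G : 'M[R]_3) x :
  conic_form G x = ((invmx G *m x)^T *m veronese_form *m (invmx G *m x)) 0 0.
Proof.
rewrite /conic_form /gcoord; move: (invmx G *m x) => y.
rewrite mxE sum3 !mxE !sum3 !mxE /=.
by field.
Qed.

Lemma veronese_form_unit : veronese_form \in unitmx.
Proof.
have : veronese_form *m (\matrix_(i, j) (if i == rev_ord j then (if i == 1 then 1 else - 2) else 0)) = 1%:M.
  apply/matrixP => i j; rewrite mxE sum3 !mxE.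
  by case: (ord3 i) => ->; case: (ord3 j) => -> /=; rewrite ?mul0r ?mulr0 ?addr0 ?add0r //; field.
by case/mulmx1_unit.
Qed.

(** The image of the form under [rho g] also vanishes on the limit curve, since [rho g] permutes its
    points. Restricted to (1, s, s^2) it is a polynomial of degree at most 4 in s: the point
    [0 : 0 : 1] removes the leading coefficient, and four roots remove the others. So the new form
    is a multiple of the old one, and comparing determinants shows that the cube of the factor is
    1. *)
Lemma conic_form_invariant (G : 'M[R]_3) g : G \in unitmx ->
  (forall h' F', framed f h' F' -> conic_form G (col 0 F') = 0) ->
  (forall s, exists h' F' c, framed f h' F' /\
       col 0 F' = c *: (G *m \col_(i < 3) (s ^+ i)) /\ c != 0) ->
  (exists h' F' c, framed f h' F' /\ col 0 F' = c *: col ord_max G /\ c != 0) ->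
  Gamma g -> forall x, conic_form G (rho g *m x) = conic_form G x.
Proof.
move=> GU hq hs hinf Gg.
pose M := invmx G *m rho g *m G.
pose N := M^T *m veronese_form *m M.
have NE (v : 'cV[R]_3) : conic_form G (rho g *m (G *m v)) = (v^T *m N *m v) 0 0.
  rewrite conic_formE.
  have -> : invmx G *m (rho g *m (G *m v)) = M *m v by rewrite /M -!mulmxA.
  by rewrite trmx_mul /N !mulmxA.
have N0 h' F' c (v : 'cV[R]_3) : framed f h' F' -> col 0 F' = c *: (G *m v) -> c != 0 -> (v^T *m N *m v) 0 0 = 0.
  move=> fF' cE c0; rewrite -NE.
  have [dh' _] := fF'.
  have dgh : SL R 2 (g *m h') by apply: SL_mul => //; exact: (Gamma_SL dG).
  have [F1 fF1] := framed_exists f dgh.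
  have [d d0 dE] := framed_equivariant rep lift Gg fF' fF1.
  have e : rho g *m col 0 F' = d 0 0 *: col 0 F1.
    rewrite colE mulmxA dE -colE; apply/colP => k.
    by rewrite mul_mx_diag !mxE mulrC.
  have := congr1 (conic_form G) e; rewrite conic_formZ (hq _ _ fF1) mulr0 cE -scalemxAr conic_formZ.
  by move=> /eqP; rewrite mulf_eq0 sqrf_eq0 (negPf c0) => /eqP.
have quad (v : 'cV[R]_3) : (v^T *m N *m v) 0 0 =
   N 0 0 * v 0 0 ^+ 2 + (N 0 1 + N 1 0) * (v 0 0 * v 1 0) + N 1 1 * v 1 0 ^+ 2
   + (N 0 ord_max + N ord_max 0) * (v 0 0 * v ord_max 0)
   + (N 1 ord_max + N ord_max 1) * (v 1 0 * v ord_max 0) + N ord_max ord_max * v ord_max 0 ^+ 2.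
  move: (N) => N'; rewrite !(mxE, sum3); ring.
have point s : N 0 0 + (N 0 1 + N 1 0) * s + (N 1 1 + (N 0 ord_max + N ord_max 0)) * s ^+ 2 +
    (N 1 ord_max + N ord_max 1) * s ^+ 3 + N ord_max ord_max * s ^+ 4 = 0.
  have [h' [F' [c [fF' [cE c0]]]]] := hs s.
  have vE (i : 'I_3) : (\col_(i < 3) (s ^+ i)) i (0 : 'I_1) = s ^+ i by rewrite mxE.
  have := N0 _ _ _ _ fF' cE c0; rewrite quad !vE /= expr0 expr1 => h.
  by rewrite -[RHS]h; ring.
have n22 : N ord_max ord_max = 0.
  have [h' [F' [c [fF' [cE c0]]]]] := hinf.
  have := N0 h' F' c (delta_mx ord_max 0) fF'.
  rewrite -(colE ord_max G) => /(_ cE c0); rewrite quad.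
  have -> : (delta_mx ord_max 0 : 'cV[R]_3) 0 0 = 0 by rewrite mxE.
  have -> : (delta_mx ord_max 0 : 'cV[R]_3) 1 0 = 0 by rewrite mxE.
  have -> : (delta_mx ord_max 0 : 'cV[R]_3) ord_max 0 = 1 by rewrite mxE.
  by move=> h; rewrite -[RHS]h; ring.
have sym i j : N i j = N j i.
  have -> : N i j = N^T j i by rewrite [RHS]mxE.
  suff -> : N^T = N by [].
  rewrite /N trmx_mul (trmx_mul M^T) (trmxK M) mulmxA; congr (_ *m _ *m _).
  apply/matrixP => k l; rewrite !mxE -[l == _](inj_eq rev_ord_inj) rev_ordK [in LHS]eq_sym.
  by case: eqP => // ->; case: (ord3 l) => ->.
(* Any four distinct values would do for the remaining cubic polynomial. *)
have := point 0; have := point 1; have := point (-1); have := point 2.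
rewrite n22 (sym 1 0) (sym ord_max 0) (sym ord_max 1) => p2 pm p1 p0.
have NS : N = N 1 1 *: veronese_form.
  apply/matrixP => i j; rewrite [RHS]mxE [veronese_form _ _]mxE.
  move: n22 (sym 1 0) (sym ord_max 0) (sym ord_max 1) p2 pm p1 p0.
  case: (ord3 i) => ->; case: (ord3 j) => -> /=;
  move: (N 0 0) (N 0 1) (N 0 ord_max) (N 1 0) (N 1 1) (N 1 ord_max) (N ord_max 0) (N ord_max 1) (N ord_max ord_max);
  clear => a b c d e k l m n h1 h2 h3 h4 p2 pm p1 p0; lra.
have n11 : N 1 1 = 1.
  have detM : \det M = 1.
    have := GU; rewrite unitmxE unitfE => dG0.
    rewrite /M !det_mulmx det_inv; have -> : \det (rho g) = 1 by case: rep => + _; exact.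
    by rewrite mulr1 mulVf.
  have := congr1 (fun X : 'M[R]_3 => \det X) NS.
  rewrite {1}/N (det_mulmx _ M) (det_mulmx M^T) det_tr detM mulr1 mul1r detZ => e.
  have := veronese_form_unit; rewrite unitmxE unitfE => v0.
  have e3 : N 1 1 ^+ 3 = 1 by apply: (mulIf v0); rewrite -e mul1r.
  exact: expr3_eq1.
move=> x; rewrite -[x](mulKVmx GU) NE NS n11 scale1r conic_formE mulKmx //.
Qed.

Lemma linear_psi_hyperconvex h0 F0 : framed f h0 F0 -> linear_psi f h0 F0 ->
  hyperconvex Gamma rho.
Proof.
move=> fF0 lin0; split; first by exists f.
have [h [F [fF lin linJ]]] := two_linear_pencils dG rep lift irr fF0 lin0.
have [G [GU [hq [hs hinf]]]] := steiner_conic dG rep lift irr fF lin linJ.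
exists (conic_domain G); split; first exact: conic_domain_strictly_convex.
have actW g l : Gamma g -> conic_domain G l -> conic_domain G (act (rho g) l).
  move=> Gg; have gU := rho_unit rep Gg; have v0 := vpick_proj_neq0 l.
  rewrite -(line_vpick l) act_line // !conic_form_line //; last exact: mulmx_neq0.
  by rewrite (conic_form_invariant GU hq hs hinf Gg).
move=> g Gg; apply/seteqP; split=> [_ [l Wl <-]|l Wl]; first exact: actW.
exists (act (rho (invmx g)) l); first by apply: actW => //; exact: (GammaV dG).
have gU := rho_unit rep Gg.
by rewrite (rhoV dG rep) // -actM ?unitmx_inv // mulmxV // act1.
Qed.

End Hyperconvexity.

(** * Angles and Lipschitz maps *)

Section Angle.
Variable R : realType.

(** By the mean value theorem sin x = x cos c with 0 < c < x, and cos c lies between 1/2 and 1. *)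
Lemma sin_between (x : R) : 0 <= x -> x <= pi -> 2^-1 <= cos x ->
  sin x <= x /\ x <= 2 * sin x.
Proof.
move=> x0 xpi cx.
have [->|xn] := eqVneq x 0; first by rewrite sin0 mulr0.
have xp : 0 < x by rewrite lt_neqAle eq_sym xn.
have [c] := MVT xp (fun y _ => is_derive_sin y) (continuous_subspaceT (@continuous_sin R)).
rewrite in_itv /= => /andP[c0 cx'] ; rewrite sin0 !subr0 => ->.
have c1 := cos_le1 c.
have c2 : 2^-1 <= cos c.
  have xm : x \in `[0, pi] by rewrite in_itv /= x0 xpi.
  have cm : c \in `[0, pi] by rewrite in_itv /= (ltW c0) (le_trans (ltW cx')).
  by apply: le_trans cx _; apply: ltW; rewrite ltr_cos.
by split; nra.
Qed.

Lemma sin_le (x : R) : 0 <= x -> sin x <= x.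
Proof.
move=> x0; have [->|xn] := eqVneq x 0; first by rewrite sin0.
have xp : 0 < x by rewrite lt_neqAle eq_sym xn.
have [c _] := MVT xp (fun y _ => is_derive_sin y) (continuous_subspaceT (@continuous_sin R)).
rewrite sin0 !subr0 => ->.
by rewrite -[X in _ <= X]mul1r ler_wpM2r // cos_le1.
Qed.

Variable n : nat.
Implicit Types u v : 'cV[R]_n.+1.

Lemma dotC u v : dot u v = dot v u.
Proof. by rewrite !dotE; apply: eq_bigr => i _; rewrite mulrC. Qed.

(** Lagrange's identity. The left side is the squared sine of the angle times the squared lengths,
    the right side the sum of the squared Plücker coordinates of the plane spanned by u and v. *)
Lemma lagrange u v : dot u u * dot v v - dot u v ^+ 2 =
  2^-1 * \sum_i \sum_j (u i 0 * v j 0 - u j 0 * v i 0) ^+ 2.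
Proof.
have e1 : \sum_i \sum_j (u i 0 ^+ 2 * v j 0 ^+ 2) = dot u u * dot v v.
  rewrite !dotE mulr_suml; apply: eq_bigr => i _; rewrite mulr_sumr.
  by apply: eq_bigr => j _; rewrite !expr2.
have e2 : \sum_i \sum_j (u i 0 * v i 0 * (u j 0 * v j 0)) = dot u v ^+ 2.
  by rewrite expr2 !dotE mulr_suml; apply: eq_bigr => i _; rewrite mulr_sumr.
have e3 : \sum_i \sum_j (u j 0 ^+ 2 * v i 0 ^+ 2) = dot u u * dot v v.
  by rewrite exchange_big.
transitivity (2^-1 * (\sum_i \sum_j (u i 0 ^+ 2 * v j 0 ^+ 2) + \sum_i \sum_j (u j 0 ^+ 2 * v i 0 ^+ 2)
   - 2 * \sum_i \sum_j (u i 0 * v i 0 * (u j 0 * v j 0)))).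
  by rewrite e1 e2 e3; field.
congr (_ * _); rewrite -big_split /= mulr_sumr -sumrB; apply: eq_bigr => i _.
rewrite -big_split /= mulr_sumr -sumrB; apply: eq_bigr => j _.
by ring.
Qed.

Definition cosine u v : R := `|dot u v| / (Num.sqrt (dot u u) * Num.sqrt (dot v v)).

Lemma cosineZl c u v : c != 0 -> cosine (c *: u) v = cosine u v.
Proof.
move=> c0; rewrite /cosine !dotZl dotZr mulrA -expr2 sqrtrM ?sqr_ge0 // sqrtr_sqr normrM.
by rewrite -mulrA -mulf_div divff ?normr_eq0 // mul1r.
Qed.

Lemma cosineC u v : cosine u v = cosine v u.
Proof. by rewrite /cosine dotC [X in _ / X = _]mulrC. Qed.

Lemma dist_line u v : u != 0 -> v != 0 -> dist (line u) (line v) = acos (cosine u v).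
Proof.
move=> u0 v0.
have [c cE] : exists c, vpick (line u) = c *: u.
  by apply/(line_eqP u0 (vpick_proj_neq0 _)); rewrite line_vpick.
have [d dE] : exists d, vpick (line v) = d *: v.
  by apply/(line_eqP v0 (vpick_proj_neq0 _)); rewrite line_vpick.
have c0 : c != 0 by have := vpick_proj_neq0 (line u); rewrite cE scaler_eq0 negb_or => /andP[].
have d0 : d != 0 by have := vpick_proj_neq0 (line v); rewrite dE scaler_eq0 negb_or => /andP[].
rewrite /dist -/(cosine (vpick (line u)) (vpick (line v))) cE dE.
by rewrite cosineZl // cosineC cosineZl // cosineC.
Qed.

Lemma cosine_sqr u v : u != 0 -> v != 0 ->
  1 - cosine u v ^+ 2 = (dot u u * dot v v - dot u v ^+ 2) / (dot u u * dot v v).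
Proof.
move=> u0 v0; have du := dot_gt0 u0; have dv := dot_gt0 v0.
rewrite /cosine expr_div_n exprMn !sqr_sqrtr ?dot_ge0 // real_normK ?num_real //.
by field; rewrite !gt_eqF.
Qed.

Lemma cosine_bounds u v : u != 0 -> v != 0 -> 0 <= cosine u v <= 1.
Proof.
move=> u0 v0; have c0 : 0 <= cosine u v by rewrite divr_ge0 // mulr_ge0 // sqrtr_ge0.
rewrite c0 /= -(@ler_pXn2r _ 2) ?nnegrE // expr1n -subr_ge0 cosine_sqr // lagrange.
rewrite divr_ge0 ?mulr_ge0 ?dot_ge0 //.
by apply: sumr_ge0 => i _; apply: sumr_ge0 => j _; exact: sqr_ge0.
Qed.

Lemma sin_dist u v : u != 0 -> v != 0 ->
  sin (dist (line u) (line v)) ^+ 2 = (dot u u * dot v v - dot u v ^+ 2) / (dot u u * dot v v).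
Proof.
move=> u0 v0; rewrite dist_line // -cosine_sqr //.
have /andP[c0 c1] := cosine_bounds u0 v0.
have cb : -1 <= cosine u v <= 1 by rewrite c1 andbT (le_trans _ c0) // lerN10.
rewrite sin_acos // sqr_sqrtr // subr_ge0.
by rewrite -[X in _ <= X](expr1n _ 2) ler_pXn2r ?nnegrE.
Qed.

Lemma dist_ge0 u v : u != 0 -> v != 0 -> 0 <= dist (line u) (line v).
Proof.
move=> u0 v0; rewrite dist_line //; have /andP[c0 c1] := cosine_bounds u0 v0.
by apply: acos_ge0; rewrite c1 andbT (le_trans _ c0) // lerN10.
Qed.

(** By Lagrange's identity the square of a minor is at most twice the squared sine of the angle, and
    sin x <= x; the constant 2 leaves room. *)
Lemma minor_le_dist u v i j : dot u u = 1 -> dot v v = 1 ->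
  `|u i 0 * v j 0 - u j 0 * v i 0| <= 2 * dist (line u) (line v).
Proof.
move=> u1 v1.
have u0 : u != 0 by rewrite -dot_eq0 u1 oner_eq0.
have v0 : v != 0 by rewrite -dot_eq0 v1 oner_eq0.
have d0 := dist_ge0 u0 v0.
rewrite -(@ler_pXn2r _ 2) ?nnegrE ?mulr_ge0 // real_normK ?num_real //.
have h1 : (u i 0 * v j 0 - u j 0 * v i 0) ^+ 2 <= 2 * sin (dist (line u) (line v)) ^+ 2.
  rewrite sin_dist // lagrange u1 v1 mulr1 divr1 mulrA mulfV ?pnatr_eq0 // mul1r.
  rewrite (bigD1 i) //= (bigD1 j) //= -addrA lerDl addr_ge0 //.
    by apply: sumr_ge0 => k _; exact: sqr_ge0.
  by apply: sumr_ge0 => k _; apply: sumr_ge0 => l _; exact: sqr_ge0.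
apply: le_trans h1 _; rewrite exprMn.
have s1 := sin_le d0.
have s2 : 0 <= sin (dist (line u) (line v)).
  apply: sin_ge0_pi; rewrite d0 dist_line //; have /andP[c0 c1] := cosine_bounds u0 v0.
  by apply: acos_lepi; rewrite c1 andbT (le_trans _ c0) // lerN10.
move: (sin (dist (line u) (line v))) (dist (line u) (line v)) s1 s2 d0 => x y s1 s2 d0.
by nra.
Qed.

End Angle.

(** * Angles between directions of the plane *)

Section Slope.
Variable R : realType.

Definition slope_vector (s : R) : 'cV[R]_2 := \col_i (if i == 0 then 1 else s).

Lemma slope_vector_neq0 s : slope_vector s != 0.
Proof. by apply/eqP => /colP/(_ 0)/eqP; rewrite !mxE oner_eq0. Qed.

Lemma dist_slope (s t : R) : 0 <= s <= 1 -> 0 <= t <= 1 ->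
  dist (line (slope_vector s)) (line (slope_vector t)) <= 2 * `|s - t|.
Proof.
move=> /andP[s0 s1] /andP[t0 t1].
have us := slope_vector_neq0 s; have ut := slope_vector_neq0 t.
have dE x y : dot (slope_vector x) (slope_vector y) = 1 + x * y.
  by rewrite dotE sum2 !mxE /= mul1r.
have d0 := dist_ge0 us ut.
have /andP[c0 c1] := cosine_bounds us ut.
have cb : -1 <= cosine (slope_vector s) (slope_vector t) <= 1.
  by rewrite c1 andbT (le_trans _ c0) // lerN10.
have cosE : cos (dist (line (slope_vector s)) (line (slope_vector t))) = cosine (slope_vector s) (slope_vector t).
  by rewrite dist_line // acosK // in_itv.
have dpi : dist (line (slope_vector s)) (line (slope_vector t)) <= pi.
  by rewrite dist_line // acos_lepi.
have ss : 0 <= s * t by rewrite mulr_ge0.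
(* The numerator 1 + s t is at least 1 and each square root is at most the square root of 2. This
   allows the angle to be bounded by twice its sine. *)
have half : 2^-1 <= cosine (slope_vector s) (slope_vector t).
  rewrite /cosine !dE ger0_norm ?addr_ge0 //.
  have q (x : R) : 0 <= x -> x <= 1 -> 0 < Num.sqrt (1 + x * x) /\ Num.sqrt (1 + x * x) ^+ 2 <= 2.
    move=> x0 x1; have p : 0 < 1 + x * x by rewrite ltr_wpDr ?mulr_ge0.
    by rewrite sqrtr_gt0 sqr_sqrtr ?(ltW p) //; split=> //; nra.
  have [p1 q1] := q s s0 s1; have [p2 q2] := q t t0 t1.
  rewrite ler_pdivlMr ?mulr_gt0 //.
  move: (Num.sqrt _) (Num.sqrt _) p1 q1 p2 q2 => a b p1 q1 p2 q2.
  have h3 := sqr_ge0 (a - b); nra.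
have := @sin_between R _ d0 dpi; rewrite cosE => /(_ half)[_ /le_trans]; apply.
rewrite ler_wpM2l //.
have s2 : 0 <= sin (dist (line (slope_vector s)) (line (slope_vector t))).
  by apply: sin_ge0_pi; rewrite d0 dpi.
rewrite -(@ler_pXn2r _ 2) ?nnegrE // real_normK ?num_real // sin_dist // !dE.
have p1 : 1 <= 1 + s * s by rewrite lerDl mulr_ge0.
have p2 : 1 <= 1 + t * t by rewrite lerDl mulr_ge0.
rewrite ler_pdivrMr; last by rewrite mulr_gt0 // (lt_le_trans ltr01).
have -> : (1 + s * s) * (1 + t * t) - (1 + s * t) ^+ 2 = (s - t) ^+ 2 by ring.
by rewrite ler_peMr ?sqr_ge0 // -[X in X <= _]mulr1 ler_pM.
Qed.

End Slope.

(** * From a Lipschitz limit map to a linear coordinate *)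

Section LipschitzRigidity.
Variables (R : realType) (Gamma : set 'M[R]_2) (rho : 'M[R]_2 -> 'M[R]_3).
Variable f : 'M[R]_2 -> proj 'cV[R]_3 * proj 'cV[R]_3 * proj 'cV[R]_3.
Hypothesis dG : discrete_subgroup Gamma.
Hypothesis rep : representation Gamma rho.
Hypothesis lift : anosov_lift Gamma rho f.
Hypothesis irr : strongly_irreducible Gamma rho.

Lemma act_delta (h : 'M[R]_2) i : SL R 2 h -> act h (line (delta_mx i 0)) = line (col i h).
Proof.
move=> dh; rewrite act_line ?SL_unit // -?colE //.
by apply/eqP => /colP/(_ i)/eqP; rewrite !mxE !eqxx oner_eq0.
Qed.

Lemma col2_neq0 (h : 'M[R]_2) i : SL R 2 h -> col i h != 0.
Proof.
move=> dh; rewrite colE mulmx_neq0 ?SL_unit //.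
by apply/eqP => /colP/(_ i)/eqP; rewrite !mxE !eqxx oner_eq0.
Qed.

(** The two matrices differ on the right by an upper triangular one. Thus the representative chosen
    by [some_rep] has no influence on the limit map. *)
Lemma first_vertex (s : R) h : SL R 2 h -> line (col 0 h) = line (slope_vector s) ->
  (f h).1.1 = (f (horocycle s)).1.1.
Proof.
move=> dh; move=> /esym/(line_eqP (slope_vector_neq0 s) (col2_neq0 0 dh))[c cE].
have h00 : h 0 0 = c by have /colP/(_ 0) := cE; rewrite !mxE mulr1.
have h10 : h 1 0 = c * s by have /colP/(_ 1) := cE; rewrite !mxE.
have [F fF] := framed_exists f (SL_horocycle s).
pose p := horocycle (- s) *m h.
have e : h = horocycle s *m p.
  have [a1 a2 a3 a4] := mx2_entry (1 : R) 0 (- s) 1.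
  have [b1 b2 b3 b4] := mx2_entry (1 : R) 0 s 1.
  rewrite /p mulmxA (_ : horocycle s *m horocycle (- s) = 1%:M) ?mul1mx //.
  by apply: mx2P; rewrite !mulmx2E /horocycle ?(b1, b2, b3, b4) ?(a1, a2, a3, a4) !mxE /=; ring.
have p10 : p 1 0 = 0.
  have [a1 a2 a3 a4] := mx2_entry (1 : R) 0 (- s) 1.
  by rewrite /p mulmx2E /horocycle a3 a4 h00 h10; ring.
have [F' fF'] := framed_exists f dh.
have fF2 : framed f (horocycle s *m p) F' by rewrite -e.
have [k k0 kE] := same_direction dG rep lift fF fF2 p10.
rewrite -[LHS]/(vertex (f h) 0) -[RHS]/(vertex (f (horocycle s)) 0).
have [_ [_ /frameP/(_ 0) <-]] := fF'; have [_ [_ /frameP/(_ 0) <-]] := fF.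
by rewrite kE lineZ // col_neq0 // (framed_unit lift fF).
Qed.

Lemma some_repP (e : 'cV[R]_2) x h : SL R 2 h -> act h (line e) = x ->
  SL R 2 (some_rep e x) /\ act (some_rep e x) (line e) = x.
Proof. by move=> dh hx; apply: (@xgetPex _ 1%:M [set h | SL R 2 h /\ act h (line e) = x]); exists h. Qed.

Lemma eta_plusE s : eta_plus f (line (slope_vector s)) = (f (horocycle s)).1.1.
Proof.
have dh := SL_horocycle s.
have [|dr] := @some_repP (delta_mx 0 0) (line (slope_vector s)) (horocycle s) dh.
  by rewrite act_delta //; congr line; apply/colP => i; rewrite !mxE.
by rewrite act_delta // => /(first_vertex dr).
Qed.

(** Multiplying a representative r on the right by the inverse of the quarter turn brings its last
    vertex to the first place, by [framed_quarter_turn], and its second column to the first, up to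
    sign: eta_- reduces to eta_+. *)
Lemma eta_minusE s : eta_minus f (line (slope_vector s)) = (f (horocycle s)).1.1.
Proof.
pose J := quarter_turn R; pose J' := mx2 (0 : R) 1 (-1) 0.
have [a1 a2 a3 a4] := mx2_entry (0 : R) 1 (-1) 0.
have [b1 b2 b3 b4] := mx2_entry (0 : R) (-1) 1 0.
have [c1 c2 c3 c4] := mx2_entry (1 : R) 0 s 1.
have dJ : SL R 2 J := SL_quarter_turn R.
have dJ' : SL R 2 J' by rewrite /SL /= det2 a1 a2 a3 a4; ring.
have JJ : J' *m J = 1%:M.
  by apply: mx2P; rewrite !mulmx2E /J /J' /quarter_turn ?(b1, b2, b3, b4) ?(a1, a2, a3, a4) !mxE /=; ring.
have dh : SL R 2 (horocycle s *m J') by apply: SL_mul => //; exact: SL_horocycle.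
have [|dr] := @some_repP (delta_mx 1 0) (line (slope_vector s)) (horocycle s *m J') dh.
  rewrite act_delta //; congr line; apply/colP => i; rewrite [LHS]mxE mulmx2E /J' a2 a4.
  by rewrite mulr1 mulr0 addr0 !mxE.
rewrite act_delta // => rE; rewrite /eta_minus /=; set r := some_rep _ _ in dr rE *.
have drJ : SL R 2 (r *m J') by exact: SL_mul.
have [F fF] := framed_exists f drJ.
have fFJ := framed_quarter_turn dG rep lift fF.
have e : r *m J' *m quarter_turn R = r by rewrite -mulmxA JJ mulmx1.
rewrite e in fFJ.
have -> : (f r).2 = (f (r *m J')).1.1.
  rewrite -[LHS]/(vertex (f r) ord_max) -[RHS]/(vertex (f (r *m J')) 0).
  have [_ [_ /frameP/(_ ord_max) <-]] := fFJ; have [_ [_ /frameP/(_ 0) <-]] := fF.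
  congr line; apply/colP => i; rewrite [LHS]mxE mul_antidiag [RHS]mxE.
  by congr (F _ _); exact: val_inj.
apply: first_vertex => //.
have -> : col 0 (r *m J') = (-1) *: col 1 r.
  by apply/colP => i; rewrite [LHS]mxE mulmx2E /J' a1 a3 !mxE; ring.
by rewrite lineZ ?oppr_eq0 ?oner_eq0 ?col2_neq0.
Qed.

Lemma framed_renormalizable h F B : framed f h F ->
  (forall k, SL R 2 k -> exists2 g, Gamma g & nrm2 (g *m k) <= B) ->
  renormalizable (framed_ball f B) (fun p => psi f p.1 p.2) (psi f h F).
Proof.
move=> fF hB s0 r r0; have [dh _] := fF.
pose q := Num.sqrt r; have q0 : 0 < q by rewrite sqrtr_gt0.
have qn : q != 0 by rewrite gt_eqF.
have q2 : q ^+ 2 = r by rewrite sqr_sqrtr // ltW.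
(* Here l_10 / l_00 = s0 and 1 / l_00^2 = r, so [renormalization] produces exactly the zoom at s0 of
   ratio r. *)
pose l := mx2 q^-1 0 (s0 / q) q.
have [l1 l2 l3 l4] := mx2_entry q^-1 0 (s0 / q) q.
have dl : SL R 2 l by rewrite /SL /= det2 l1 l2 l3 l4 mulVf // mul0r subr0.
have dhl : SL R 2 (h *m l) by exact: SL_mul.
have [g Gg gB] := hB _ dhl.
have dk : SL R 2 (g *m (h *m l)) by apply: SL_mul => //; exact: (Gamma_SL dG).
have [F' fF'] := framed_exists f dk.
exists (g *m (h *m l), F'); first by split.
have [c cE] := renormalization dG rep lift fF Gg dl l2 fF'.
exists c => s /=; rewrite cE /l l1 l3.
have -> : s0 / q / q^-1 = s0 by field.
by have -> : s / q^-1 ^+ 2 = r * s by rewrite -q2; field.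
Qed.

(** The denominators of psi are bounded away from 0 on [0, 1] by compactness, and the numerator of a
    difference of two values is a combination of minors of two unit vectors, which the angle between
    the lines controls. *)
Lemma psi_lipschitz L F : framed f 1%:M F ->
  (forall s t, 0 <= s <= 1 -> 0 <= t <= 1 ->
    dist (f (horocycle s)).1.1 (f (horocycle t)).1.1 <= L * `|s - t|) ->
  exists C, forall s t, 0 <= s <= 1 -> 0 <= t <= 1 ->
    `|psi f 1%:M F s - psi f 1%:M F t| <= C * `|s - t|.
Proof.
move=> fF hL; have FU := framed_unit lift fF.
have [e e0 he] : exists2 e, 0 < e & forall s, s \in `[0, 1] -> e <= pencil f 1%:M F s 0 0.
  have [||e e0 he] := @compact_ge_bound R R `[0, 1]%classic (fun s => pencil f 1%:M F s 0 0) (@segment_compact _ _ _).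
  - apply: continuous_subspaceT; apply: continuous_filterP => s H FH Hs.
    apply: (@cvg_pencil _ _ _ _ lift R H _ (fun=> 1%:M) (fun=> F) id) => //.
    + exact: filterE.
    + exact: cvg_cst.
    + exact: cvg_cst.
  - move=> s _; rewrite lt_neqAle eq_sym (pencil_neq0 dG rep lift s fF) /=.
    have [F1 fF1] := framed_exists f (SL_mul (SL1 R 2) (SL_horocycle s)).
    by rewrite (pencilE _ _ _ fF1) -expr2 sqr_ge0.
  - by exists e.
pose a k := invmx F 0 k; pose b k := invmx F 1 k.
pose M := \sum_k \sum_l `|b k * a l|.
exists (M * (2 * L) / e) => s t si ti.
have frame_at u : exists U, framed f (1%:M *m horocycle u) U.
  exact: (framed_exists f (SL_mul (SL1 R 2) (SL_horocycle u))).
have [U fU] := frame_at s; have [W fW] := frame_at t.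
have one10 : (1%:M : 'M[R]_2) 1 0 = 0 by rewrite mxE.
have fU1 : framed f (1%:M *m horocycle s *m 1%:M) U by rewrite mulmx1.
have fW1 : framed f (1%:M *m horocycle t *m 1%:M) W by rewrite mulmx1.
have [X0 ->] := psiE dG rep lift fF (SL1 R 2) one10 fU1.
have [Y0 ->] := psiE dG rep lift fF (SL1 R 2) one10 fW1.
have hX : e <= coord F (col 0 U) 0 ^+ 2 by rewrite expr2 -(pencilE _ _ _ fU); apply: he; rewrite in_itv.
have hY : e <= coord F (col 0 W) 0 ^+ 2 by rewrite expr2 -(pencilE _ _ _ fW); apply: he; rewrite in_itv.
have hXY : e <= `|coord F (col 0 U) 0 * coord F (col 0 W) 0|.
  rewrite -(@ler_pXn2r _ 2) ?nnegrE ?(ltW e0) // real_normK ?num_real // exprMn expr2.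
  by rewrite ler_pM // ltW.
(* The numerator becomes a minor of the two coordinate vectors, bilinear and alternating in the unit
   vectors, so that arbitrary signs of these do not matter. *)
have -> : coord F (col 0 U) 1 / coord F (col 0 U) 0 - coord F (col 0 W) 1 / coord F (col 0 W) 0 =
  (coord F (col 0 U) 1 * coord F (col 0 W) 0 - coord F (col 0 W) 1 * coord F (col 0 U) 0) /
  (coord F (col 0 U) 0 * coord F (col 0 W) 0) by field; rewrite X0 Y0.
rewrite normrM normfV.
have M0 : 0 <= M by apply: sumr_ge0 => k _; apply: sumr_ge0.
have num : `|coord F (col 0 U) 1 * coord F (col 0 W) 0 - coord F (col 0 W) 1 * coord F (col 0 U) 0| <= M * (2 * L) * `|s - t|.
  have -> : coord F (col 0 U) 1 * coord F (col 0 W) 0 - coord F (col 0 W) 1 * coord F (col 0 U) 0 =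
     \sum_k \sum_l b k * a l * (col 0 U k 0 * col 0 W l 0 - col 0 U l 0 * col 0 W k 0).
    rewrite /coord ![(invmx F *m _) _ _]mxE !mulr_suml -sumrB; apply: eq_bigr => k _.
    rewrite !mulr_sumr -sumrB; apply: eq_bigr => l _; rewrite /a /b; ring.
  apply: le_trans (ler_norm_sum _ _ _) _; rewrite -mulrA mulr_suml ler_sum // => k _.
  apply: le_trans (ler_norm_sum _ _ _) _; rewrite mulr_suml ler_sum // => l _.
  rewrite normrM ler_wpM2l //.
  have [_ [u1 /frameP/(_ 0) eU]] := fU; have [_ [w1 /frameP/(_ 0) eW]] := fW.
  apply: le_trans (minor_le_dist _ _ (u1 0) (w1 0)) _.
  by rewrite -mulrA ler_wpM2l // eU eW !mul1mx; exact: hL.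
have xy0 : 0 < `|coord F (col 0 U) 0 * coord F (col 0 W) 0| by apply: lt_le_trans hXY.
apply: le_trans (ler_wpM2r _ num) _; first by rewrite invr_ge0.
rewrite [X in _ <= X]mulrAC; apply: ler_wpM2l; first exact: le_trans num.
by rewrite lef_pV2 ?posrE.
Qed.

(** Both limit maps restrict to the same curve in the chart [1 : s], so one argument covers them. A
    Lipschitz bound on the arc 0 <= s <= 1 is enough to start: the zooms carry it to a linear psi on
    the whole line, at some point of the compact family. *)
Lemma lipschitz_hyperconvex (eta : proj 'cV[R]_2 -> proj 'cV[R]_3) :
  (forall s, eta (line (slope_vector s)) = (f (horocycle s)).1.1) ->
  lipschitz_map eta -> hyperconvex Gamma rho.
Proof.
move=> etaE [L hL].
have [B hB] := cocompact dG rep lift.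
have [F fF] := framed_exists f (SL1 R 2).
have [|C hC] := @psi_lipschitz (`|L| * 2) F fF.
  move=> s t si ti; rewrite -!etaE; apply: le_trans (hL _ _) _.
  have d0 := dist_ge0 (slope_vector_neq0 s) (slope_vector_neq0 t).
  apply: le_trans (ler_wpM2r d0 (ler_norm L)) _.
  by rewrite -mulrA ler_wpM2l // dist_slope.
have cK : compact (framed_ball f B) by exact: (framed_ball_compact lift).
have clK : closed (framed_ball f B).
  by apply: (compact_closed _ cK); exact: (@norm_hausdorff R ('M[R]_2 * 'M[R]_3)%type).
have [|||p [fp _] lin] := @lipschitz_linear R _ (framed_ball f B) (fun p => psi f p.1 p.2) cK clK _ _ (psi f 1%:M F) C _ (framed_renormalizable fF hB) hC.
- by move=> s; exact: (psi_continuous dG rep lift).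
- by move=> q [fq _]; exact: (psi0 dG rep lift fq).
- by move=> q [fq _]; exact: framed_renormalizable.
exact: (linear_psi_hyperconvex dG rep lift irr fp lin).
Qed.

End LipschitzRigidity.

Theorem corollary7p2 (R : realType) (S : closed_surface) (Gamma : set 'M[R]_2)
    (rho : 'M[R]_2 -> 'M[R]_3) :
  (euler_characteristic S < 0)%R ->
  is_fundamental_group S Gamma ->
  discrete_subgroup Gamma ->
  representation Gamma rho ->
  anosov Gamma rho ->
  ~ hyperconvex Gamma rho ->
  strongly_irreducible Gamma rho ->
  forall f, anosov_lift Gamma rho f ->
    ~ lipschitz_map (eta_plus f) /\ ~ lipschitz_map (eta_minus f).
Proof.
move=> _ _ dG rep _ nh irr f lift; split=> lip; apply: nh.
- exact: (lipschitz_hyperconvex dG rep lift irr (eta_plusE dG rep lift)).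
- exact: (lipschitz_hyperconvex dG rep lift irr (eta_minusE dG rep lift)).
Qed.
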